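(* Let $c=(1\,2\cdots n)\in\mathfrak{S}_n$. Let $L$ be an oriented link with $d$ components, and let $\boldsymbol\beta_L\in\mathbf{B}_n$ be a braid whose closure is $L$. Let $\beta_L$ be the image of $\boldsymbol\beta_L$ in $\mathfrak{S}_n$ (which has $d$ cycles), and let $\lambda=(\lambda_1\ge\cdots\ge\lambda_d)$ be its cycle type. Set $m_0=0$ and $m_j=\lambda_1+\cdots+\lambda_j$ for $1\le j\le d$, and define $$c_\lambda=\prod_{j=1}^d(m_{j-1}+1\;\;m_{j-1}+2\;\;\cdots\;\;m_j)\in\mathfrak{S}_n.$$ Choose $g\in\mathfrak{S}_n$ with $g\beta_Lg^{-1}=c_\lambda$, and choose a braid lift $\mathbf{g}\in\mathbf{B}_n$ of $g$. Suppose $$\boldsymbol\rho_L:=\mathbf{g}\boldsymbol\beta_L\mathbf{g}^{-1}\mathbf{B}(c_\lambda)^{-1}=\mathbb{P}_c(t_1)^{\epsilon_1}\cdots\mathbb{P}_c(t_M)^{\epsilon_M},$$ where $\vec t=(t_1,\ldots,t_M)\in T^M$ and $\vec\epsilon=(\epsilon_1,\ldots,\epsilon_M)\in\{\pm1\}^M$. Then $$z^{d-1}\,\mathrm{HOMFLYPT}(L;a,z)\Big|_{z=0}=\sum_{k=0}^{n-1}(-1)^{n-1+k}\sum_{u\in\mathfrak{S}_{n,k}}\mathrm{sub}_T^{(1^{\ell(u)},\vec\epsilon)}\big(\mathrm{rev}(\mathrm{inv}_c(u))\,\vec t,\;c_\lambda^{-1}\big)\,a^{-\mathrm{wr}(\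boldsymbol\beta_L)-n+1+2k}.$$
   Context: Symmetric group: $\mathfrak{S}_n$ is the symmetric group on $\{1,\ldots,n\}$ with simple reflections $s_i=(i\;i+1)$, $1\le i\le n-1$, so $c=s_1s_2\cdots s_{n-1}$; $\ell$ is Coxeter length (number of inversions); $T$ is the set of transpositions; $\ell_T(w)$ is the least number of transpositions with product $w$; $w_\circ$ is the longest element. $\mathrm{Des}(u)=\{s_i:\ell(us_i)<\ell(u)\}$ and $\mathfrak{S}_{n,k}=\{u\in\mathfrak{S}_n:\mathrm{Des}(u)=\{s_1,\ldots,s_k\}\}$. Braid group: $\mathbf{B}_n$ is the $n$-strand braid group with Artin generators $\mathbf{s}_1,\ldots,\mathbf{s}_{n-1}$; $\mathbf{s}_i\mapsto s_i$ defines the surjection to $\mathfrak{S}_n$, and a lift of $w$ is a preimage of $w$. If $(s_{i_1},\ldots,s_{i_k})$ is a reduced word for $w$, then $\mathbf{B}(w)=\mathbf{s}_{i_1}\cdots\mathbf{s}_{i_k}$. $\mathrm{wr}(\boldsymbol\beta)$ (writhe) is the sum of the exponents in any expression of $\boldsymbol\beta$ as a product of Artin generators and inverses. For $i<j$, the $c$-dual lift of $(i\,j)$ is $\mathbf{t}_{(ij)}=\mathbf{s}_i\cdots\mathbf{s}_{j-2}\mathbf{s}_{j-1}\mathbf{s}_{j-2}^{-1}\cdots\mathbf{s}_i^{-1}$, and $\mathbb{P}_c((i\,j))=\mathbf{t}_{(ij)}^2$. HOMFLYPT: $\mathrm{HOMFLYPT}(L;a,z)\in\mathbb{Z}[a^{\pm1},z^{\pm1}]$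 is the invariant of oriented links with value $1$ on the unknot and satisfying $a\,\mathrm{HOMFLYPT}(L_+)-a^{-1}\,\mathrm{HOMFLYPT}(L_-)=z\,\mathrm{HOMFLYPT}(L_0)$, where $L_+,L_-,L_0$ differ only inside a small disk as a positive crossing, a negative crossing, and the oriented smoothing. In a braid closure, $\mathbf{s}_i$ gives a positive crossing. Inversions: the inversion sequence of a word $(r_1,\ldots,r_k)$ in simple reflections is $(t_1,\ldots,t_k)$ with $t_i=r_1\cdots r_{i-1}r_ir_{i-1}\cdots r_1$. The $c$-sorting word of $w_\circ$ is the lexicographically first subword of $\mathsf{c}\mathsf{c}\mathsf{c}\cdots$, $\mathsf{c}=(s_1,\ldots,s_{n-1})$, that is a reduced word for $w_\circ$; its inversion sequence lists every transposition once. For $u\in\mathfrak{S}_n$, $\mathrm{Inv}(u)=\{t\in T:\ell(tu)<\ell(u)\}$, and $\mathrm{inv}_c(u)$ is the restriction of that inversion sequence to $\mathrm{Inv}(u)$ (a sequence of length $\ell(u)$). $\mathrm{rev}$ reverses a sequence; juxtaposition of sequences is concatenation. $(1^k,\vec\epsilon)=(1,\ldots,1,\epsilon_1,\ldots,\epsilon_M)$ with $k$ ones. Signed subword count: for $\vec a=(a_1,\ldots,a_M)\in T^M$, $\vec\eta\in\{\pm1\}^M$, $\pi\in\mathfrak{S}_n$, and $k=\ell_T(\pi)$, $$\mathrm{sub}_T^{\vec\eta}(\vec a,\pi)=\sum_{\substack{1\le i_1<\cdots<i_k\le M\\ a_{i_1}\cdots a_{i_k}=\pi}}\ \prod_{j=1}^{k}\eta_{i_j}.$$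 *)

(* Defs.v *)
(* All indices are 0-based: n is r.+1, so permutations live in 'S_r.+1, the
   simple reflections and Artin generators are indexed by 'I_r, and (i j) with
   1 <= i < j <= n is stored shifted by 1. *)
From HB Require Import structures.
From Stdlib Require Import Relation_Operators.
From mathcomp Require Import all_boot all_order all_fingroup all_algebra.

Set Implicit Arguments.
Unset Strict Implicit.
Unset Printing Implicit Defensive.

Import Order.TTheory GRing.Theory Num.Theory.

(* One application of a relation on words inside a larger word. *)
Definition in_context (T : Type) (R : seq T -> seq T -> Prop) (w w' : seq T) :=
  exists p q x y, [/\ R x y, w = p ++ x ++ q & w' = p ++ y ++ q].

(* Products of permutations are composed from right to left, so that
   s_1 s_2 ... s_(n-1) = (1 2 ... n); the product of perm.v is the opposite. *)
Definition pcomp (T : finType) (u v : {perm T}) : {perm T} := (v * u)%g.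

Notation "u ∘ v" := (pcomp u v) (at level 40, left associativity).

Lemma pcompE (T : finType) (u v : {perm T}) x : (u ∘ v) x = u (v x).
Proof. by rewrite permM. Qed.

Definition perm_product (T : finType) (ws : seq {perm T}) : {perm T} :=
  foldr (@pcomp T) 1%g ws.

Definition simple_refl (r i : nat) : 'S_r.+1 :=
  tperm (inord i) (inord i.+1).

Definition coxeter_length (r : nat) (u : 'S_r.+1) : nat :=
  #|[set p : 'I_r.+1 * 'I_r.+1 | (p.1 < p.2) && (u p.2 < u p.1)]|.

Definition reduced_word (r : nat) (v : seq nat) (w : 'S_r.+1) : bool :=
  [&& all (fun i => i < r) v, perm_product [seq simple_refl r i | i <- v] == w
    & size v == coxeter_length w].

Definition longest (r : nat) : 'S_r.+1 := perm (@rev_ord_inj r.+1).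

Definition descents (r : nat) (u : 'S_r.+1) : {set 'I_r} :=
  [set i : 'I_r | coxeter_length (u ∘ simple_refl r i) < coxeter_length u].

(* The set of u whose descents are exactly the first k simple reflections. *)
Definition initial_descents (r k : nat) : {set 'S_r.+1} :=
  [set u : 'S_r.+1 | descents u == [set i : 'I_r | i < k]].

Definition transp (r : nat) : Type :=
  {p : 'I_r.+1 * 'I_r.+1 | p.1 < p.2}.

Definition transp_perm (r : nat) (t : transp r) : 'S_r.+1 :=
  tperm (val t).1 (val t).2.

Definition is_transp_product (r k : nat) (w : 'S_r.+1) : bool :=
  [exists ts : k.-tuple ('I_r.+1 * 'I_r.+1),
     all (fun p => p.1 != p.2) ts
     && (perm_product [seq tperm p.1 p.2 | p <- ts] == w)].

Lemma is_transp_product_ex (r : nat) (w : 'S_r.+1) :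
  exists k, is_transp_product k w.
Proof.
have [ts -> ts_neq] := prod_tpermP w.
exists (size (rev ts)); apply/existsP; exists (in_tuple (rev ts)).
rewrite /= all_rev ts_neq /=; apply/eqP.
elim: ts {ts_neq} => [|t ts IHts]; first by rewrite big_nil.
rewrite big_cons rev_cons map_rcons -cats1 /perm_product foldr_cat /=.
rewrite -IHts /perm_product {IHts}; move: (map _ _) => ws.
elim: ws => [|w0 ws /= ->]; first by rewrite /= /pcomp mul1g mulg1.
by rewrite /pcomp mulgA.
Qed.

Definition reflection_length (r : nat) (w : 'S_r.+1) : nat :=
  ex_minn (is_transp_product_ex w).

Definition cycle_perm (T : finType) (s : seq T) : {perm T} :=
  perm (can_inj (prev_next (undup_uniq s))).

(* Sizes of all cycles, fixed points included, in weakly decreasing order. *)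
Definition cycle_type (r : nat) (w : 'S_r.+1) : seq nat :=
  sort geq [seq #|(A : {set 'I_r.+1})| | A <- enum (porbits w)].

(* The j-th block of consecutive entries is m_(j-1), ..., m_j - 1, where
   m_j = sumn (take j lam). *)
Definition c_lambda (r : nat) (lam : seq nat) : 'S_r.+1 :=
  perm_product [seq cycle_perm
               [seq inord x | x <- iota (sumn (take j lam)) (nth 0 lam j)]
        | j <- iota 0 (size lam)].

(* A subword of ccc... is given by its strictly increasing list of positions;
   the letter at position p is simple reflection number p %% r. *)
Definition sorting_letters (r : nat) (ps : seq nat) : seq nat :=
  [seq p %% r | p <- ps].

Definition longest_subword (r : nat) (ps : seq nat) : bool :=
  sorted ltn ps && reduced_word (sorting_letters r ps) (longest r).

Definition is_c_sorting (r : nat) (ps : seq nat) : Prop :=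
  longest_subword r ps
  /\ forall qs, longest_subword r qs -> ((ps : seqlexi nat) <= qs)%O.

Definition inversion_sequence (r : nat) (v : seq nat) : seq 'S_r.+1 :=
  [seq perm_product [seq simple_refl r i | i <- take k.+1 v ++ rev (take k v)]
  | k <- iota 0 (size v)].

(* The restriction to Inv(u) of the inversion sequence of the word v. *)
Definition inv_seq (r : nat) (v : seq nat) (u : 'S_r.+1) : seq 'S_r.+1 :=
  [seq t <- inversion_sequence r v
  | coxeter_length (t ∘ u) < coxeter_length u].

Definition sign_val (b : bool) : int := if b then 1%R else (-1)%R.

Definition sub_T (r : nat) (eta : seq int) (s : seq 'S_r.+1)
    (w : 'S_r.+1) : int :=
  (\sum_(I : {set 'I_(size s)}
         | (#|I| == reflection_length w)
           && (perm_product [seq nth 1%g s i | i : 'I_(size s) <- enum I] == w))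
     \prod_(i in I) nth 0 eta i)%R.

(* (i, true) is the Artin generator number i and (i, false) its inverse; the
   elements of the braid group are words up to braid_eq. *)
Definition braid_word (r : nat) : Type := seq ('I_r * bool).

Inductive braid_relation (r : nat) : braid_word r -> braid_word r -> Prop :=
| BraidCancel i e : braid_relation [:: (i, e); (i, ~~ e)] [::]
| BraidComm (i j : 'I_r) : i.+1 < j ->
    braid_relation [:: (i, true); (j, true)] [:: (j, true); (i, true)]
| BraidBraid (i j : 'I_r) : j = i.+1 :> nat ->
    braid_relation [:: (i, true); (j, true); (i, true)]
                   [:: (j, true); (i, true); (j, true)].

Definition braid_eq (r : nat) : braid_word r -> braid_word r -> Prop :=
  clos_refl_sym_trans _ (in_context (@braid_relation r)).

Definition braid_inv (r : nat) (b : braid_word r) : braid_word r :=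
  rev [seq (x.1, ~~ x.2) | x <- b].

Definition braid_perm (r : nat) (b : braid_word r) : 'S_r.+1 :=
  perm_product [seq simple_refl r x.1 | x : 'I_r * bool <- b].

Definition writhe (r : nat) (b : braid_word r) : int :=
  (\sum_(x <- b) sign_val x.2)%R.

Definition positive_braid (r : nat) (v : seq 'I_r) : braid_word r :=
  [seq (i, true) | i <- v].

(* For t = (i j): conjugate of generator j-1 by generators i, ..., j-2. *)
Definition dual_lift (r : nat) (t : transp r) : braid_word r :=
  let: (i, j) := val t in
  let x := positive_braid [seq k : 'I_r <- enum 'I_r | i <= k < j.-1] in
  x ++ positive_braid [seq k : 'I_r <- enum 'I_r | k == j.-1 :> nat]
    ++ braid_inv x.

Definition dual_pure (r : nat) (t : transp r) : braid_word r :=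
  dual_lift t ++ dual_lift t.

Definition braid_sign (r : nat) (b : braid_word r) (e : bool) : braid_word r :=
  if e then b else braid_inv b.

(* An oriented link diagram in the plane, in general position with respect to
   the height function, is read from bottom to top as a word in local minima
   (cups), local maxima (caps) and crossings.  The number i in (k, i) counts
   the strands to the left.  A horizontal line not through one of these points
   sees a sequence of strands, oriented upwards (true) or downwards (false).
   - Cup b creates strands with orientations b, ~~ b;
   - in Cross e, the strand going from bottom left to top right is over the
     other one if e = true, and under it if e = false. *)
Inductive event := Cup of bool | Cap | Cross of bool.

Definition letter : Type := event * nat.

Definition arity (k : event) : nat := if k is Cup _ then 0 else 2.
Definition coarity (k : event) : nat := if k is Cap then 0 else 2.

(* Replaces the m entries of s starting at position i by new. *)
Definition splice (T : Type) (i m : nat) (new s : seq T) : seq T :=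
  take i s ++ new ++ drop (i + m) s.

Definition step (l : letter) (s : seq bool) : option (seq bool) :=
  let: (k, i) := l in
  let x := nth true s i in
  let y := nth true s i.+1 in
  if i + arity k <= size s then
    match k with
    | Cup b => Some (splice i 0 [:: b; ~~ b] s)
    | Cap => if x != y then Some (splice i 2 [::] s) else None
    | Cross _ => Some (splice i 2 [:: y; x] s)
    end
  else None.

Definition run (w : seq letter) (s : seq bool) : option (seq bool) :=
  foldl (fun o l => obind (step l) o) (Some s) w.

Record link_diagram := LinkDiagram {
  diagram_word : seq letter;
  diagram_closed : run diagram_word [::] == Some [::]
}.

HB.instance Definition _ := [isSub for diagram_word].

(* Planar isotopies and Reidemeister moves.  The orientations of the incoming
   strands are arbitrary, up to both sides having to occur in closed diagrams. *)
Inductive diagram_move : seq letter -> seq letter -> Prop :=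
(* two events side by side, with m strands in between, exchange heights *)
| MoveFar k l i m :
    diagram_move [:: (k, i); (l, i + coarity k + m)]
                 [:: (l, i + arity k + m); (k, i)]
| MoveZigzagL b i : diagram_move [:: (Cup b, i); (Cap, i.+1)] [::]
| MoveZigzagR b i : diagram_move [:: (Cup b, i.+1); (Cap, i)] [::]
(* a strand crossing one leg of a cup or cap moves to the other leg *)
| MoveSlideCup b e i :
    diagram_move [:: (Cup b, i); (Cross e, i.+1)]
                 [:: (Cup b, i.+1); (Cross (~~ e), i)]
| MoveSlideCap e i :
    diagram_move [:: (Cross e, i); (Cap, i.+1)]
                 [:: (Cross (~~ e), i.+1); (Cap, i)]
| MoveR1 b e i :
    diagram_move [:: (Cup b, i.+1); (Cross e, i); (Cap, i.+1)] [::]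
| MoveR2 e i : diagram_move [:: (Cross e, i); (Cross (~~ e), i)] [::]
| MoveR3 e i :
    diagram_move [:: (Cross e, i); (Cross e, i.+1); (Cross e, i)]
                 [:: (Cross e, i.+1); (Cross e, i); (Cross e, i.+1)].

(* Two diagrams represent the same oriented link. *)
Definition isotopic : link_diagram -> link_diagram -> Prop :=
  clos_refl_sym_trans _
    (fun D D' => in_context diagram_move (diagram_word D) (diagram_word D')).

(* Strands carry labels, those of a cup being fresh; a cap either closes up a
   component or identifies the labels of the two strands it joins. *)
Fixpoint count_components (w : seq letter) (fresh : nat) (s : seq nat) : nat :=
  if w is (k, i) :: w' then
    let x := nth 0 s i in
    let y := nth 0 s i.+1 in
    match k with
    | Cup _ => count_components w' fresh.+1 (splice i 0 [:: fresh; fresh] s)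
    | Cross _ => count_components w' fresh (splice i 2 [:: y; x] s)
    | Cap => (x == y) + count_components w' fresh
               [seq if l == y then x else l | l <- splice i 2 [::] s]
    end
  else 0.

Definition num_components (D : link_diagram) : nat :=
  count_components (diagram_word D) 0 [::].

(* Braid closure: the r.+1 upward strands of the braid are on the left, and are
   closed up by r.+1 nested arcs to the right.  Generators become positive
   crossings. *)
Definition closure_word (r : nat) (b : braid_word r) : seq letter :=
  [seq (Cup true, i) | i <- iota 0 r.+1]
  ++ [seq (Cross x.2, nat_of_ord x.1) | x : 'I_r * bool <- b]
  ++ [seq (Cap, i) | i <- rev (iota 0 r.+1)].

Lemma run_cat w w' s : run (w ++ w') s = obind (run w') (run w s).
Proof.
rewrite /run foldl_cat; case: (foldl _ _ w) => //=.
by elim: w'.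
Qed.

Lemma step_cup b s1 s2 :
  step (Cup b, size s1) (s1 ++ s2) = Some (s1 ++ [:: b, ~~ b & s2]).
Proof.
by rewrite /step addn0 size_cat leq_addr /splice addn0 take_size_cat //
           drop_size_cat.
Qed.

Lemma step_cap x s1 s2 :
  step (Cap, size s1) (s1 ++ [:: x, ~~ x & s2]) = Some (s1 ++ s2).
Proof.
rewrite /step size_cat leq_add2l /= !nth_cat ltnn ltnNge leqnSn subnn subSnn /=.
rewrite /splice take_size_cat // drop_cat ltnNge leq_addr addKn /= drop0.
by case: x.
Qed.

Lemma step_cross e x y s1 s2 :
  step (Cross e, size s1) (s1 ++ [:: x, y & s2]) = Some (s1 ++ [:: y, x & s2]).
Proof.
rewrite /step size_cat leq_add2l /= !nth_cat ltnn ltnNge leqnSn subnn subSnn /=.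
by rewrite /splice take_size_cat // drop_cat ltnNge leq_addr addKn /= drop0.
Qed.

Lemma closure_closed (r : nat) (b : braid_word r) :
  run (closure_word b) [::] == Some [::].
Proof.
pose st n := nseq n true ++ nseq n false.
have nseqSr n : nseq n.+1 true = nseq n true ++ [:: true].
  by rewrite -addn1 nseqD.
have stS n : st n.+1 = nseq n true ++ [:: true, false & nseq n false].
  by rewrite /st nseqSr -catA.
have st_cups n : run [seq (Cup true, i) | i <- iota 0 n] [::] = Some (st n).
  elim: n => [//|n IHn]; rewrite -[in iota _ _]addn1 iotaD map_cat run_cat IHn.
  by have := step_cup true (nseq n true) (nseq n false); rewrite size_nseq -stS.
have st_caps n : run [seq (Cap, i) | i <- rev (iota 0 n)] (st n) = Some [::].
  elim: n => [//|n IHn]; rewrite -[in iota _ _]addn1 iotaD rev_cat map_cat.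
  rewrite run_cat stS; set o := run _ (_ ++ _); suff -> : o = Some (st n) by [].
  by have := step_cap true (nseq n true) (nseq n false); rewrite size_nseq.
have st_cross : run [seq (Cross x.2, nat_of_ord x.1) | x : 'I_r * bool <- b]
                    (st r.+1) = Some (st r.+1).
  elim: b => [//|[i e] b IHb]; rewrite -cat1s map_cat run_cat.
  set o := run _ (st _); suff -> : o = Some (st r.+1) by [].
  rewrite {}/o; have -> : st r.+1 = nseq i true ++
      [:: true, true & nseq (r - i.+1) true ++ nseq r.+1 false].
    have lt_ir := ltn_ord i.
    rewrite -[true :: _]/(nseq 2 true ++ nseq (r - i.+1) true ++ _) /st !catA.
    by rewrite -!nseqD addn2 addSn subnKC.
  have := step_cross e true true (nseq i true).
  by rewrite size_nseq => /(_ (nseq (r - i.+1) true ++ nseq r.+1 false)).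
rewrite run_cat st_cups -[obind _ _]/(run _ _) run_cat st_cross.
by rewrite -[obind _ _]/(run _ _) st_caps.
Qed.

Definition braid_closure (r : nat) (b : braid_word r) : link_diagram :=
  LinkDiagram (closure_closed b).

(* The ring Z[a^+-1, z^+-1] inside its fraction field; the outer variable of
   {poly {poly int}} is z and the inner one is a. *)
Definition laurent_field : fieldType := {fraction {poly {poly int}}}.

Definition frac_of (p : {poly {poly int}}) : laurent_field := tofrac p.

Definition var_a : laurent_field := frac_of ('X%:P)%R.
Definition var_z : laurent_field := frac_of 'X%R.

Definition is_laurent (x : laurent_field) : Prop :=
  exists m p, x = (frac_of p / (var_a * var_z) ^+ m)%R.

(* x lies in Z[a^+-1][z] and y is its value at z = 0. *)
Definition value_at_z0 (x y : laurent_field) : Prop :=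
  exists m (p : {poly {poly int}}),
    x = (frac_of p / var_a ^+ m)%R /\ y = (frac_of (p.[0])%:P / var_a ^+ m)%R.

Definition unknot : link_diagram :=
  @LinkDiagram [:: (Cup true, 0); (Cap, 0)] isT.

(* For a crossing (Cross e, i) between strands whose orientations, just below
   it, are x and y: it is positive iff e = (x == y), and its oriented smoothing
   is vertical if x = y and horizontal otherwise. *)
Definition smoothing (i : nat) (x y : bool) : seq letter :=
  if x == y then [::] else [:: (Cap, i); (Cup y, i)].

Definition skein_triple (Lp Lm L0 : link_diagram) : Prop :=
  exists p q s i,
    let x := nth true s i in
    let y := nth true s i.+1 in
    [/\ run p [::] = Some s,
        diagram_word Lp = p ++ (Cross (x == y), i) :: q,
        diagram_word Lm = p ++ (Cross (x != y), i) :: q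
      & diagram_word L0 = p ++ smoothing i x y ++ q].

Record is_HOMFLYPT (P : link_diagram -> laurent_field) : Prop := {
  HOMFLYPT_laurent : forall D, is_laurent (P D);
  HOMFLYPT_isotopic : forall D D', isotopic D D' -> P D = P D';
  HOMFLYPT_unknot : P unknot = 1%R;
  HOMFLYPT_skein : forall Lp Lm L0, skein_triple Lp Lm L0 ->
    (var_a * P Lp - var_a^-1 * P Lm = var_z * P L0)%R
}.

(* Main.v *)
(* The Hecke algebra with T_i - T_i^-1 = z carries the trace tau (coefficient
   of 1) and the commuting multiplicative Jucys-Murphy elements L_2, ..., L_n.
   The function tau(b prod_j (a L_j - a^-1)) obeys the skein relation, is
   cyclic and behaves well under stabilization; hence, up to a power of z, it
   is the HOMFLYPT polynomial of the closure of b, normalized by the writhe.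
   Expand the product over subsets K of {2, ..., n}: these correspond to the
   elements u of the sets S_{n,k}, and the product of the L_j with j in K is
   the product of the P_c(t) over the inversions t of u.
   Since P_c(t)^{+-1} = 1 +- z t^{+-1} in the Hecke algebra, each term becomes
   a sum over subwords of tau(t_1 ... t_k B(c_lambda)).  The trace of a lift of
   w is divisible by z^l_T(w), so the lowest order in z only sees the subwords
   along which l_T drops at each step.  In the braids t_1 ... t_k B(c_lambda)
   they give, of two strands in the same cycle the one with the smaller label
   always passes over the other ("layered"), and this makes the lowest
   coefficient vanish unless the permutation is trivial. *)
From HB Require Import structures.
From Stdlib Require Import Relation_Operators.
Require Import Defs.
From mathcomp Require Import all_boot all_order all_fingroup all_algebra.
From mathcomp Require Import zify ring.

Set Implicit Arguments.
Unset Strict Implicit.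
Unset Printing Implicit Defensive.

Import Order.TTheory GRing.Theory Num.Theory.

(** * Permutations and words *)

(** A functional on the Hecke algebra is handled as a function on braid words that respects the
    braid moves and the skein relation. It is determined by its values on the words x and x
    s_m^(+-1) y, with x and y free of s_m, so its behaviour under stabilization fixes it; this is
    how the trace is identified with the polynomial. Layering works as follows. The trace is
    computed letter by letter: a crossing is followed or, for one of the two signs, also smoothed at
    the cost of a factor z. Between strands of one cycle, layering gives the sign without smoothing.
    Between different cycles, smoothing merges them and raises l_T, which pushes the term beyond the
    lowest order. Only the unsmoothed term is left. The braids are layered because the cycles of
    c_lambda are intervals: a transposition (i j) that lowers l_T cuts a cycle into its part in [i,
    j) and the rest, and both parts are still traversed upwards. Finally, the Jucys-Murphy product
    lists inversions by columns and the sorting word by rows. Subword counts see only permutations,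
    so commuting transpositions may be exchanged. *)

Section SimpleReflections.
Variable r : nat.
Implicit Types (v u : 'S_r.+1) (i j k : nat).

Lemma inord_eq i j : i <= r -> j <= r ->
  ((inord i : 'I_r.+1) == inord j) = (i == j).
Proof. by move=> le_i le_j; rewrite -val_eqE /= !inordK. Qed.

Definition desc v i : bool := v (inord i.+1) < v (inord i).

Lemma simple_reflL i : i < r -> simple_refl r i (inord i) = inord i.+1.
Proof. by rewrite tpermL. Qed.

Lemma simple_reflR i : i < r -> simple_refl r i (inord i.+1) = inord i.
Proof. by rewrite tpermR. Qed.

Lemma simple_reflD i k : i < r -> k <= r -> k != i -> k != i.+1 ->
  simple_refl r i (inord k) = inord k.
Proof.
by move=> lt_i le_k ki ki1; rewrite tpermD // inord_eq 1?eq_sym // ltnW.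
Qed.

Lemma simple_reflK i : simple_refl r i ∘ simple_refl r i = 1%g.
Proof. exact: tperm2. Qed.

Lemma pcompA (T : finType) (x y w : {perm T}) : x ∘ (y ∘ w) = x ∘ y ∘ w.
Proof. by rewrite /Defs.pcomp mulgA. Qed.

Lemma pcomp1 (T : finType) (x : {perm T}) : x ∘ 1%g = x.
Proof. exact: mul1g. Qed.

Lemma pcomp1l (T : finType) (x : {perm T}) : 1%g ∘ x = x.
Proof. exact: mulg1. Qed.

Lemma pcompsK v i : v ∘ simple_refl r i ∘ simple_refl r i = v.
Proof. by rewrite -pcompA simple_reflK pcomp1. Qed.

Lemma tperm_comm (T : finType) (a b c d : T) :
  a != c -> a != d -> b != c -> b != d ->
  tperm a b ∘ tperm c d = tperm c d ∘ tperm a b.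
Proof.
by move=> ac ad bc bd; rewrite /Defs.pcomp [RHS]conjgC tpermJ !tpermD // eq_sym.
Qed.

Lemma simple_refl_comm i j : i.+1 < j -> j < r ->
  simple_refl r i ∘ simple_refl r j = simple_refl r j ∘ simple_refl r i.
Proof. by move=> ltij ltj; apply: tperm_comm; rewrite inord_eq //; lia. Qed.

Lemma simple_refl_braid i : i.+1 < r ->
  simple_refl r i ∘ simple_refl r i.+1 ∘ simple_refl r i
  = simple_refl r i.+1 ∘ simple_refl r i ∘ simple_refl r i.+1.
Proof.
move=> lti; rewrite /simple_refl /Defs.pcomp !mulgA.
have n1 : (inord i : 'I_r.+1) != inord i.+1 by rewrite inord_eq //; lia.
have n2 : (inord i : 'I_r.+1) != inord i.+2 by rewrite inord_eq //; lia.
have n3 : (inord i.+1 : 'I_r.+1) != inord i.+2 by rewrite inord_eq //; lia.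
move: (inord i) (inord i.+1) (inord i.+2) n1 n2 n3 => a b c ab ac bc.
have conj (x y : {perm 'I_r.+1}) : (x^-1 = x -> x * y * x = y ^ x)%g.
  by move=> xV; rewrite conjgE mulgA xV.
by rewrite !conj ?tpermV // !tpermJ tpermR tpermL !tpermD // eq_sym.
Qed.

Lemma descK v i : i < r -> desc (v ∘ simple_refl r i) i = ~~ desc v i.
Proof.
move=> lti; rewrite /desc !pcompE simple_reflL // simple_reflR // -leqNgt.
have : v (inord i) != v (inord i.+1) by rewrite (inj_eq perm_inj) inord_eq //; lia.
by move=> ne; rewrite ltn_neqAle (inj_eq val_inj) ne.
Qed.

Lemma desc_far v i j : i < r -> j < r -> (i.+1 < j) || (j.+1 < i) ->
  desc (v ∘ simple_refl r i) j = desc v j.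
Proof. by move=> lti ltj ij; rewrite /desc !pcompE !simple_reflD //; lia. Qed.

End SimpleReflections.

(** Words in the first [m] generators, hence braids on [m.+1] strands. Letters are plain naturals,
    so that one word can be read with different numbers of strands. *)
Definition below (m : nat) (b : seq (nat * bool)) : bool :=
  all (fun x => x.1 < m) b.

Lemma below_cat m b b' : below m (b ++ b') = below m b && below m b'.
Proof. exact: all_cat. Qed.

Lemma belowW m m' b : (m <= m') -> below m b -> below m' b.
Proof. by move=> lemm; apply: sub_all => x /= /leq_trans -> . Qed.

(** * Cycles, and how a transposition splits them *)

Section Cycles.
Variable n : nat.
Implicit Types (w c s : {perm 'I_n}) (x y : 'I_n).

(** On a finite set, each of two points of a cycle is reached from the other by a nonnegative power,
    so stability of [D] in one direction suffices. *)
Lemma porbit_closed w (D : pred 'I_n) x y : (forall z, D z -> D (w z)) ->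
  y \in porbit w x -> D x = D y.
Proof.
move=> clD; have clX k z : D z -> D ((w ^+ k)%g z).
  by elim: k z => [|k IHk] z Dz; rewrite ?expg0 ?perm1 // expgSr permM clD ?IHk.
move=> yx; apply/idP/idP => H.
  by have /porbitP[k ->] := yx; apply: (clX k x H).
by have /porbitP[k ->] : x \in porbit w y; [rewrite porbit_sym | apply: (clX k y H)].
Qed.

Lemma mem_porbit_perm w x y : (w y \in porbit w x) = (y \in porbit w x).
Proof.
by rewrite -!eq_porbit_mem; congr (_ == _); have := porbit_perm w 1 y; rewrite expg1.
Qed.

Lemma mem_porbit_permV w x y : ((w^-1)%g y \in porbit w x) = (y \in porbit w x).
Proof. by rewrite -[in RHS](permKV w y) mem_porbit_perm. Qed.

Lemma mem_porbit_perml w x y : (y \in porbit w (w x)) = (y \in porbit w x).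
Proof. by rewrite porbit_sym mem_porbit_perm porbit_sym. Qed.

Lemma mem_porbit_trans w x y z :
  y \in porbit w x -> z \in porbit w y -> z \in porbit w x.
Proof. by rewrite -!eq_porbit_mem => /eqP-> /eqP->. Qed.

Lemma sub_porbit w w' x y : (forall z, w' z \in porbit w z) ->
  y \in porbit w' x -> y \in porbit w x.
Proof.
move=> sub /(porbit_closed (D := fun z => z \in porbit w x)) <-.
  exact: porbit_id.
by move=> z /= zx; apply: mem_porbit_trans zx (sub z).
Qed.

(* Each cycle visits its elements in increasing order. *)
Definition increasing_cycles w : Prop :=
  forall x y, y \in porbit w x -> x < y -> x < w x <= y.

(** The cycles are blocks of consecutive elements, each traversed upwards; [c_lambda] is of this
    form. *)
Definition interval_cycles c : Prop :=
  forall x y, y \in porbit c x -> x < y -> ((c^-1)%g y).+1 = y.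

(** The preimage of the minimum is the maximum: if it were below another element of its cycle, [w]
    would have to increase it. *)
Lemma increasing_cycles_max w x : increasing_cycles w ->
  (forall y, y \in porbit w x -> y <= x) ->
  forall y, y \in porbit w x -> w x <= y.
Proof.
move=> inc maxx y yx.
case: (@arg_minnP _ x (fun z => z \in porbit w x) val); first exact: porbit_id.
move=> mn mnx mn_min; apply: leq_trans (mn_min y yx); rewrite leq_eqVlt.
have ux : (w^-1)%g mn \in porbit w x by rewrite mem_porbit_permV.
suff -> : x = (w^-1)%g mn by rewrite permKV eqxx.
apply/val_inj/eqP; rewrite /= eqn_leq maxx // andbT leqNgt; apply/negP => lt.
have := inc ((w^-1)%g mn) x; rewrite porbit_sym mem_porbit_permV porbit_sym.
rewrite porbit_sym mnx permKV => /(_ isT lt) /andP[lt' _].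
by have := mn_min _ ux; rewrite leqNgt lt'.
Qed.

Lemma interval_cycles_increasing c : interval_cycles c -> increasing_cycles c.
Proof.
move=> int x y yx ltxy.
case: (@arg_minnP _ y (fun z => (z \in porbit c x) && (x < z)) val).
  by rewrite yx.
move=> z /andP[zx ltxz] z_min; have ez := int x z zx ltxz.
have zx' : (c^-1)%g z \in porbit c x by rewrite mem_porbit_permV.
suff ex : x = (c^-1)%g z by rewrite ex permKV ez leqnn z_min // yx.
apply/val_inj/eqP; rewrite /= eqn_leq -ltnS ez ltxz /= leqNgt; apply/negP => lt.
by have := z_min ((c^-1)%g z); rewrite zx' lt /= -ez ltnn => /(_ isT).
Qed.

Lemma interval_cycles_min c p : interval_cycles c ->
  (forall y, y \in porbit c p -> p <= y) ->
  forall y, y \in porbit c p -> y <= (c^-1)%g p.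
Proof.
move=> int minp y yp; rewrite leqNgt; apply/negP => lt.
have yp' : y \in porbit c ((c^-1)%g p) by rewrite porbit_sym mem_porbit_permV porbit_sym.
have /andP[] := interval_cycles_increasing int yp' lt.
by rewrite permKV ltnNge minp // mem_porbit_permV porbit_id.
Qed.

Section Split.
Variables (c w : {perm 'I_n}) (i j : 'I_n).
Hypotheses (int : interval_cycles c) (inc : increasing_cycles w)
  (sub : forall x y, y \in porbit w x -> y \in porbit c x)
  (lt_ij : i < j).
Let s := w ∘ (c^-1)%g.
Hypothesis (same : s j \in porbit w (s i)).
Let i' := (c^-1)%g i.
Let j' := (c^-1)%g j.
Let w' := tperm (s i) (s j) ∘ w.
(** The transposition cuts the cycle of [w] into its part in [i, j) and the rest. [D] is the first
    part; it contains [s i] and not [s j]. *)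
Let D : pred 'I_n := fun z => [&& z \in porbit w j', i <= z & z < j].

Let sE x : s x = w ((c^-1)%g x).
Proof. by rewrite /s pcompE. Qed.

Let ji : j' \in porbit w i'.
Proof. by move: same; rewrite !sE mem_porbit_perm mem_porbit_perml. Qed.

Let ij : i' \in porbit w j'. Proof. by rewrite porbit_sym ji. Qed.

Let c_ji : j \in porbit c i.
Proof.
by have := sub ji; rewrite mem_porbit_permV porbit_sym mem_porbit_permV porbit_sym.
Qed.

Let ej : j'.+1 = j. Proof. exact: int c_ji lt_ij. Qed.

Let ne_ij : i' != j'.
Proof. by rewrite (inj_eq perm_inj); apply: contraTneq lt_ij => ->; rewrite ltnn. Qed.

(** If [i] opens its block, then [i'] closes it and the cyclic order wraps around; this case is
    treated separately below. *)
Let pred_i : i'.+1 = i \/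
  (forall y, y \in porbit c i -> i <= y) /\ (forall y, y \in porbit c i -> y <= i').
Proof.
have [/existsP[x /andP[xi ltxi]]|] := boolP [exists x, (x \in porbit c i) && (x < i)].
  by left; apply: (int (x := x)); rewrite // porbit_sym.
rewrite negb_exists => /forallP mini; right.
have mini' y : y \in porbit c i -> i <= y.
  by move=> yi; have := mini y; rewrite yi -leqNgt.
by split=> //; apply: interval_cycles_min.
Qed.

Let c_orb x : x \in porbit w j' -> x \in porbit c i.
Proof.
move=> xj; have : x \in porbit c j' by apply: sub.
rewrite porbit_sym mem_porbit_permV porbit_sym; exact: mem_porbit_trans.
Qed.

Let i'_out : (i' < i) || (j <= i').
Proof. by case: pred_i => [<-|[_ ->]]; rewrite ?ltnSn ?orbT. Qed.

(** [w i'], which is [s i], is the least element of the cycle from [i] on: the successor of [i - 1],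
    or the minimum reached from the maximum. *)
Let wi'_min z : z \in porbit w j' -> i <= z -> i <= w i' <= z.
Proof.
move=> zj lez; case: pred_i => [ei|[mini maxi]].
  by rewrite -ei; apply: inc; [apply: mem_porbit_trans ji zj | rewrite ei].
rewrite mini ?c_orb ?mem_porbit_perm //=.
apply: increasing_cycles_max => //; last exact: mem_porbit_trans ji zj.
by move=> y yi; apply: maxi; apply: c_orb; apply: mem_porbit_trans ij yi.
Qed.

Let w'E x : w' x = if x == i' then w j' else if x == j' then w i' else w x.
Proof.
rewrite pcompE !sE -/i' -/j'; have [->|ni] := eqVneq x i'; first by rewrite tpermL.
have [->|nj] := eqVneq x j'; first by rewrite tpermR.
by rewrite tpermD // (inj_eq perm_inj) eq_sym.
Qed.

(** Inside [D] the map [w'] climbs like [w]; the top element [j' = j - 1] returns to the least one,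
    [w i']. *)
Let D_closed z : D z -> D (w' z).
Proof.
case/and3P=> zj lez ltz; rewrite w'E.
have -> : (z == i') = false.
  by apply: contraTF i'_out => /eqP <-; rewrite negb_or -leqNgt lez -ltnNge.
have le_ij : i <= j' by rewrite -ltnS ej.
have [_|nz] := eqVneq z j'.
  have /andP[le1 le2] := wi'_min (porbit_id _ _) le_ij.
  by rewrite /D mem_porbit_perm ij le1 /= -ej ltnS.
have lt_zj : z < j' by rewrite ltn_neqAle -ltnS ej ltz andbT nz.
have /andP[lt1 le2] : z < w z <= j' by apply: inc; rewrite // porbit_sym.
by rewrite /D mem_porbit_perm zj (leq_trans lez (ltnW lt1)) -ej ltnS.
Qed.

Lemma split_sub x y : y \in porbit w' x -> y \in porbit w x.
Proof.
apply: sub_porbit => {x y} z; rewrite w'E; have [->|_] := eqVneq z i'.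
  by rewrite mem_porbit_perm.
have [->|_] := eqVneq z j'; first by rewrite mem_porbit_perm.
by rewrite mem_porbit_perm porbit_id.
Qed.

Let D_const x y : y \in porbit w' x -> D x = D y.
Proof. exact: porbit_closed D_closed. Qed.

Let D_si : D (s i).
Proof.
have Dj : D j' by rewrite /D porbit_id -ltnS ej lt_ij -ej ltnSn.
by have := D_closed Dj; rewrite w'E eqxx eq_sym (negPf ne_ij) sE.
Qed.

Let D_sj : D (s j) = false.
Proof.
have : w' i' = s j by rewrite w'E eqxx sE.
move=> <-; have := @D_const i' (w' i'); rewrite mem_porbit_perm porbit_id => <- //.
apply/negP => /and3P[_ le lt]; move: i'_out; rewrite ltnNge le /=.
by rewrite leqNgt lt.
Qed.

(** Only [i'] and [j'] get new images: [j'] is the top of its part, and [i'] jumps over [D] to the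
    image [w j'] of [j']. *)
Lemma split_increasing : increasing_cycles w'.
Proof.
move=> x y yx ltxy; have yx' := split_sub yx; have Dxy := D_const yx.
rewrite w'E; have [ex|nxi] := eqVneq x i'; last first.
  have [ex|nxj] := eqVneq x j'; last exact: inc.
  have Dj : D j' by rewrite /D porbit_id -ltnS ej lt_ij -ej ltnSn.
  move: ltxy; rewrite ltnNge -ltnS ex ej; move: Dxy; rewrite ex Dj => /esym.
  by case/and3P=> _ _ ->.
have yj : y \in porbit w j' by apply: mem_porbit_trans ij _; rewrite -ex.
have Dx : D x = false.
  apply/negP => /and3P[_ le lt]; move: i'_out; rewrite -ex ltnNge le /=.
  by rewrite leqNgt lt.
case: pred_i => [ei|[_ maxi]]; last first.
  by move: ltxy; rewrite ex ltnNge maxi // c_orb.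
have lejy : j <= y.
  move: Dxy; rewrite Dx /D yj /= -ei -ex ltxy /= => /esym/negbT.
  by rewrite -leqNgt.
have /andP[lt1 ->] : j' < w j' <= y by apply: inc; rewrite // -ltnS ej.
rewrite andbT ex; apply: leq_trans lt1; rewrite ltnS -ltnS ej ei; exact: ltnW.
Qed.

Lemma split_apart : s j \notin porbit w' (s i).
Proof. by apply/negP => /D_const; rewrite D_si D_sj. Qed.

(** [s i] is the minimum of its part. This gives the sign of the crossings that its strand makes in
    the lift of (i j). *)
Lemma split_left (p : 'I_n) : i < p < j -> s p \in porbit w' (s i) -> s i < s p.
Proof.
case/andP=> ltip ltpj pi; have := D_const pi; rewrite D_si => /esym /and3P[pj le _].
have /andP[_] := wi'_min pj le; rewrite -sE leq_eqVlt => /predU1P[/val_inj /perm_inj e|//].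
by move: ltip; rewrite e ltnn.
Qed.

(** If [s p] lay with [s j], then [c^-1 p = p - 1] would be an element of the cycle of [w] in [i,
    j), hence of [D], and [D] would contain its image [s p]. *)
Lemma split_right (p : 'I_n) : i < p < j -> s p \notin porbit w' (s j).
Proof.
case/andP=> ltip ltpj; apply/negP => pj.
have pw := split_sub pj; have := D_const pj; rewrite D_sj => /esym/negP; apply.
have p'j : (c^-1)%g p \in porbit w j'.
  by move: pw; rewrite !sE mem_porbit_perm mem_porbit_perml.
have ep : ((c^-1)%g p).+1 = p.
  apply: (int (x := i)) => //; have := c_orb p'j; rewrite mem_porbit_permV //.
suff Dp : D ((c^-1)%g p).
  have ni : (p == i) = false by apply: contraTF ltip => /eqP ->; rewrite ltnn.
  have nj : (p == j) = false by apply: contraTF ltpj => /eqP ->; rewrite ltnn.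
  by have := D_closed Dp; rewrite w'E !(inj_eq perm_inj) ni nj sE.
have le1 : i <= (c^-1)%g p by rewrite -ltnS ep.
by rewrite /D p'j le1 ep ltnW.
Qed.

End Split.
End Cycles.

(** * Reflection length as a count of cycles *)

Section ReflectionLength.
Variable r : nat.
Implicit Types (w u v : 'S_r.+1) (x y : 'I_r.+1).

(** The reflection length (see [reflection_lengthE]), in the form in which the effect of a
    transposition is easy to follow. *)
Definition cycle_defect w : nat := r.+1 - #|porbits w|.

Lemma card_porbits_le w : #|porbits w| <= r.+1.
Proof. by rewrite -[X in _ <= X]card_ord leq_imset_card. Qed.

Lemma porbits_tperm_comp x y w : x != y ->
  #|porbits (tperm x y ∘ w)| + (x \notin porbit w y).*2 = #|porbits w| + 1.
Proof.
(* [porbits_mul_tperm] has the transposition on the other side; inversion swaps the sides and keeps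
   the cycles. *)
move=> xy; have := porbits_mul_tperm (w^-1)%g x y; rewrite xy porbitV porbitsV => /= <-.
by rewrite -(porbitsV (_ ∘ _)) /Defs.pcomp invMg tpermV.
Qed.

Lemma cycle_defect_same x y w : x != y -> y \in porbit w x ->
  (cycle_defect (tperm x y ∘ w)).+1 = cycle_defect w.
Proof.
move=> xy yx; have := porbits_tperm_comp w xy; rewrite porbit_sym yx /= addn0.
have := card_porbits_le (tperm x y ∘ w); rewrite /cycle_defect.
by move: #|porbits (_ ∘ w)| #|porbits w| => A B; lia.
Qed.

Lemma cycle_defect_diff x y w : y \notin porbit w x ->
  cycle_defect (tperm x y ∘ w) = (cycle_defect w).+1.
Proof.
move=> yx; have xy : x != y by apply: contraNneq yx => ->; apply: porbit_id.
have := porbits_tperm_comp w xy; rewrite porbit_sym yx /=.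
have := card_porbits_le w; rewrite /cycle_defect.
by move: #|porbits (_ ∘ w)| #|porbits w| => A B; lia.
Qed.

Lemma cycle_defect_le x y w : cycle_defect (tperm x y ∘ w) <= (cycle_defect w).+1.
Proof.
have [->|xy] := eqVneq x y; first by rewrite tperm1 pcomp1l.
have [yx|/cycle_defect_diff ->] := boolP (y \in porbit w x); last by [].
by rewrite -(cycle_defect_same xy yx); lia.
Qed.

Lemma cycle_defect_ge x y w : cycle_defect w <= (cycle_defect (tperm x y ∘ w)).+1.
Proof.
by have := cycle_defect_le x y (tperm x y ∘ w); rewrite /Defs.pcomp -mulgA tperm2 mulg1.
Qed.

Lemma tperm_slide (s : 'S_r.+1) i j : s ∘ tperm i j = tperm (s i) (s j) ∘ s.
Proof. by rewrite /Defs.pcomp -tpermJ conjgE mulgA -mulgA mulgA mulgV mul1g. Qed.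

Lemma cycle_defect1 : cycle_defect 1%g = 0.
Proof.
apply/eqP; rewrite subn_eq0 -[X in X <= _]card_ord.
rewrite /porbits card_imset // => x y /eqP.
by rewrite eq_porbit_mem => /porbitP[k]; rewrite expg1n perm1.
Qed.

Lemma cycle_defectV w : cycle_defect (w^-1)%g = cycle_defect w.
Proof. by rewrite /cycle_defect porbitsV. Qed.

Lemma cycle_defect_eq0 w : cycle_defect w = 0 -> w = 1%g.
Proof.
move=> w0; apply/permP => x; rewrite perm1; apply/eqP/negPn/negP => wx.
have := @cycle_defect_same x (w x) w; rewrite eq_sym wx w0.
by rewrite mem_porbit_perm porbit_id => /(_ isT isT).
Qed.

Lemma perm_product_cat (T : finType) (a b : seq {perm T}) :
  perm_product (a ++ b) = perm_product a ∘ perm_product b.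
Proof.
elim: a => [|x a IHa]; first by rewrite pcomp1l.
by rewrite -[LHS]/(x ∘ perm_product (a ++ b)) IHa pcompA.
Qed.

Lemma cycle_defect_product (ts : seq ('I_r.+1 * 'I_r.+1)) w :
  cycle_defect w <= cycle_defect (perm_product [seq tperm p.1 p.2 | p <- ts] ∘ w)
                    + size ts.
Proof.
elim: ts => [|p ts IHts] /=; first by rewrite pcomp1l addn0.
rewrite -pcompA addnS -addSn; apply: leq_trans IHts _.
by rewrite leq_add2r cycle_defect_ge.
Qed.

(** Composing with the transposition of [x] and [w x] makes [x] a fixed point and lowers the defect
    by one. *)
Lemma transp_product_defect w : is_transp_product (cycle_defect w) w.
Proof.
move ew: (cycle_defect w) => k; elim: k w ew => [|k IHk] w ew.
  rewrite (cycle_defect_eq0 ew); apply/existsP; exists [tuple].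
  by rewrite /= eqxx.
have [x wx] : exists x, w x != x.
  apply/existsP; rewrite -negb_forall; apply/negP => /forallP w1.
  suff w_1 : w = 1%g by rewrite w_1 cycle_defect1 in ew.
  by apply/permP => x; rewrite perm1; apply/eqP.
have := @cycle_defect_same x (w x) w; rewrite eq_sym wx ew.
rewrite mem_porbit_perm porbit_id => /(_ isT isT) [] /IHk /existsP[ts /andP[ts_ne /eqP tsP]].
apply/existsP; exists [tuple of (x, w x) :: ts]; rewrite /= eq_sym wx ts_ne /=.
rewrite tsP.
by rewrite /Defs.pcomp -mulgA tperm2 mulg1.
Qed.

Lemma reflection_lengthE w : reflection_length w = cycle_defect w.
Proof.
rewrite /reflection_length; case: ex_minnP => k /existsP[ts /andP[_ /eqP tsP]] min_k.
apply/eqP; rewrite eqn_leq min_k ?transp_product_defect //=.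
have := cycle_defect_product ts w^-1; rewrite tsP /Defs.pcomp mulVg cycle_defect1.
by rewrite cycle_defectV size_tuple.
Qed.

End ReflectionLength.

(** * Coxeter length and descents *)

Section CoxeterLength.
Variable r : nat.
Implicit Types (u v w : 'S_r.+1) (p q i j : 'I_r.+1).

(** The symmetric form over ordered pairs can be reindexed by any permutation, as the comparison in
    [coxeter_length_tperm] requires. *)
Lemma coxeter_length_sum u :
  (coxeter_length u).*2 = \sum_(p < r.+1) \sum_(q < r.+1) ((p < q) != (u p < u q)).
Proof.
have -> : coxeter_length u = \sum_(p < r.+1) \sum_(q < r.+1) ((p < q) && (u q < u p)).
  rewrite /coxeter_length -sum1_card pair_bigA /= big_mkcond /=.
  by apply: eq_bigr => -[p q] _; rewrite inE /=; case: ifP.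
rewrite -addnn {2}exchange_big /= -big_split /=; apply: eq_bigr => p _.
rewrite -big_split /=; apply: eq_bigr => q _.
have := inj_eq (@perm_inj _ u) p q; rewrite -!(inj_eq val_inj) /=.
by case: (ltngtP p q) => /=; case: (ltngtP (u p) (u q)).
Qed.

Lemma coxeter_length_tperm u p q : p < q -> u p < u q ->
  coxeter_length u < coxeter_length (u ∘ tperm p q).
Proof.
move=> lt_pq lt_u; rewrite -ltn_double !coxeter_length_sum.
set t := tperm p q; pose f (a b : 'I_r.+1) : nat := (a < b) != (u a < u b).
pose g (a b : 'I_r.+1) : nat := (t a < t b) != (u a < u b).
have -> : \sum_(a < r.+1) \sum_(b < r.+1) ((a < b) != ((u ∘ t) a < (u ∘ t) b))
          = \sum_a \sum_b g a b.
  rewrite (reindex_inj (@perm_inj _ t)) /=; apply: eq_bigr => a _.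
  rewrite (reindex_inj (@perm_inj _ t)) /=; apply: eq_bigr => b _.
  by rewrite !pcompE /t !tpermK.
(* [f] and [g] cannot be compared pair by pair. The inequality holds after summing over the four
   pairs that [t] produces from (a, b), and it is strict at (p, q). *)
pose avg (h : 'I_r.+1 -> 'I_r.+1 -> nat) a b :=
  h a b + h (t a) b + (h a (t b) + h (t a) (t b)).
have sum_avg h : \sum_a \sum_b avg h a b = 4 * \sum_a \sum_b h a b.
  have tl (h' : 'I_r.+1 -> 'I_r.+1 -> nat) : \sum_a \sum_b h' (t a) b = \sum_a \sum_b h' a b.
    by rewrite [RHS](reindex_inj (@perm_inj _ t)).
  have tr (h' : 'I_r.+1 -> 'I_r.+1 -> nat) : \sum_a \sum_b h' a (t b) = \sum_a \sum_b h' a b.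
    by apply: eq_bigr => a _; rewrite [RHS](reindex_inj (@perm_inj _ t)).
  under eq_bigr => a _ do rewrite !big_split /=.
  rewrite !big_split /=.
  have := tl (fun a b => h a (t b)); have := tr h; have := tl h => /= -> -> ->.
  by move: (\sum_a _) => S; lia.
rewrite -(ltn_pmul2l (isT : 0 < 4)) -(sum_avg f) -(sum_avg g).
have [tp tq] : t p = q /\ t q = p by rewrite /t tpermL tpermR.
have ord_t a : [\/ a = p, a = q | t a = a].
  have [->|ap] := eqVneq a p; first exact: Or31.
  have [->|aq] := eqVneq a q; first exact: Or32.
  by apply: Or33; rewrite /t tpermD 1?eq_sym.
have f_pq : avg f p q = 0.
  rewrite /avg tp tq /f !ltnn lt_pq lt_u.
  by rewrite (ltnNge q p) (ltnNge (u q)) !(ltnW lt_pq, ltnW lt_u).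
have g_pq : 0 < avg g p q.
  rewrite /avg tp tq /g tp tq !ltnn lt_pq lt_u.
  by rewrite (ltnNge q p) (ltnNge (u q)) !(ltnW lt_pq, ltnW lt_u).
have le_avg a b : avg f a b <= avg g a b.
  have fg0 c d : (c == p) || (c == q) -> (d == p) || (d == q) -> avg f c d = 0.
    move=> hc hd; apply/eqP; rewrite -leqn0 -f_pq.
    case/orP: hc => /eqP->; case/orP: hd => /eqP->;
      by rewrite /avg ?tp ?tq; lia.
  case: (ord_t a) (ord_t b) => [ea|ea|ea] [eb|eb|eb];
    try (by rewrite fg0 ?ea ?eb ?eqxx ?orbT); rewrite /avg /f /g.
  - rewrite !ea !eb ?tp ?tq ?tp ?tq.
    by case: (ltnP p b); case: (ltnP q b); case: (ltnP (u p) (u b));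
       case: (ltnP (u q) (u b)) => //=; lia.
  - rewrite !ea !eb ?tp ?tq ?tp ?tq.
    by case: (ltnP p b); case: (ltnP q b); case: (ltnP (u p) (u b));
       case: (ltnP (u q) (u b)) => //=; lia.
  - rewrite !ea !eb ?tp ?tq ?tp ?tq.
    by case: (ltnP a p); case: (ltnP a q); case: (ltnP (u a) (u p));
       case: (ltnP (u a) (u q)) => //=; lia.
  - rewrite !ea !eb ?tp ?tq ?tp ?tq.
    by case: (ltnP a p); case: (ltnP a q); case: (ltnP (u a) (u p));
       case: (ltnP (u a) (u q)) => //=; lia.
  - by rewrite !ea !eb.
rewrite !pair_bigA /= (bigD1 (p, q)) // [X in _ < X](bigD1 (p, q)) //= f_pq add0n.
rewrite -[X in X <= _]add1n.
by apply: leq_add => //; apply: leq_sum.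
Qed.

Lemma ltn_coxeter_length_tperm u p q : p < q ->
  (coxeter_length (u ∘ tperm p q) < coxeter_length u) = (u q < u p).
Proof.
move=> lt_pq; apply/idP/idP => [lt|lt_u]; last first.
  have := @coxeter_length_tperm (u ∘ tperm p q) p q lt_pq.
  by rewrite !pcompE tpermL tpermR -pcompA /Defs.pcomp tperm2 mul1g => /(_ lt_u).
rewrite ltnNge; apply: contraL lt; rewrite leq_eqVlt => /predU1P[/val_inj/perm_inj e|].
  by rewrite e ltnn in lt_pq.
by move=> lt_u; rewrite -leqNgt ltnW // coxeter_length_tperm.
Qed.

Lemma descE u (i : nat) : i < r ->
  (coxeter_length (u ∘ simple_refl r i) < coxeter_length u) = desc u i.
Proof. by move=> lti; rewrite ltn_coxeter_length_tperm //= !inordK //; lia. Qed.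

Lemma simple_refl_val (i : nat) p : i < r -> simple_refl r i p
  = (if p == i :> nat then i.+1 else if p == i.+1 :> nat then i else p) :> nat.
Proof.
move=> lti; rewrite /simple_refl; case: tpermP => [->|->|/eqP + /eqP].
- by rewrite !inordK ?eqxx //; lia.
- by rewrite !inordK ?eqxx; try lia; rewrite ifN //; lia.
- by rewrite -!val_eqE /= !inordK; try lia; move=> /negPf -> /negPf ->.
Qed.

Lemma coxeter_length_simple u (i : nat) : i < r ->
  coxeter_length (u ∘ simple_refl r i) <= (coxeter_length u).+1.
Proof.
move=> lti; rewrite /coxeter_length.
set s := simple_refl r i; set B := [set p : 'I_r.+1 * 'I_r.+1 | (p.1 < p.2) && (u p.2 < u p.1)].
set A := [set p | _].
pose h (a : 'I_r.+1 * 'I_r.+1) := (s a.1, s a.2).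
have h_inj : injective h.
  by move=> [a b] [a' b'] [] /perm_inj -> /perm_inj ->.
suff sub : A \subset (inord i, inord i.+1) |: [set h a | a in B].
  apply: leq_trans (subset_leq_card sub) _.
  by apply: leq_trans (leq_card_setU _ _) _; rewrite cards1 card_imset.
apply/subsetP => -[a b]; rewrite !inE /= !pcompE => /andP[lt_ab lt_u].
have [|ne] := eqVneq (a, b) (inord i, inord i.+1); first by [].
apply/imsetP; exists (s a, s b); last by rewrite /h /= !tpermK.
rewrite inE /= lt_u andbT.
rewrite !simple_refl_val //; move: ne; rewrite xpair_eqE -!val_eqE /= !inordK //; try lia.
by do ?[case: eqP => ? /=]; lia.
Qed.

Lemma coxeter_length1 : coxeter_length (1%g : 'S_r.+1) = 0.
Proof.
rewrite /coxeter_length (_ : [set p | _] = set0) ?cards0 //.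
by apply/setP => -[a b]; rewrite !inE /= !perm1; case: ltngtP.
Qed.

End CoxeterLength.

(** * Reduced words *)

Section Reduced.
Variable r : nat.
Implicit Types (u v w c : 'S_r.+1) (b : seq nat).

Definition word_prod b : 'S_r.+1 := perm_product [seq simple_refl r i | i <- b].

Lemma word_prod_cons i b : word_prod (i :: b) = simple_refl r i ∘ word_prod b.
Proof. by []. Qed.

Lemma coxeter_length_word u b : all (fun i => i < r) b ->
  coxeter_length (u ∘ word_prod b) <= coxeter_length u + size b.
Proof.
elim: b u => [|i b IHb] u; first by rewrite pcomp1 addn0.
case/andP=> lti /IHb {}IHb; rewrite word_prod_cons pcompA.
by apply: leq_trans (IHb _) _; rewrite addnS -addSn leq_add2r coxeter_length_simple.
Qed.

(** Lengths add up along [b]; the opposite inequality is [coxeter_length_word]. The start [u] is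
    arbitrary for the sake of induction. *)
Definition reduced_after u b : bool :=
  all (fun i => i < r) b
  && (coxeter_length u + size b <= coxeter_length (u ∘ word_prod b)).

Lemma reduced_after_cons u i b : reduced_after u (i :: b) ->
  [/\ i < r, desc u i = false & reduced_after (u ∘ simple_refl r i) b].
Proof.
case/andP=> /andP[lti bb]; rewrite word_prod_cons pcompA /= => le.
have le' := coxeter_length_word (u ∘ simple_refl r i) bb.
split=> //; first by apply/negP; rewrite -descE //; lia.
by apply/andP; split=> //; have := coxeter_length_simple u lti; lia.
Qed.

(** Two strands cross at most once in a reduced word, so a pair of values that [u] has inverted
    stays inverted. *)
Lemma reduced_after_inversion u b (p q : 'I_r.+1) : reduced_after u b -> p < q ->
  (u^-1)%g q < (u^-1)%g p ->
  ((u ∘ word_prod b)^-1)%g q < ((u ∘ word_prod b)^-1)%g p.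
Proof.
elim: b u => [|i b IHb] u; first by rewrite pcomp1.
case/reduced_after_cons=> lti asc red ltpq inv; rewrite word_prod_cons pcompA.
apply: IHb => //; rewrite /Defs.pcomp invMg tpermV !permM.
rewrite -/(simple_refl r i) !simple_refl_val //.
set a := (u^-1)%g q in inv *; set a' := (u^-1)%g p in inv *.
have ne : ~ (a = i :> nat /\ a' = i.+1 :> nat).
  case=> ea ea'; move: asc; rewrite /desc -[i in X in _ < X]ea -ea' !inord_val.
  by rewrite /a /a' !permKV ltpq.
by move: inv ne; do ?[case: eqP => ? /=]; lia.
Qed.

End Reduced.

(** * Layered braid words *)

Section Layered.
Variable r : nat.
Implicit Types (u v w c : 'S_r.+1) (x : nat * bool) (b : seq (nat * bool)).

Definition braid_prod b : 'S_r.+1 := word_prod r (map fst b).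

Lemma braid_prod_cons x b : braid_prod (x :: b) = simple_refl r x.1 ∘ braid_prod b.
Proof. by []. Qed.

Lemma braid_prod_cat b b' : braid_prod (b ++ b') = braid_prod b ∘ braid_prod b'.
Proof. by rewrite /braid_prod /word_prod !map_cat perm_product_cat. Qed.

(* The strand labelled p starts at position p, and v gives the labels at the
   current positions.  Of two strands in the same cycle of w, the one with the
   smaller label passes over the other. *)
Fixpoint layered w b v : bool :=
  if b is (i, e) :: b' then
    let x := v (inord i) in
    let y := v (inord i.+1) in
    ((y \in porbit w x) ==> (e == (x < y)))
    && layered w b' (v ∘ simple_refl r i)
  else true.

Lemma layered_cat w b b' v :
  layered w (b ++ b') v = layered w b v && layered w b' (v ∘ braid_prod b).
Proof.
elim: b v => [|[i e] b IHb] v; first by rewrite pcomp1.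
by rewrite /= IHb -andbA -pcompA.
Qed.

(** The [c]-dual lift of the transposition of [i] and [(i + d).+1], or its inverse when [e] is
    false: inverting a conjugate inverts its middle letter only. *)
Fixpoint transp_word (i d : nat) (e : bool) : seq (nat * bool) :=
  if d is d'.+1 then (i, true) :: transp_word i.+1 d' e ++ [:: (i, false)]
  else [:: (i, e)].

Lemma transp_word_prod i d e : i + d < r ->
  braid_prod (transp_word i d e) = tperm (inord i) (inord (i + d).+1).
Proof.
elim: d i => [|d IHd] i ltr; first by rewrite addn0 /= braid_prod_cons pcomp1.
rewrite /= braid_prod_cons braid_prod_cat IHd; last lia.
rewrite braid_prod_cons pcomp1 pcompA addSnnS.
have conj (x y : {perm 'I_r.+1}) : x ∘ x = 1%g -> x ∘ y ∘ x = (y ^ x)%g.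
  by move=> xx; rewrite conjgE (_ : x^-1 = x)%g //; apply/eqP; rewrite eq_invg_mul; apply/eqP.
have lti : i < r by lia.
rewrite conj ?simple_reflK // tpermJ /= simple_reflR //.
by rewrite simple_reflD //; lia.
Qed.

(** Both exchanged strands pass over the intermediate ones. For [a] this is right because its label
    is smaller than those of its cycle; for [z] the sign is never tested, as it shares no cycle with
    them. *)
Lemma layered_transp_word w v i d e : i + d < r ->
  let: a := v (inord i) in let: z := v (inord (i + d).+1) in
  z \notin porbit w a ->
  (forall p : nat, i < p <= i + d ->
     (v (inord p) \in porbit w a -> a < v (inord p))
     /\ v (inord p) \notin porbit w z) ->
  layered w (transp_word i d e) v.
Proof.
elim: d i v => [|d IHd] i v ltr; first by rewrite addn0 /= => /negPf ->.
rewrite /= => apart btw; rewrite layered_cat /=.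
have lti1 : i < i.+1 <= i + d.+1 by lia.
have [lt1 ap1] := btw i.+1 lti1.
rewrite andbT; apply/and3P; split.
- by apply/implyP => /lt1 ->.
- have v' p : i.+1 < p <= r -> (v ∘ simple_refl r i) (inord p) = v (inord p).
    by move=> ltp; rewrite pcompE simple_reflD //; lia.
  apply: IHd; first lia.
    by rewrite v' ?addSnnS ?pcompE ?simple_reflR //; lia.
  move=> p ltp; rewrite (v' p) ?(v' (i.+1 + d).+1) ?addSnnS; try lia.
  by rewrite pcompE simple_reflR; [apply: btw|]; lia.
- rewrite transp_word_prod; last lia.
  set t := tperm _ _; have t1 : t (inord i.+1) = inord (i.+1 + d).+1 by apply: tpermL.
  have t2 : t (inord i) = inord i by rewrite tpermD // inord_eq //; lia.
  rewrite !pcompE t1 t2 simple_reflL ?simple_reflD; try lia.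
  apply/implyP; rewrite porbit_sym addSnnS => H; move: ap1.
  by rewrite H.
Qed.

(** A reduced word only crosses pairs that are inverted at the end. Positions [p < q] of one block
    are inverted by [c^-1] only if [p] opens the block. Then [c^-1 p] closes it, so the left label
    [w (c^-1 p)] is the minimum of its cycle, and the positive sign is the right one. *)
Lemma layered_reduced w c v u (b : seq nat) : interval_cycles c -> increasing_cycles w ->
  (forall p q, q \in porbit w p -> q \in porbit c p) ->
  reduced_after u b -> u ∘ word_prod r b = c -> v = w ∘ (c^-1)%g ∘ u ->
  layered w [seq (i, true) | i <- b] v.
Proof.
move=> int inc sub; elim: b v u => // i b IHb v u red eqc ->.
have [lti asc red'] := reduced_after_cons red.
rewrite word_prod_cons pcompA in eqc.
rewrite /=; apply/andP; split; last by apply: IHb red' eqc _; rewrite -!pcompA.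
apply/implyP; rewrite !pcompE => same.
set p := u (inord i) in same *; set q := u (inord i.+1) in same *.
have ltpq : p < q.
  move: asc; rewrite /desc -/p -/q => /negbT; rewrite -leqNgt leq_eqVlt.
  case/predU1P=> // /val_inj /perm_inj /eqP; rewrite inord_eq //; lia.
have inv : (c^-1)%g q < (c^-1)%g p.
  rewrite -eqc; apply: reduced_after_inversion => //.
  rewrite /Defs.pcomp invMg tpermV !permM /p /q !permK -/(simple_refl r i).
  by rewrite simple_reflL // simple_reflR // !inordK //; lia.
have wpq : (c^-1)%g q \in porbit w ((c^-1)%g p).
  by move: same; rewrite mem_porbit_perm mem_porbit_perml.
have qp : q \in porbit c p.
  by have := sub _ _ wpq; rewrite mem_porbit_permV porbit_sym mem_porbit_permV porbit_sym.
have eq : ((c^-1)%g q).+1 = q := int _ _ qp ltpq.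
have minp y : y \in porbit c p -> p <= y.
  move=> yp; rewrite leqNgt; apply/negP => ltyp.
  have ep : ((c^-1)%g p).+1 = p by apply: int ltyp; rewrite porbit_sym.
  by move: inv; rewrite -ltnS eq ep ltnNge ltnW.
have maxp := interval_cycles_min int minp.
rewrite eq_sym; apply/eqP; rewrite ltn_neqAle; apply/andP; split.
  rewrite -[_ == _]/(_ == _ :> 'I_r.+1) !(inj_eq perm_inj).
  by rewrite inord_eq //; lia.
apply: increasing_cycles_max => //; last by rewrite mem_porbit_perm.
move=> y yx; apply: maxp; have := sub _ _ yx.
by rewrite porbit_sym mem_porbit_permV porbit_sym.
Qed.

End Layered.

(** * The cycles of [c_lambda] *)

Section BlockCycles.
Variable r : nat.
Implicit Types (lam : seq nat) (x y : 'I_r.+1).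

Definition block m l : seq 'I_r.+1 := [seq inord k | k <- iota m l].

Lemma mem_block m l x : m + l <= r.+1 -> (x \in block m l) = (m <= x < m + l).
Proof.
move=> le; apply/mapP/idP => [[k]|lt].
  by rewrite mem_iota => ltk ->; rewrite inordK //; lia.
by exists (x : nat); rewrite ?mem_iota ?inord_val.
Qed.

Lemma block_uniq m l : m + l <= r.+1 -> uniq (block m l).
Proof.
move=> le; rewrite map_inj_in_uniq ?iota_uniq // => a b; rewrite !mem_iota => lta ltb.
by move/(congr1 val); rewrite /= !inordK //; lia.
Qed.

Lemma block_cycle_mem m l x : m + l <= r.+1 ->
  (m <= cycle_perm (block m l) x < m + l) = (m <= x < m + l).
Proof.
by move=> le; rewrite -!mem_block // permE undup_id ?block_uniq // mem_next.
Qed.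

Lemma block_cycle_out m l x : m + l <= r.+1 -> ~~ (m <= x < m + l) ->
  cycle_perm (block m l) x = x.
Proof.
move=> le; rewrite -mem_block // permE undup_id ?block_uniq // => /negPf out.
by rewrite next_nth out.
Qed.

Lemma block_cycle_next m l x : m + l <= r.+1 -> m <= x -> x.+1 < m + l ->
  cycle_perm (block m l) x = x.+1 :> nat.
Proof.
move=> le lex ltx; have xb : x \in block m l by rewrite mem_block // lex (ltnW ltx).
have szb : size (block m l) = l by rewrite size_map size_iota.
have nthb k : k < l -> nth x (block m l) k = inord (m + k).
  by move=> ltk; rewrite (nth_map 0) ?size_iota // nth_iota.
have ix : index x (block m l) = x - m.
  rewrite -[X in index X](_ : nth x (block m l) (x - m) = x).
    by rewrite index_uniq ?block_uniq ?szb //; lia.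
  by rewrite nthb; [rewrite subnKC // inord_val | lia].
rewrite permE undup_id ?block_uniq // next_nth xb ix.
have := nthb (x - m).+1; case: (block m l) szb => [|y p] /= szb; first by lia.
move=> nthp; rewrite (set_nth_default x) ?nthp ?inordK; lia.
Qed.

(** [c_lambda] by recursion on the parts, with the first block starting at an arbitrary [m]. *)
Fixpoint blocks m lam : 'S_r.+1 :=
  if lam is l :: lam' then cycle_perm (block m l) ∘ blocks (m + l) lam' else 1%g.

Lemma blocksE m lam :
  perm_product [seq cycle_perm (block (m + sumn (take j lam)) (nth 0 lam j))
               | j <- iota 0 (size lam)] = blocks m lam.
Proof.
elim: lam m => //= l lam IHlam m; rewrite addn0 -IHlam; congr (_ ∘ perm_product _).
rewrite (iotaDl 1 0) -map_comp; apply: eq_map => j /=.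
by rewrite addnA.
Qed.

Lemma blocks_low m lam x : m + sumn lam <= r.+1 -> x < m -> blocks m lam x = x.
Proof.
elim: lam m => [|l lam IHlam] m /= le ltx; first by rewrite perm1.
rewrite pcompE IHlam; try lia.
by apply: block_cycle_out; lia.
Qed.

(** Either [y] continues a block, or a block starts at [y]. In the latter case the elements below
    [y] form a union of cycles, so [y] is the least element of its own. *)
Lemma blocks_step m lam y : m + sumn lam <= r.+1 -> m <= y < m + sumn lam ->
  (exists2 p : 'I_r.+1, p.+1 = y & blocks m lam p = y)
  \/ (forall x, x < y -> blocks m lam x < y).
Proof.
elim: lam m => [|l lam IHlam] m /= le; first by rewrite addn0; lia.
have le1 : m + l <= r.+1 by lia.
have le2 : m + l + sumn lam <= r.+1 by lia.
have [lty ltmy|ley ltmy] := ltnP y (m + l); last first.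
  have [|[p ep bp]|low] := IHlam (m + l) le2; first by lia.
    by left; exists p; rewrite // pcompE bp block_cycle_out //; lia.
  right=> x ltx; rewrite pcompE; have ltb := low x ltx.
  have [inb|outb] := boolP (m <= blocks (m + l) lam x < m + l).
    have := block_cycle_mem (blocks (m + l) lam x) le1; rewrite inb => /andP[_ lt].
    exact: leq_trans lt ley.
  by rewrite block_cycle_out.
have [ey|ney] := eqVneq (y : nat) m.
  right=> x ltx; rewrite pcompE blocks_low //; last by lia.
  by rewrite block_cycle_out //; lia.
have ltp : y.-1 < r.+1 by have := ltn_ord y; lia.
left; exists (Ordinal ltp) => /=; first by lia.
rewrite pcompE blocks_low //=; last by lia.
by apply/val_inj; rewrite /= block_cycle_next //=; lia.
Qed.

Lemma interval_cycles_blocks lam : sumn lam = r.+1 -> interval_cycles (blocks 0 lam).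
Proof.
move=> sz x y yx ltxy; set c := blocks 0 lam in yx *.
have le : 0 + sumn lam <= r.+1 by rewrite sz.
have lty : 0 <= y < 0 + sumn lam by rewrite sz /= ltn_ord.
have [[p ep bp]|low] := blocks_step le lty.
  by rewrite (_ : (c^-1)%g y = p) // -bp permK.
have := porbit_closed (D := fun z : 'I_r.+1 => z < y) low yx.
by rewrite ltxy ltnn.
Qed.

Lemma c_lambda_blocks lam : c_lambda r lam = blocks 0 lam.
Proof. by rewrite -blocksE. Qed.

End BlockCycles.

Section CycleType.
Variable r : nat.
Implicit Types w g : 'S_r.+1.

Lemma sumn_cycle_type w : sumn (cycle_type w) = r.+1.
Proof.
have part : partition (porbits w) [set: 'I_r.+1].
  apply/and3P; split.
  - apply/eqP/setP => x; rewrite inE; apply/bigcupP.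
    by exists (porbit w x); rewrite ?imset_f ?porbit_id.
  - apply/trivIsetP => _ _ /imsetP[x _ ->] /imsetP[y _ ->]; apply: contraNT.
    case/pred0Pn=> z /andP[zx zy]; rewrite eq_porbit_mem.
    by apply: mem_porbit_trans zy _; rewrite porbit_sym.
  - by apply/imsetP => -[x _ /setP/(_ x)]; rewrite inE porbit_id.
rewrite /cycle_type (perm_sumn (permEl (perm_sort _ _))) sumnE big_map big_enum /=.
by rewrite -(card_partition part) cardsT card_ord.
Qed.

Lemma size_cycle_type w : size (cycle_type w) = #|porbits w|.
Proof. by rewrite /cycle_type size_sort size_map -cardE. Qed.

Lemma card_porbits_conj g w : #|porbits (g ∘ w ∘ (g^-1)%g)| = #|porbits w|.
Proof.
have orb x : porbit (g ∘ w ∘ (g^-1)%g) (g x) = g @: porbit w x.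
  have step k : ((g ∘ w ∘ (g^-1)%g) ^+ k)%g (g x) = g ((w ^+ k)%g x).
    elim: k => [|k IHk]; first by rewrite !expg0 !perm1.
    by rewrite !expgSr [LHS]permM IHk [LHS]pcompE permK pcompE permM.
  apply/setP => y; apply/porbitP/imsetP => [[k ->]|[z /porbitP[k ->] ->]].
    by exists ((w ^+ k)%g x); rewrite ?mem_porbit ?step.
  by exists k; rewrite step.
have -> : porbits (g ∘ w ∘ (g^-1)%g) = (fun A : {set 'I_r.+1} => g @: A) @: porbits w.
  apply/setP => A; apply/imsetP/imsetP => [[x _ ->]|[B /imsetP[x _ ->] ->]].
    exists (porbit w ((g^-1)%g x)); first exact: imset_f.
    by rewrite -orb permKV.
  by exists (g x); rewrite // orb.
by rewrite card_imset //; apply: imset_inj; apply: perm_inj.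
Qed.

End CycleType.

(** * Permutations with an initial descent set *)

Section Unimodal.
Variable r : nat.
Implicit Types (u v : 'S_r.+1) (i j : 'I_r.+1) (K : {set 'I_r.+1}).

Lemma card_ord_lt n m : m <= n -> #|[set p : 'I_n | p < m]| = m.
Proof.
move=> le; have -> : [set p : 'I_n | p < m] = [set widen_ord le p | p : 'I_m].
  apply/setP => p; rewrite inE; apply/idP/imsetP => [lt|[q _ ->]]; last exact: (ltn_ord q).
  by exists (Ordinal lt) => //; apply/val_inj.
by rewrite card_imset ?card_ord // => a b /(congr1 val) /= /val_inj.
Qed.

(** The inverse takes at [i] the number of its smaller values, so their order determines the
    permutation. *)
Lemma perm_order_eq u v :
  (forall i j, ((u^-1)%g i < (u^-1)%g j) = ((v^-1)%g i < (v^-1)%g j)) -> u = v.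
Proof.
have rankE (w : 'S_r.+1) i : (w^-1)%g i = #|[set j | (w^-1)%g j < (w^-1)%g i]| :> nat.
  have -> : [set j | (w^-1)%g j < (w^-1)%g i] = w @: [set p : 'I_r.+1 | p < (w^-1)%g i].
    apply/setP => j; rewrite inE; apply/idP/imsetP => [lt|[p + ->]].
      by exists ((w^-1)%g j); rewrite ?inE ?permKV.
    by rewrite inE permK.
  rewrite card_imset; last exact: perm_inj.
  by rewrite card_ord_lt // ltnW.
move=> uv; apply: invg_inj; apply/permP => i; apply/val_inj.
rewrite /= rankE [RHS]rankE; congr #|pred_of_set _|.
by apply/setP => j; rewrite !inE uv.
Qed.

(* The order in which the values occur in the permutation that lists K
   decreasingly and then the complement of K increasingly. *)
Definition precedes K i j : bool :=
  if i < j then j \notin K else (j < i) && (i \in K).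

Lemma precedes_total K i j : i != j -> precedes K i j = ~~ precedes K j i.
Proof.
by rewrite /precedes -val_eqE /= => ij; case: ltngtP ij => //=; rewrite negbK.
Qed.

Lemma precedes_irr K i : precedes K i i = false.
Proof. by rewrite /precedes ltnn. Qed.

Lemma precedes_trans K : transitive (precedes K).
Proof.
move=> j i l; rewrite /precedes.
have [ij|ji|ij] := ltngtP i j => //=.
  have [jl|lj|jl] := ltngtP j l => //=; first by rewrite (ltn_trans ij jl).
  by move=> /negPf ->.
have [jl|lj|jl] := ltngtP j l => //= iK; last first.
  by move=> jK; rewrite ltnNge (ltnW (ltn_trans lj ji)) (ltn_trans lj ji).
move=> lK; have [il|li|/val_inj il] := ltngtP i l => //.
by rewrite -il iK in lK.
Qed.

Definition rank K j : nat := #|[set i | precedes K i j]|.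

Lemma rank_lt K i j : precedes K i j -> rank K i < rank K j.
Proof.
move=> ij; apply: proper_card; apply/properP; split.
  by apply/subsetP => x; rewrite !inE => /precedes_trans; apply.
by exists i; rewrite inE ?precedes_irr.
Qed.

Lemma ltn_rank K i j : (rank K i < rank K j) = precedes K i j.
Proof.
have [->|ij] := eqVneq i j; first by rewrite ltnn precedes_irr.
apply/idP/idP => [lt|]; last exact: rank_lt.
by rewrite precedes_total //; apply: contraL lt => /rank_lt lt; rewrite -leqNgt ltnW.
Qed.

Lemma rank_le K j : rank K j <= r.
Proof.
rewrite -ltnS -[X in _ < X]card_ord -cardsT; apply: proper_card.
by apply/properP; split; [apply/subsetP | exists j; rewrite inE ?precedes_irr].
Qed.

Definition position K j : 'I_r.+1 := inord (rank K j).

Lemma position_inj K : injective (position K).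
Proof.
move=> i j /(congr1 val); rewrite /= !inordK ?ltnS ?rank_le // => eq_rank.
apply/eqP/negPn/negP => ij; have := precedes_total K ij.
by rewrite -!ltn_rank eq_rank ltnn.
Qed.

(** [position] tells where each value stands, so the permutation is its inverse. For [K] without
    [ord0] it is the element of S_(n,k), with k the size of [K], whose first k values form [K]. *)
Definition unimodal K : 'S_r.+1 := ((perm (@position_inj K))^-1)%g.

Lemma unimodal_order K i j :
  (((unimodal K)^-1)%g i < ((unimodal K)^-1)%g j) = precedes K i j.
Proof. by rewrite /unimodal invgK !permE /= !inordK ?ltnS ?rank_le // ltn_rank. Qed.

Lemma ltn_rank_card K j : (rank K j < #|K|) = (j \in K).
Proof.
apply/idP/idP => [|jK].
  apply: contraTT => jK; rewrite -leqNgt; apply: subset_leq_card.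
  apply/subsetP => i iK; rewrite inE /precedes iK andbT jK.
  by case: ltngtP => // /val_inj e; rewrite -e iK in jK.
apply: proper_card; apply/properP; split; last by exists j; rewrite ?inE ?precedes_irr.
by apply/subsetP => i; rewrite inE /precedes jK; case: ltngtP => // _ /=.
Qed.

Definition top_values u (k : nat) : {set 'I_r.+1} := [set j | (u^-1)%g j < k].

Lemma top_values_unimodal K : top_values (unimodal K) #|K| = K.
Proof.
apply/setP => j; rewrite inE /unimodal invgK permE /= inordK ?ltnS ?rank_le //.
exact: ltn_rank_card.
Qed.

Lemma initial_descentsP u (k : nat) :
  reflect (forall i : nat, i < r -> desc u i = (i < k)) (u \in initial_descents r k).
Proof.
rewrite inE; apply: (iffP eqP) => [/setP des i lti|des].
  by have := des (Ordinal lti); rewrite !inE /= descE.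
by apply/setP => i; rewrite !inE descE // des.
Qed.

Lemma unimodal_descents K : ord0 \notin K -> unimodal K \in initial_descents r #|K|.
Proof.
move=> K0; apply/initial_descentsP => i lti; rewrite /desc.
set u := unimodal K; set x := u (inord i); set y := u (inord i.+1).
have ux : (u^-1)%g x = i :> nat by rewrite permK inordK //; lia.
have uy : (u^-1)%g y = i.+1 :> nat by rewrite permK inordK.
have xy : precedes K x y by rewrite -unimodal_order ux uy.
have -> : (i < #|K|) = (x \in K).
  by rewrite -ux -[in RHS](top_values_unimodal K) inE.
apply/idP/idP => [ltyx|xK].
  by move: xy; rewrite /precedes ltnNge (ltnW ltyx) ltyx /=.
rewrite ltnNge; apply/negP; rewrite leq_eqVlt => /predU1P[/val_inj e|ltxy].
  by move: xy; rewrite e precedes_irr.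
(* If [x < y], then [ord0], which lies outside [K], would stand strictly between [x] and [y], whose
   positions are consecutive. *)
have yK : y \notin K by move: xy; rewrite /precedes ltxy.
have x0 : precedes K x ord0.
  rewrite /precedes ltn0 xK andbT lt0n; apply: contraNneq K0 => x0.
  by rewrite (_ : ord0 = x) //; apply/val_inj.
have y0 : precedes K ord0 y by rewrite /precedes yK (leq_ltn_trans (leq0n x) ltxy).
by move: x0 y0; rewrite -!unimodal_order -/u ux uy; lia.
Qed.

Section InitialDescents.
Variables (u : 'S_r.+1) (k : nat).
Hypotheses (lekr : k <= r) (des : u \in initial_descents r k).

Let step_dec p : p < k -> u (inord p.+1) < u (inord p).
Proof.
by move=> ltp; have /initial_descentsP/(_ p) := des; rewrite /desc ltp => ->; lia.
Qed.

Let step_inc p : k <= p -> p < r -> u (inord p) < u (inord p.+1).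
Proof.
move=> lep ltp; have /initial_descentsP/(_ p ltp) := des.
rewrite /desc [in RHS]ltnNge lep /= => /negbT; rewrite -leqNgt leq_eqVlt.
by case/predU1P=> // /val_inj /perm_inj /eqP; rewrite inord_eq //; lia.
Qed.

Let dec p q : p < q -> q <= k -> u (inord q) < u (inord p).
Proof.
elim: q => // q IHq; rewrite ltnS leq_eqVlt => /predU1P[->|lt] le; first exact: step_dec.
by apply: ltn_trans (step_dec le) (IHq lt (ltnW le)).
Qed.

Let inc p q : k <= p -> p < q -> q <= r -> u (inord p) < u (inord q).
Proof.
move=> lep; elim: q => // q IHq; rewrite ltnS leq_eqVlt => /predU1P[<-|lt] le.
  exact: step_inc.
by apply: ltn_trans (IHq lt (ltnW le)) (step_inc _ le); lia.
Qed.

Lemma initial_descents_order i j :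
  ((u^-1)%g i < (u^-1)%g j) = precedes (top_values u k) i j.
Proof.
have main (x y : 'I_r.+1) : x < y -> ((u^-1)%g x < (u^-1)%g y) = (y \notin top_values u k).
  move=> ltxy; rewrite inE -leqNgt; set p := (u^-1)%g x; set q := (u^-1)%g y.
  have ux : u (inord p) = x by rewrite inord_val permKV.
  have uy : u (inord q) = y by rewrite inord_val permKV.
  apply/idP/idP => [ltpq|leq]; rewrite leqNgt; apply/negP => lt.
    by have := dec ltpq (ltnW lt); rewrite ux uy; lia.
  move: lt; rewrite ltnS leq_eqVlt => /predU1P[/val_inj /perm_inj e|ltqp].
    by rewrite e ltnn in ltxy.
  have lepr : p <= r by rewrite -ltnS.
  by have := inc leq ltqp lepr; rewrite ux uy; lia.
rewrite /precedes; case: (ltngtP i j) => [/main //|ltji|/val_inj ->]; last by rewrite ltnn.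
have ne : ((u^-1)%g i == (u^-1)%g j :> nat) = false.
  by rewrite (inj_eq val_inj) (inj_eq perm_inj); apply: contraTF ltji => /eqP->; rewrite ltnn.
by rewrite -[RHS]negbK -(main _ _ ltji) -leqNgt [RHS]leq_eqVlt ne.
Qed.

Lemma initial_descents_unimodal : unimodal (top_values u k) = u.
Proof. by apply: perm_order_eq => i j; rewrite unimodal_order initial_descents_order. Qed.

Lemma card_top_values : #|top_values u k| = k.
Proof.
have -> : top_values u k = u @: [set p : 'I_r.+1 | p < k].
  apply/setP => j; rewrite inE; apply/idP/imsetP => [lt|[p + ->]].
    by exists ((u^-1)%g j); rewrite ?inE ?permKV.
  by rewrite inE permK.
rewrite card_imset; last exact: perm_inj.
by rewrite card_ord_lt // leqW.
Qed.

(** The values decrease up to and including position [k], so the least one cannot stand before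
    it. *)
Lemma top_values0 : ord0 \notin top_values u k.
Proof.
rewrite inE -leqNgt leqNgt; apply/negP => lt.
have := dec lt (leqnn k); rewrite inord_val permKV ltn0 //.
Qed.

End InitialDescents.

Lemma big_initial_descents (R : Type) (idx : R) (op : Monoid.com_law idx)
    (F : nat -> 'S_r.+1 -> R) :
  \big[op/idx]_(0 <= k < r.+1) \big[op/idx]_(u in initial_descents r k) F k u
  = \big[op/idx]_(K : {set 'I_r.+1} | ord0 \notin K) F #|K| (unimodal K).
Proof.
rewrite big_mkord.
have card_lt (K : {set 'I_r.+1}) : ord0 \notin K -> #|K| < r.+1.
  move=> K0; rewrite -[X in _ < X]card_ord -cardsT; apply: proper_card.
  by apply/properP; split; [apply/subsetP | exists ord0].
rewrite [RHS](partition_big (fun K : {set 'I_r.+1} => inord #|K| : 'I_r.+1) xpredT) //=.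
apply: eq_bigr => k _.
rewrite (reindex_onto (fun K => unimodal K) (fun u => top_values u k)) /=; last first.
  by move=> u /initial_descents_unimodal ->; rewrite // -ltnS.
apply: eq_big => [K|K].
  apply/andP/andP => [[des /eqP eK]|[K0 /eqP eK]].
    have lek : k <= r by rewrite -ltnS.
    have cK := card_top_values (unimodal K) lek; rewrite eK in cK.
    split; first by rewrite -eK; apply: top_values0 lek des.
    by rewrite cK inord_val.
  have ck : #|K| = k by rewrite -eK inordK // card_lt.
  split; rewrite -?ck ?top_values_unimodal //.
  exact: unimodal_descents.
case/andP=> des /eqP eK; congr (F _ _).
by have := @card_top_values (unimodal K) k; rewrite eK => -> //; rewrite -ltnS.
Qed.

End Unimodal.

(** * The c-sorting word *)

Section SortingWord.
Variable r : nat.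
Implicit Types (u v : 'S_r.+1) (a b p n m : nat) (s : seq nat).

(* The values of the prefix of the sorting word formed by a full rows
   s_0 .. s_(r-1), s_0 .. s_(r-2), .. and b letters of the next one. *)
Definition sorting_label a b p : nat :=
  if p < b then p + a + 1 else
  if p == b then a else if p <= r - a then p + a else r - p.

Definition sorting_state a b u : Prop :=
  forall p, p <= r -> u (inord p) = sorting_label a b p :> nat.

Lemma sorting_state1 : sorting_state 0 0 1%g.
Proof.
by move=> p lep; rewrite perm1 inordK // /sorting_label subn0 lep addn0; case: eqP.
Qed.

Lemma sorting_state_step a b u : b < r - a -> sorting_state a b u ->
  sorting_state a b.+1 (u ∘ simple_refl r b).
Proof.
move=> ltb st p lep; have ltbr : b < r by lia.
rewrite pcompE; have [->|nb] := eqVneq p b.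
  by rewrite simple_reflL // st // /sorting_label; do ?case: ifP; lia.
have [->|nb1] := eqVneq p b.+1.
  by rewrite simple_reflR // st ?(ltnW ltbr) // /sorting_label; do ?case: ifP; lia.
by rewrite simple_reflD // st // /sorting_label; do ?case: ifP; lia.
Qed.

Lemma sorting_state_next a u : a < r -> sorting_state a (r - a) u ->
  sorting_state a.+1 0 u.
Proof.
by move=> lta st p lep; rewrite st // /sorting_label; do ?case: ifP; lia.
Qed.

Lemma sorting_state_desc a b u : b < r - a -> sorting_state a b u -> desc u b = false.
Proof.
by move=> ltb st; rewrite /desc !st; try lia; rewrite /sorting_label; do ?case: ifP; lia.
Qed.

(** Positions past [r - a] already hold their final, decreasing values, so a letter there would
    shorten the prefix. *)
Lemma sorting_state_tail a b u : r - a < b -> b < r -> sorting_state a 0 u -> desc u b.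
Proof.
by move=> ltb ltbr st; rewrite /desc !st; try lia; rewrite /sorting_label; do ?case: ifP; lia.
Qed.

Lemma sorting_state_longest u : sorting_state r 0 u -> u = longest r.
Proof.
move=> st; apply/permP => p; apply/val_inj; have := st p.
rewrite inord_val -ltnS ltn_ord permE /= => /(_ isT) ->.
by have := ltn_ord p; rewrite /sorting_label; do ?case: ifP; lia.
Qed.

(** The inversion sequence with the prefix as accumulator: the reflection u s_i u^-1 exchanges the
    values of [u] at [i] and [i.+1]. *)
Fixpoint inversions_from u s : seq 'S_r.+1 :=
  if s is i :: s' then
    tperm (u (inord i)) (u (inord i.+1)) :: inversions_from (u ∘ simple_refl r i) s'
  else [::].

Lemma inversions_from_cat u s s' :
  inversions_from u (s ++ s')
  = inversions_from u s ++ inversions_from (u ∘ word_prod r s) s'.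
Proof.
elim: s u => [|i s IHs] u /=; first by rewrite pcomp1.
by rewrite IHs word_prod_cons pcompA.
Qed.

Lemma word_prod_cat s s' : word_prod r (s ++ s') = word_prod r s ∘ word_prod r s'.
Proof. by rewrite /word_prod map_cat perm_product_cat. Qed.

Lemma inversion_sequenceE s : inversion_sequence r s = inversions_from 1%g s.
Proof.
suff main u : [seq u ∘ word_prod r (take k.+1 s ++ rev (take k s)) ∘ (u^-1)%g
              | k <- iota 0 (size s)] = inversions_from u s.
  rewrite -main; apply: eq_map => k.
  by rewrite /Defs.pcomp invg1 mul1g mulg1.
elim: s u => //= i s IHs u; congr (_ :: _).
  rewrite take0 /= word_prod_cons pcomp1 /simple_refl tperm_slide.
  by rewrite /Defs.pcomp mulgA mulVg mul1g.
rewrite -IHs (iotaDl 1 0) -map_comp; apply: eq_map => k /=.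
rewrite rev_cons -cats1 catA !word_prod_cat word_prod_cons word_prod_cat.
rewrite [word_prod r [:: i]]word_prod_cons pcomp1.
rewrite -!word_prod_cat; set X := word_prod r (_ ++ _).
by rewrite /Defs.pcomp invMg tpermV -/(simple_refl r i) -!mulgA.
Qed.

Definition row_pairs a b n : seq (nat * nat) := [seq (a, (a + b').+1) | b' <- iota b n].

Definition tperm_pair (p : nat * nat) : 'S_r.+1 := tperm (inord p.1) (inord p.2).

(** In row [a] the value [a] travels to the right and passes the larger values in increasing
    order. *)
Lemma row_run n a b u : b + n <= r - a -> sorting_state a b u ->
  [/\ sorting_state a (b + n) (u ∘ word_prod r (iota b n)),
      inversions_from u (iota b n) = map tperm_pair (row_pairs a b n)
    & coxeter_length (u ∘ word_prod r (iota b n)) = coxeter_length u + n].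
Proof.
elim: n b u => [|n IHn] b u le st; first by rewrite /= !addn0 pcomp1.
have ltb : b < r - a by lia.
have [|st' inv len] := IHn b.+1 _ _ (sorting_state_step ltb st); first by lia.
rewrite /= word_prod_cons pcompA addnS -addSn; split=> //.
  rewrite inv; congr (tperm _ _ :: _); apply/val_inj; rewrite /= st ?inordK; try lia;
    by rewrite /sorting_label; do ?case: ifP; lia.
rewrite len addnS -addSn; congr (_ + _); apply/eqP; rewrite eqn_leq.
rewrite coxeter_length_simple; last lia.
have := descE (u ∘ simple_refl r b) (_ : b < r); rewrite pcompsK descK; try lia.
by rewrite (sorting_state_desc ltb st) => ->; lia.
Qed.

Definition sorting_rows a m : seq nat := flatten [seq iota 0 (r - a') | a' <- iota a m].

Lemma rows_run m a u : a + m <= r -> sorting_state a 0 u ->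
  [/\ sorting_state (a + m) 0 (u ∘ word_prod r (sorting_rows a m)),
      inversions_from u (sorting_rows a m)
      = map tperm_pair (flatten [seq row_pairs a' 0 (r - a') | a' <- iota a m])
    & coxeter_length (u ∘ word_prod r (sorting_rows a m))
      = coxeter_length u + size (sorting_rows a m)].
Proof.
elim: m a u => [|m IHm] a u le st; first by rewrite /= !addn0 pcomp1.
have [|st1 inv1 len1] := @row_run (r - a) a 0 u _ st; first by lia.
have lta : a < r by lia.
have [|st2 inv2 len2] := IHm a.+1 _ _ (sorting_state_next lta st1); first by lia.
rewrite /sorting_rows /= -/(sorting_rows a.+1 m) word_prod_cat pcompA addnS -addSn.
split=> //.
  by rewrite inversions_from_cat inv1 inv2 -map_cat.
by rewrite len2 len1 size_cat size_iota addnA.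
Qed.

Lemma sorting_rows_longest : word_prod r (sorting_rows 0 r) = longest r
  /\ coxeter_length (longest r) = size (sorting_rows 0 r).
Proof.
have [|st _ len] := @rows_run r 0 1%g _ sorting_state1; first by [].
have e := sorting_state_longest st; rewrite -e len coxeter_length1.
by rewrite pcomp1l.
Qed.

Definition row_positions a b n : seq nat := [seq a * r + b' | b' <- iota b n].

Definition sorting_positions a m : seq nat :=
  flatten [seq row_positions a' 0 (r - a') | a' <- iota a m].

Lemma sorting_lettersE a m : sorting_letters r (sorting_positions a m) = sorting_rows a m.
Proof.
rewrite /sorting_letters map_flatten -map_comp; congr flatten; apply: eq_map => a' /=.
rewrite -map_comp -[RHS]map_id; apply/eq_in_map => b; rewrite mem_iota /= => ltb.
by rewrite modnMDl modn_small //; lia.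
Qed.

Lemma sorting_rows_lt a m : all (fun i => i < r) (sorting_rows a m).
Proof.
apply/allP => i /flattenP[s /mapP[a' _ ->]]; rewrite mem_iota; lia.
Qed.

Lemma sorting_positions_ge a m x : x \in sorting_positions a m -> a * r <= x.
Proof.
case/flattenP=> s /mapP[a']; rewrite mem_iota => /andP[le _] -> /mapP[b _ ->].
by apply: leq_trans (leq_addr _ _); rewrite leq_mul2r le orbT.
Qed.

Lemma sorting_positions_sorted a m : a + m <= r -> sorted ltn (sorting_positions a m).
Proof.
have tr : transitive ltn by move=> x y z; apply: ltn_trans.
rewrite (sorted_pairwise tr); elim: m a => // m IHm a le.
rewrite /sorting_positions /= -/(sorting_positions a.+1 m) pairwise_cat IHm; last lia.
rewrite andbT; apply/andP; split.
  apply/allrelP => x y /mapP[b]; rewrite mem_iota => ltb -> /sorting_positions_ge.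
  by rewrite mulSn /=; lia.
rewrite /row_positions pairwise_map -(sorted_pairwise (leT := relpre _ _)).
  by apply: sub_sorted (iota_ltn_sorted _ _) => x y /=; rewrite ltn_add2l.
by move=> x y z /=; apply: ltn_trans.
Qed.

Lemma longest_subword_positions : longest_subword r (sorting_positions 0 r).
Proof.
have [e len] := sorting_rows_longest.
by rewrite /longest_subword sorting_positions_sorted //= /reduced_word sorting_lettersE
           sorting_rows_lt -/(word_prod r _) e len !eqxx.
Qed.

(** A subword that is lexicographically no larger, and whose positions are all at least [a * r + b],
    must start with exactly this position; and so on along the row. *)
Lemma greedy_row n a b u qs rest : b + n = r - a -> sorting_state a b u ->
  sorted ltn qs -> all (leq (a * r + b)) qs ->
  ((qs : seqlexi nat) <= row_positions a b n ++ rest)%O ->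
  size qs = n + size rest -> reduced_after u (sorting_letters r qs) ->
  exists qs', [/\ qs = row_positions a b n ++ qs', sorted ltn qs',
    all (leq (a * r + b + n)) qs' & ((qs' : seqlexi nat) <= rest)%O]
    /\ size qs' = size rest
    /\ reduced_after (u ∘ word_prod r (iota b n)) (sorting_letters r qs').
Proof.
elim: n b u qs => [|n IHn] b u qs en st srt ge lex sz red.
  by exists qs; rewrite addn0 pcomp1.
case: qs srt ge lex sz red => [//|x qs] srt /= /andP[gex ge].
rewrite /row_positions /= -/(row_positions a b.+1 n) lexi_cons => /andP[].
rewrite leEnat => lex /implyP /(_ gex) lex' [sz] red.
have ex : x = a * r + b by apply/eqP; rewrite eqn_leq lex.
have ltb : b < r - a by lia.
have [_ _] := reduced_after_cons red.
rewrite ex modnMDl modn_small; last lia.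
move=> red'; have en' : b.+1 + n = r - a by lia.
have geq : all (leq (a * r + b.+1)) qs.
  apply/allP => y yqs; have := order_path_min ltn_trans srt => /allP/(_ y yqs).
  by rewrite ex addnS.
have [qs' [[eqs srt' ge' lex''] [sz' red'']]] := IHn b.+1 _ qs en'
  (sorting_state_step ltb st) (path_sorted srt) geq lex' sz red'.
exists qs'; rewrite eqs word_prod_cons pcompA; split=> //; split=> //.
by rewrite addnS -addSn -addnS.
Qed.

(** The letters that remain in a copy of [c] after its row are descents of the prefix, so a reduced
    subword has to continue in the next copy. The bound on the entries of [qs] is the position right
    after the previous row. *)
Lemma greedy m a u qs : a + m = r -> sorting_state a 0 u -> sorted ltn qs ->
  (0 < a -> all (leq (a.-1 * r + (r - a.-1))) qs) ->
  ((qs : seqlexi nat) <= sorting_positions a m)%O ->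
  size qs = size (sorting_positions a m) -> reduced_after u (sorting_letters r qs) ->
  qs = sorting_positions a m.
Proof.
elim: m a u qs => [|m IHm] a u qs em st srt ge lex sz red.
  by apply/size0nil; rewrite sz.
have ge' : all (leq (a * r + 0)) qs.
  case: qs srt ge {lex sz} red => // x qs srt ge red.
  suff gex : a * r <= x.
    rewrite /= addn0 gex; apply/allP => y yqs.
    have := order_path_min ltn_trans srt => /allP/(_ y yqs).
    by move=> /ltnW; apply: leq_trans.
  case: a em st ge => [|a] em st ge; first by rewrite mul0n.
  have /andP[gex _] := ge isT; rewrite leqNgt; apply/negP => ltx.
  have [_ + _] := reduced_after_cons red.
  rewrite mulSn in ltx; rewrite /= in gex.
  have ex : x = a * r + (x - a * r) by lia.
  have ltb : x - a * r < r by lia.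
  rewrite ex modnMDl modn_small // (sorting_state_tail _ ltb st) //; lia.
have en : 0 + (r - a) = r - a by [].
have szr : size qs = (r - a) + size (sorting_positions a.+1 m).
  by rewrite sz size_cat size_map size_iota.
have [qs' [[eqs srt' geq' lex'] [sz' red']]] :=
  @greedy_row (r - a) a 0 u qs (sorting_positions a.+1 m) en st srt ge' lex szr red.
have [|st1 _ _] := @row_run (r - a) a 0 u _ st; first by lia.
have lta : a < r by lia.
rewrite eqs /sorting_positions /= -/(sorting_positions a.+1 m); congr (_ ++ _).
apply: IHm (sorting_state_next lta st1) srt' _ lex' sz' red'; first lia.
by move=> _; rewrite /= -[X in X + _]addn0.
Qed.

Lemma c_sorting_letters ps : is_c_sorting r ps -> sorting_letters r ps = sorting_rows 0 r.
Proof.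
case=> /andP[srt /and3P[lt /eqP prod /eqP sz]] minps.
have [e len] := sorting_rows_longest.
rewrite -sorting_lettersE; congr sorting_letters.
apply: (@greedy r 0 1%g) => //; first exact: sorting_state1.
- exact: minps longest_subword_positions.
- move: sz; rewrite size_map len => ->.
  by rewrite -sorting_lettersE size_map.
by rewrite /reduced_after lt pcomp1l /word_prod prod coxeter_length1 sz leqnn.
Qed.

End SortingWord.

(** * Diagrams of braid closures *)

Arguments step : simpl never.

Lemma step_shift s1 s k j :
  step (k, size s1 + j) (s1 ++ s) = omap (cat s1) (step (k, j) s).
Proof.
rewrite /step -addnA size_cat leq_add2l; case: ifP => // _.
have nthE p : nth true (s1 ++ s) (size s1 + p) = nth true s p.
  by rewrite nth_cat ltnNge leq_addr addKn.
have spliceE m new : splice (size s1 + j) m new (s1 ++ s) = s1 ++ splice j m new s.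
  rewrite /splice take_cat drop_cat -addnA !ltnNge !leq_addr /= !addKn.
  by rewrite -catA.
by case: k => [b||e] /=; rewrite -?addnS ?nthE ?spliceE //; case: ifP.
Qed.

Lemma run_shift s1 s w :
  run [seq (l.1, size s1 + l.2) | l <- w] (s1 ++ s) = omap (cat s1) (run w s).
Proof.
rewrite /run; have: Some (s1 ++ s) = omap (cat s1) (Some s) by [].
elim: w (Some (s1 ++ s)) (Some s) => [|[k j] w IHw] o o' -> //=.
by apply: IHw; case: o' => //= s'; rewrite step_shift.
Qed.

Lemma step_low k j s : size s < j -> step (k, j) s = None.
Proof. by move=> lt; rewrite /step leqNgt (leq_trans lt (leq_addr _ _)). Qed.

Lemma foldl_none (w : seq letter) :
  foldl (fun o l => obind (step l) o) None w = None.
Proof. by elim: w. Qed.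

(** With fewer than [i] strands both words fail, being nonempty; otherwise the first [i] strands are
    spectators. *)
Lemma run_shift_eq i w w' : 0 < size w -> 0 < size w' ->
  (forall s, run w s = run w' s) -> forall s,
  run [seq (l.1, i + l.2) | l <- w] s = run [seq (l.1, i + l.2) | l <- w'] s.
Proof.
move=> w0 w'0 eq_w s; have [le_is | lt] := leqP i (size s).
  rewrite -(cat_take_drop i s) -[i in map (fun l => (_, i + _))](size_takel le_is).
  by rewrite !run_shift eq_w.
by case: w w' w0 w'0 {eq_w} => [|[k j] w] [|[k' j'] w'] //= _ _;
   rewrite /run /= !step_low ?foldl_none ?ltn_addr.
Qed.

(** Moves whose two sides act alike on every sequence of strands. They can be chained on words, with
    closedness checked only once. A move such as [MoveR2] is not of this kind, since its empty side
    accepts any strands. *)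
Inductive stable_move : seq letter -> seq letter -> Prop :=
  StableMove w w' of diagram_move w w' & (forall s, run w s = run w' s) :
    stable_move w w'.

Lemma far_move k l i m :
  stable_move [:: (k, i); (l, i + coarity k + m)]
              [:: (l, i + arity k + m); (k, i)].
Proof.
split; first exact: MoveFar.
suff eq0 : forall s, run [:: (k, 0); (l, coarity k + m)] s
                     = run [:: (l, arity k + m); (k, 0)] s.
  by have := run_shift_eq i _ _ eq0; rewrite /= !addn0 !addnA; apply.
have step0 b s : step (Cup b, 0) s = Some [:: b, ~~ b & s].
  by rewrite /step /splice take0 drop0.
have stepX x y e s : step (Cross e, 0) [:: x, y & s] = Some [:: y, x & s].
  by rewrite /step /splice take0 /= drop0.
have stepA x y s : step (Cap, 0) [:: x, y & s] = if x != y then Some s else None.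
  by rewrite /step /splice take0 /= drop0.
have short k' s : size s < arity k' -> step (k', 0) s = None.
  by rewrite /step add0n ltnNge => /negPf ->.
have shift x y s : step (l, 2 + m) [:: x, y & s] = omap (cat [:: x; y]) (step (l, m) s).
  exact: (step_shift [:: x; y]).
move=> s; rewrite /run; case: k => [b||e] /=; rewrite ?add0n.
- rewrite /splice take0 drop0 [_ ++ _]/= shift.
  by case: (step _ s) => //= s'; rewrite step0.
- case: s => [|x [|y s]]; [by rewrite short // step_low .. |].
  rewrite shift stepA.
  case: ifP => xy /=; case: (step _ s) => //= s'; rewrite stepA xy //.
- case: s => [|x [|y s]]; [by rewrite short // step_low .. |].
  rewrite shift stepX /= shift.
  by case: (step _ s) => //= s'; rewrite stepX.
Qed.

Lemma slide_cup_move b e i :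
  stable_move [:: (Cup b, i); (Cross e, i.+1)]
              [:: (Cup b, i.+1); (Cross (~~ e), i)].
Proof.
split; first exact: MoveSlideCup.
suff eq0 : forall s, run [:: (Cup b, 0); (Cross e, 1)] s
                     = run [:: (Cup b, 1); (Cross (~~ e), 0)] s.
  by have := run_shift_eq i _ _ eq0; rewrite /= !addn0 !addn1; apply.
by case=> [|x s] //; rewrite /run /step /splice /= !(take0, drop0) /= ?drop0.
Qed.

Lemma slide_cap_move e i :
  stable_move [:: (Cross e, i); (Cap, i.+1)]
              [:: (Cross (~~ e), i.+1); (Cap, i)].
Proof.
split; first exact: MoveSlideCap.
suff eq0 : forall s, run [:: (Cross e, 0); (Cap, 1)] s
                     = run [:: (Cross (~~ e), 1); (Cap, 0)] s.
  by have := run_shift_eq i _ _ eq0; rewrite /= !addn0 !addn1; apply.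
case=> [|x [|y [|t s]]] //; rewrite /run /step /splice /= ?drop0;
  by case: ifP => //=; rewrite ?drop0.
Qed.

Lemma braid_move e i :
  stable_move [:: (Cross e, i); (Cross e, i.+1); (Cross e, i)]
              [:: (Cross e, i.+1); (Cross e, i); (Cross e, i.+1)].
Proof.
split; first exact: MoveR3.
suff eq0 : forall s, run [:: (Cross e, 0); (Cross e, 1); (Cross e, 0)] s
                     = run [:: (Cross e, 1); (Cross e, 0); (Cross e, 1)] s.
  by have := run_shift_eq i _ _ eq0; rewrite /= !addn0 !addn1; apply.
by case=> [|x [|y [|t s]]] //; rewrite /run /step /splice /= !drop0.
Qed.

Definition stable_eq : seq letter -> seq letter -> Prop :=
  clos_refl_sym_trans _ (in_context stable_move).

Lemma stable_refl w : stable_eq w w.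
Proof. exact: rst_refl. Qed.

Lemma stable_sym w w' : stable_eq w w' -> stable_eq w' w.
Proof. exact: rst_sym. Qed.

Lemma stable_trans w w' w'' :
  stable_eq w w' -> stable_eq w' w'' -> stable_eq w w''.
Proof. exact: rst_trans. Qed.

Lemma stable_step w w' : stable_move w w' -> stable_eq w w'.
Proof.
by move=> ww; apply: rst_step; exists [::], [::], w, w'; rewrite !cats0.
Qed.

Lemma stable_ctx p q w w' : stable_eq w w' -> stable_eq (p ++ w ++ q) (p ++ w' ++ q).
Proof.
elim=> {w w'} [w w' [p' [q' [x [y [xy -> ->]]]]]|w|w w' _|w w' w'' _ + _].
- apply: rst_step; exists (p ++ p'), (q' ++ q), x, y.
  by split; rewrite // -!catA.
- exact: stable_refl.
- exact: stable_sym.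
- exact: stable_trans.
Qed.

Lemma stable_cat w w' v v' :
  stable_eq w w' -> stable_eq v v' -> stable_eq (w ++ v) (w' ++ v').
Proof.
move=> ww vv; apply: (@stable_trans _ (w' ++ v)).
  exact: (stable_ctx [::] v ww).
by have := stable_ctx w' [::] vv; rewrite !cats0.
Qed.

Lemma stable_cons l w w' : stable_eq w w' -> stable_eq (l :: w) (l :: w').
Proof. by apply: (@stable_cat [:: l] [:: l]); apply: stable_refl. Qed.

Lemma stable_run w w' s : stable_eq w w' -> run w s = run w' s.
Proof.
elim=> {w w'} [w w' [p [q [x [y [[x' y' _ eq_xy] -> ->]]]]]|w|w w' _|w w' w'' _ + _] //.
  by rewrite !run_cat; case: (run p s) => //= s'; rewrite -!/(run _ _) run_cat eq_xy -run_cat.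
by move=> -> ->.
Qed.

Lemma stable_isotopic D D' :
  stable_eq (diagram_word D) (diagram_word D') -> isotopic D D'.
Proof.
move eqw: (diagram_word D) => w; move eqw': (diagram_word D') => w' ww'.
elim: ww' D D' eqw eqw' => {w w'}.
- move=> w w' [p [q [x [y [[x' y' xy _] eqw eqw']]]]] D D' eqD eqD'.
  apply: rst_step; exists p, q, x', y'.
  by split; rewrite // (eqD, eqD').
- by move=> w D D' <- eqD'; rewrite (val_inj (eqD' : val D' = val D)); apply: rst_refl.
- by move=> w w' _ IH D D' eqD eqD'; apply: rst_sym; apply: IH.
- move=> w w'' w' ww'' IH _ IH' D D' eqD eqD'.
  have closed : run w'' [::] == Some [::].
    by rewrite -(stable_run _ ww'') -eqD diagram_closed.
  by apply: rst_trans (IH _ (LinkDiagram closed) _ _) (IH' _ _ _ _).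
Qed.

Definition cups (m : nat) : seq letter := [seq (Cup true, i) | i <- iota 0 m].
Definition caps (m : nat) : seq letter := [seq (Cap, i) | i <- rev (iota 0 m)].
Definition crossings (b : seq (nat * bool)) : seq letter :=
  [seq (Cross x.2, x.1) | x <- b].

Definition strand_closure m b : seq letter := cups m.+1 ++ crossings b ++ caps m.+1.

Lemma capsS m : caps m.+1 = (Cap, m) :: caps m.
Proof. by rewrite /caps -[in iota _ _]addn1 iotaD rev_cat. Qed.

Lemma cupsS m : cups m.+1 = cups m ++ [:: (Cup true, m)].
Proof. by rewrite /cups -[in iota _ _]addn1 iotaD map_cat. Qed.

Lemma crossings_cat b b' : crossings (b ++ b') = crossings b ++ crossings b'.
Proof. exact: map_cat. Qed.

Lemma cross_cross_swap e e' i j : i.+1 < j ->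
  stable_eq [:: (Cross e, i); (Cross e', j)] [:: (Cross e', j); (Cross e, i)].
Proof.
move=> lt; have := far_move (Cross e) (Cross e') i (j - i.+2).
by rewrite /= addn2 subnKC // => /stable_step.
Qed.

Lemma cross_cap_swap e i j : i.+1 < j ->
  stable_eq [:: (Cross e, i); (Cap, j)] [:: (Cap, j); (Cross e, i)].
Proof.
move=> lt; have := far_move (Cross e) Cap i (j - i.+2).
by rewrite /= addn2 subnKC // => /stable_step.
Qed.

Lemma cap_cross_swap e i j : j <= i ->
  stable_eq [:: (Cap, j); (Cross e, i)] [:: (Cross e, i.+2); (Cap, j)].
Proof.
move=> le; have := far_move Cap (Cross e) j (i - j).
by rewrite /= addn0 addnAC !subnKC // addn2 => /stable_step.
Qed.

Lemma cross_cup_swap b e i j : i.+1 < j ->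
  stable_eq [:: (Cross e, i); (Cup b, j)] [:: (Cup b, j); (Cross e, i)].
Proof.
move=> lt; have := far_move (Cross e) (Cup b) i (j - i.+2).
by rewrite /= addn2 subnKC // => /stable_step.
Qed.

Lemma cup_cross_swap b e i j : j <= i ->
  stable_eq [:: (Cup b, j); (Cross e, i.+2)] [:: (Cross e, i); (Cup b, j)].
Proof.
move=> le; have := far_move (Cup b) (Cross e) j (i - j).
by rewrite /= addn0 addnAC !subnKC // addn2 => /stable_step.
Qed.

(** The crossing slides around two arcs to their right legs. Strands [i] and [i.+1] are joined to
    strands 2m + 1 - i and 2m - i, whence the new place. Each of the two slides flips the sign, so
    [e] is restored. *)
Lemma cross_caps m i e : i < m ->
  stable_eq ((Cross e, i) :: caps m.+1) ((Cross e, m.*2 - i) :: caps m.+1).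
Proof.
elim: m i => // m IHm i; rewrite ltnS leq_eqVlt => /predU1P[->|lti].
  rewrite (_ : m.+1.*2 - m = m.+2); last lia.
  rewrite !capsS.
  suff swap : stable_eq [:: (Cross e, m); (Cap, m.+1); (Cap, m)]
                        [:: (Cross e, m.+2); (Cap, m.+1); (Cap, m)].
    exact: (stable_ctx [::] (caps m) swap).
  apply: (@stable_trans _ [:: (Cross (~~ e), m.+1); (Cap, m); (Cap, m)]).
    exact: (stable_ctx [::] [:: (Cap, m)] (stable_step (slide_cap_move e m))).
  apply: (@stable_trans _ [:: (Cross (~~ e), m.+1); (Cap, m.+2); (Cap, m)]).
    apply: stable_cons; have := far_move Cap Cap m 0.
    by rewrite /= !addn0 addn2 => /stable_step.
  have := stable_ctx [::] [:: (Cap, m)] (stable_step (slide_cap_move (~~ e) m.+1)).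
  by rewrite negbK.
rewrite capsS.
apply: stable_trans (stable_ctx [::] (caps m.+1) (cross_cap_swap e (_ : i.+1 < m.+1))) _.
  by [].
apply: stable_trans (stable_cons _ (IHm _ lti)) _.
rewrite (_ : m.+1.*2 - i = (m.*2 - i).+2); last lia.
by apply: (stable_ctx [::] (caps m.+1) (cap_cross_swap e (_ : m.+1 <= m.*2 - i))); lia.
Qed.

Lemma cups_cross m i e : i < m ->
  stable_eq (cups m.+1 ++ [:: (Cross e, i)]) (cups m.+1 ++ [:: (Cross e, m.*2 - i)]).
Proof.
elim: m i => // m IHm i; rewrite ltnS leq_eqVlt => /predU1P[->|lti].
  rewrite (_ : m.+1.*2 - m = m.+2); last lia.
  rewrite !cupsS -!catA; apply: stable_cat; first exact: stable_refl.
  apply: (@stable_trans _ [:: (Cup true, m); (Cup true, m); (Cross (~~ e), m.+1)]).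
    apply: stable_cons; apply: stable_sym; apply: stable_step.
    by have := slide_cup_move true (~~ e) m; rewrite negbK.
  apply: (@stable_trans _ [:: (Cup true, m); (Cup true, m.+2); (Cross (~~ e), m.+1)]).
    apply: (@stable_cat [:: _; _] [:: _; _]); last exact: stable_refl.
    apply: stable_sym; have := far_move (Cup true) (Cup true) m 0.
    by rewrite /= !addn0 addn2 => /stable_step.
  by apply: stable_cons; apply: stable_sym; apply: stable_step; apply: slide_cup_move.
rewrite cupsS -!catA.
apply: (@stable_trans _ (cups m.+1 ++ [:: (Cross e, i); (Cup true, m.+1)])).
  by apply: stable_cat (stable_refl _) (stable_sym (cross_cup_swap _ _ _)).
rewrite -[[:: (Cross e, i); _]]/([:: _] ++ [:: _]) (catA _ [:: (Cross e, i)]).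
apply: stable_trans (stable_cat (IHm _ lti) (stable_refl _)) _.
rewrite -catA; apply: stable_cat (stable_refl _) _; apply: stable_sym.
rewrite (_ : m.+1.*2 - i = (m.*2 - i).+2); last lia.
by apply: cup_cross_swap; lia.
Qed.

Lemma crossings_swap m b l : below m b ->
  (forall e i, i < m -> stable_eq [:: (Cross e, i); l] [:: l; (Cross e, i)]) ->
  stable_eq (crossings b ++ [:: l]) (l :: crossings b).
Proof.
move=> + swap; elim: b => [_|[i e] b IHb /andP[/= lti /IHb {}IHb]].
  exact: stable_refl.
apply: stable_trans (stable_cons _ IHb) _.
exact: (stable_ctx [::] (crossings b) (swap _ _ _)).
Qed.

(** The letter travels around the closure: along the cups to the downward strands, up past [b], and
    back along the caps. *)
Lemma stable_rotation m i e b : i < m -> below m b ->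
  stable_eq (strand_closure m ((i, e) :: b)) (strand_closure m (b ++ [:: (i, e)])).
Proof.
move=> lti bb; rewrite /strand_closure crossings_cat -!catA.
rewrite -[crossings (_ :: b)]/([:: (Cross e, i)] ++ crossings b).
rewrite -!catA catA.
apply: stable_trans (stable_cat (cups_cross e lti) (stable_refl _)) _.
rewrite -catA; apply: stable_cat (stable_refl _) _.
apply: (@stable_trans _ (crossings b ++ (Cross e, m.*2 - i) :: caps m.+1)).
  rewrite -[(Cross e, _) :: caps _]cat1s !catA.
  apply: stable_cat (stable_refl _); apply: stable_sym.
  apply: (crossings_swap bb) => e' i' lti'; apply: cross_cross_swap; lia.
by apply: stable_cat (stable_refl _) (stable_sym (cross_caps _ _)).
Qed.

(** The innermost cup is lifted past [b], which leaves a curl for the first Reidemeister move. *)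
Lemma stable_markov m e b : below m b ->
  stable_eq (strand_closure m.+1 (b ++ [:: (m, e)]))
    (cups m.+1 ++ crossings b ++ [:: (Cup true, m.+1); (Cross e, m); (Cap, m.+1)]
       ++ caps m.+1).
Proof.
move=> bb; rewrite /strand_closure cupsS capsS crossings_cat -!catA.
apply: stable_cat (stable_refl _) _.
have swap : stable_eq ([:: (Cup true, m.+1)] ++ crossings b)
                      (crossings b ++ [:: (Cup true, m.+1)]).
  apply: stable_sym; apply: (crossings_swap bb) => e' i' lti'.
  by apply: cross_cup_swap.
have := stable_cat swap (stable_refl [:: (Cross e, m), (Cap, m.+1) & caps m.+1]).
by rewrite -!catA.
Qed.

Local Open Scope ring_scope.

(** * Skein modules of braid words *)

Inductive word_move : seq (nat * bool) -> seq (nat * bool) -> Prop :=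
| WordCancel i e : word_move [:: (i, e); (i, ~~ e)] [::]
| WordFar i j e e' : (i.+1 < j)%N ->
    word_move [:: (i, e); (j, e')] [:: (j, e'); (i, e)]
| WordBraid i : word_move [:: (i, true); (i.+1, true); (i, true)]
                          [:: (i.+1, true); (i, true); (i.+1, true)].

Section Uniqueness.
Variables (R : comNzRingType) (z : R).
Implicit Types (D : seq (nat * bool) -> R) (b c x y : seq (nat * bool)).

(** A linear functional on the Hecke algebra of [m.+1] strands, given by its values on braid
    words. *)
Record skein_invariant m D : Prop := SkeinInvariant {
  inv_skein : forall i b c, (i < m)%N -> below m b -> below m c ->
    D (b ++ (i, true) :: c) - D (b ++ (i, false) :: c) = z * D (b ++ c);
  inv_move : forall b c x y, word_move x y ->
    below m b -> below m x -> below m y -> below m c ->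
    D (b ++ x ++ c) = D (b ++ y ++ c)
}.

Lemma skein_invariantW m D : skein_invariant m.+1 D -> skein_invariant m D.
Proof.
have W b : below m b -> below m.+1 b by apply: belowW.
by case=> sk mv; split=> *; [apply: sk | apply: mv]; auto; apply: ltnW.
Qed.

Lemma skein_invariant_ctx m D p q : below m p -> below m q ->
  skein_invariant m D -> skein_invariant m (fun b => D (p ++ b ++ q)).
Proof.
move=> bp bq [sk mv]; split=> [i b c lti bb bc|b c x y xy bb bx by_ bc].
  rewrite -!catA !(catA p) sk // ?below_cat ?bp ?bq ?bb ?bc //.
by rewrite -!catA !(catA p) (mv _ _ _ _ xy) // below_cat ?bp ?bq ?bb ?bc.
Qed.

Lemma skein_invariantB m D D' (k : R) : skein_invariant m D ->
  skein_invariant m D' -> skein_invariant m (fun b => D b - k * D' b).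
Proof.
move=> [sk mv] [sk' mv']; split=> [i b c lti bb bc|b c x y xy bb bx by_ bc].
  have := sk i b c lti bb bc; have := sk' i b c lti bb bc.
  move=> e' e; by rewrite opprB addrACA mulrBr -e mulrCA -e'; ring.
by rewrite (mv _ _ _ _ xy) // (mv' _ _ _ _ xy).
Qed.

Definition basic_zero m D : Prop :=
  (forall x, below m x -> D x = 0) /\
  (forall x e y, below m x -> below m y -> D (x ++ (m, e) :: y) = 0).

Section Reduction.
Variables (m : nat) (D : seq (nat * bool) -> R).
Hypotheses (inv : skein_invariant m.+1 D) (bas : basic_zero m D).

Let lt_mm : (m < m.+1)%N := ltnSn m.
Let W b : below m b -> below m.+1 b. Proof. by apply: belowW. Qed.

(** If the word without the letter has value 0, the skein relation gives a letter and its inverse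
    the same value. *)
Lemma inv_flip i b c : (i < m.+1)%N -> below m.+1 b -> below m.+1 c ->
  D (b ++ c) = 0 -> D (b ++ (i, true) :: c) = 0 ->
  forall e, D (b ++ (i, e) :: c) = 0.
Proof.
move=> lti bb bc D0 D1 [] //; have := inv_skein inv lti bb bc.
by rewrite D0 D1 mulr0 sub0r => /eqP; rewrite oppr_eq0 => /eqP.
Qed.

Lemma inv_square x y e e' : below m x -> below m y ->
  D (x ++ (m, e) :: (m, e') :: y) = 0.
Proof.
move=> bx by_; have [bas1 bas2] := bas.
have bmy e2 : below m.+1 ((m, e2) :: y) by rewrite /= lt_mm W.
have sq_ne e2 : D (x ++ (m, e2) :: (m, ~~ e2) :: y) = 0.
  rewrite -[x ++ _]/(x ++ [:: (m, e2); (m, ~~ e2)] ++ y).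
  rewrite (inv_move inv (WordCancel m e2) (W bx) _ _ (W by_)) /= ?lt_mm //.
  by rewrite bas1 // below_cat bx.
have [-> | ->] : e' = ~~ e \/ e' = e by case: e; case: e'; auto.
  exact: sq_ne.
case: e {e'}.
  have := inv_skein inv lt_mm (W bx) (bmy true).
  by rewrite (bas2 x true y) // mulr0 (sq_ne false) subr0.
have := inv_skein inv lt_mm (W bx) (bmy false).
by rewrite (bas2 x false y) // mulr0 (sq_ne true) sub0r => /eqP; rewrite oppr_eq0 => /eqP.
Qed.

Lemma inv_commute k p x q e : (k < m)%N -> below k x -> below m.+1 p -> below m.+1 q ->
  D (p ++ (m, e) :: x ++ q) = D (p ++ x ++ (m, e) :: q).
Proof.
move=> ltk; elim: x p => // -[i e'] x IHx p /andP[/= lti bx] bp bq.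
have lti' : (i < m.+1)%N by lia.
have bxq : below m.+1 (x ++ q) by rewrite below_cat bq (belowW _ bx) //; lia.
rewrite -[p ++ (m, e) :: _]/(p ++ [:: (m, e); (i, e')] ++ (x ++ q)).
have ltk' : (i.+1 < m)%N by lia.
rewrite -(inv_move inv (WordFar e' e ltk') bp _ _ bxq) /= ?lti' ?lt_mm //.
rewrite -cat1s catA [RHS](_ : _ = D ((p ++ [:: (i, e')]) ++ x ++ (m, e) :: q)).
  by rewrite IHx // below_cat bp /= lti'.
by rewrite -catA.
Qed.

(** By [inv_flip] all exponents may be taken positive, and the braid relation then leaves a single
    letter [m]. *)
Lemma inv_triple m' x y e e' e'' : m = m'.+1 -> below m x -> below m y ->
  D (x ++ (m, e) :: (m', e') :: (m, e'') :: y) = 0.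
Proof.
move=> em bx by_; have [bas1 bas2] := bas.
have ltm' : (m' < m)%N by rewrite em.
have b1 e1 : below m.+1 ((m, e1) :: y) by rewrite /= lt_mm W.
have b2 e1 e2 : below m.+1 ((m', e1) :: (m, e2) :: y).
  by rewrite /= lt_mm (leqW ltm') W.
have b3 e1 : below m.+1 (x ++ [:: (m, e1)]) by rewrite below_cat W //= lt_mm.
have b4 e1 e2 : below m.+1 (x ++ [:: (m, e1); (m', e2)]).
  by rewrite below_cat W //= lt_mm (leqW ltm').
have catE e1 e2 c : x ++ [:: (m, e1), (m', e2) & c] = (x ++ [:: (m, e1)]) ++ (m', e2) :: c.
  by rewrite -catA.
have catE' e1 e2 c : (x ++ [:: (m, e1)]) ++ (m', e2) :: c = (x ++ [:: (m, e1); (m', e2)]) ++ c.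
  by rewrite -!catA.
apply: (inv_flip lt_mm (W bx) (b2 _ _)).
  by rewrite -cat1s catA bas2 // below_cat bx /= ltm'.
rewrite catE; apply: (inv_flip (leqW ltm') (b3 _) (b1 _)).
  by rewrite -catA inv_square.
rewrite catE'; apply: (inv_flip lt_mm (b4 _ _) (W by_)).
  by rewrite -catA bas2 //= ltm'.
rewrite -catA -[[:: _; _] ++ _]/([:: (m, true); (m', true); (m, true)] ++ y).
have := inv_move inv (WordBraid m') (W bx) _ _ (W by_); rewrite -em => <-; first last.
- by rewrite /= lt_mm (leqW ltm').
- by rewrite /= lt_mm (leqW ltm').
rewrite -[[:: _; _; _] ++ y]/([:: (m', true)] ++ (m, true) :: (m', true) :: y).
by rewrite catA bas2 //= ?ltm' // below_cat bx /= ltm'.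
Qed.

End Reduction.

(* The words x and x s_m^{+-1} y, with x and y free of s_m, span the algebra. *)
Lemma skein_invariant_zero m D : skein_invariant m.+1 D -> basic_zero m D ->
  forall b, below m.+1 b -> D b = 0.
Proof.
elim: m D => [|m IHm] D inv bas b.
  elim: b D inv bas => [|[i e] b IHb] D inv [bas1 bas2] bb; first exact: bas1.
  move: bb => /= /andP[]; rewrite ltnS leqn0 => /eqP -> bb.
  have bx (x : seq (nat * bool)) : below 0 x -> x = [::] by case: x.
  have binv : skein_invariant 1 (fun b => D ([:: (0%N, e)] ++ b ++ [::])).
    exact: skein_invariant_ctx.
  suff bas : basic_zero 0 (fun b => D ([:: (0%N, e)] ++ b ++ [::])).
    by have := IHb _ binv bas bb; rewrite cats0.
  split=> [x /bx -> | x e' y /bx -> /bx ->]; first exact: (bas2 [::]).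
  have nil0 : below 0 [::] by [].
  exact: (inv_square inv (conj bas1 bas2) e e' nil0 nil0).
elim: b D inv bas => [|[i e] b IHb] D inv [bas1 bas2] bb; first exact: bas1.
move: bb => /= /andP[lti bb].
have binv : skein_invariant m.+2 (fun b => D ([:: (i, e)] ++ b ++ [::])).
  by apply: skein_invariant_ctx; rewrite //= lti.
suff: basic_zero m.+1 (fun b => D ([:: (i, e)] ++ b ++ [::])).
  by move=> bas; have := IHb _ binv bas bb; rewrite cats0.
have W (x : seq (nat * bool)) : below m x -> below m.+1 x by apply: belowW.
move: lti; rewrite ltnS leq_eqVlt => /predU1P[->|lti]; last first.
  split=> [x bx|x e' y bx by_]; rewrite cats0 /=; first by rewrite bas1 //= lti.
  by rewrite (bas2 ((i, e) :: x)) //= lti.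
split=> [x bx|x e' y bx by_]; rewrite cats0 /=; first exact: (bas2 [::]).
have W' (w : seq (nat * bool)) : below m.+1 w -> below m.+2 w by apply: belowW.
(* Two letters [m.+1] enclose [x]. As a function of [x] the value is again an invariant, so the
   induction on [m] reduces to [x] with at most one letter [m], that is to [inv_square] and
   [inv_triple]. *)
apply: (IHm (fun w => D ([:: (m.+1, e)] ++ w ++ (m.+1, e') :: y))) bx.
  apply: skein_invariantW; apply: skein_invariant_ctx => //=.
    by rewrite ltnSn.
  by rewrite ltnSn W'.
have com p w q e2 : below m w -> below m.+2 p -> below m.+2 q ->
    D (p ++ (m.+1, e2) :: w ++ q) = D (p ++ w ++ (m.+1, e2) :: q).
  by move=> bw bp bq; apply: (inv_commute inv) bw bp bq.
have lt2 : (m.+1 < m.+2)%N by [].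
have lt1 : (m < m.+2)%N by [].
split=> [x' bx'|x' e2 y' bx' by'] /=.
  rewrite (com [::]) //=; last by rewrite lt2 W'.
  exact: (inv_square inv (conj bas1 bas2) _ _ (W _ bx') by_).
have bq : below m.+2 ((m, e2) :: y' ++ (m.+1, e') :: y).
  by rewrite /= below_cat /= lt1 lt2 (W' _ by_) (W' _ (W _ by')).
have bp : below m.+2 (x' ++ [:: (m.+1, e); (m, e2)]).
  by rewrite below_cat /= lt1 lt2 (W' _ (W _ bx')).
rewrite -catA (com [::]) //.
have := com _ _ _ e' by' bp (W' _ by_); rewrite -!catA /= => <-.
apply: (inv_triple inv (conj bas1 bas2) _ _ _ (erefl _) (W _ bx')).
by rewrite below_cat (W _ by').
Qed.

End Uniqueness.

(** * The Hecke algebra and its Ocneanu trace *)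

Section Hecke.
Variables (r : nat) (R : comNzRingType) (z : R).

Notation V := {ffun 'S_r.+1 -> R^o}.
Implicit Types (g : V) (v : 'S_r.+1) (x : nat * bool) (b : seq (nat * bool)).

Definition hsign (e : bool) : R := if e then z else - z.

(** The coefficient of T_v in T_v T_i^(+-1). At a descent T_v T_i = T_(v s_i) + z T_v, and T_i^-1 =
    T_i - z contributes -z exactly at the ascents. *)
Definition stay x v : R := if desc v x.1 == x.2 then hsign x.2 else 0.

(* Right multiplication by T_i or its inverse on the standard basis, transposed:
   (heckeT (i, e) g) v is the value of the functional g at T_v T_i^{+-1}. *)
Definition heckeT x g : V :=
  [ffun v => g (v ∘ simple_refl r x.1) + stay x v * g v].

Definition hecke b g : V := foldr heckeT g b.

(** The functional tau, so that [hecke b hecke1 v] is the trace of T_v times the image of [b]. *)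
Definition hecke1 : V := [ffun v => (v == 1%g)%:R].

Lemma hecke_cat b b' g : hecke (b ++ b') g = hecke b (hecke b' g).
Proof. exact: foldr_cat. Qed.

Lemma heckeT_linear x (c : R) g g' :
  heckeT x (c *: g + g') = c *: heckeT x g + heckeT x g'.
Proof. by apply/ffunP => v; rewrite !ffunE /GRing.scale /=; ring. Qed.

HB.instance Definition _ x :=
  GRing.isLinear.Build R V V _ (heckeT x) (@heckeT_linear x).

Lemma hecke_linear b (c : R) g g' :
  hecke b (c *: g + g') = c *: hecke b g + hecke b g'.
Proof. by elim: b => //= x b ->; rewrite linearP. Qed.

HB.instance Definition _ b :=
  GRing.isLinear.Build R V V _ (hecke b) (@hecke_linear b).

Lemma heckeT_skein i g : heckeT (i, true) g = heckeT (i, false) g + z *: g.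
Proof.
apply/ffunP => v; rewrite !ffunE /stay /= /GRing.scale /=.
by case: (desc v i); rewrite /=; ring.
Qed.

Lemma heckeTK i e g : (i < r)%N -> heckeT (i, e) (heckeT (i, ~~ e) g) = g.
Proof.
move=> lti; apply/ffunP => v; rewrite !ffunE /stay /= pcompsK descK //.
by case: (desc v i); case: e; rewrite /=; ring.
Qed.

Lemma heckeT_far i j e e' g : (i.+1 < j)%N -> (j < r)%N ->
  heckeT (i, e) (heckeT (j, e') g) = heckeT (j, e') (heckeT (i, e) g).
Proof.
move=> ltij ltj; apply/ffunP => v; rewrite !ffunE /stay /=.
rewrite !desc_far ?ltij ?orbT //; try lia.
rewrite -!pcompA simple_refl_comm //; ring.
Qed.

Lemma heckeT_braid i g : (i.+1 < r)%N ->
  heckeT (i, true) (heckeT (i.+1, true) (heckeT (i, true) g))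
  = heckeT (i.+1, true) (heckeT (i, true) (heckeT (i.+1, true) g)).
Proof.
move=> lti; apply/ffunP => v; rewrite !ffunE /stay /= !pcompsK.
rewrite !descK; try lia.
have b := @simple_refl_braid r i lti.
have := congr1 (Defs.pcomp v) b; rewrite !pcompA => ->.
rewrite /desc !pcompE !(simple_reflL, simple_reflR); try lia.
rewrite !(@simple_reflD r i i.+2) ?(@simple_reflD r i.+1 i); try lia.
rewrite !(simple_reflL, simple_reflR); try lia.
move: (v (inord i) : nat) (v (inord i.+1) : nat) (v (inord i.+2) : nat) => a a1 a2.
(* The only coincidence of group elements beyond the braid relation. *)
case: (ltnP a1 a) => h1; case: (ltnP a2 a1) => h2; case: (ltnP a2 a) => h3 /=;
  try lia; ring.
Qed.

End Hecke.

(** The multiplicative Jucys-Murphy element L_(m+1): strand [m] encircles the strands 0, ..., m -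
    1. *)
Fixpoint jm (m : nat) : seq (nat * bool) :=
  if m is m'.+1 then (m', true) :: jm m' ++ [:: (m', true)] else [::].

Lemma below_jm m : below m (jm m).
Proof.
by elim: m => // m IHm; rewrite /= below_cat (belowW _ IHm) //= !ltnSn.
Qed.

Section Markov.
Variables (r : nat) (R : comNzRingType) (z : R).

Notation V := {ffun 'S_r.+1 -> R^o}.
Implicit Types (g h : V) (v u : 'S_r.+1) (b x y : seq (nat * bool)).
Local Notation T := (heckeT z).
Local Notation hecke := (@hecke r R z).
Local Notation delta := (hecke1 r R).

Lemma hecke_jmS m g :
  hecke (jm m.+1) g = T (m, true) (hecke (jm m) (T (m, true) g)).
Proof. by rewrite /= hecke_cat. Qed.

Lemma heckeT_comm_inv i g (H : V -> V) : (i < r)%N ->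
  (forall g, H (T (i, true) g) = T (i, true) (H g)) ->
  H (T (i, false) g) = T (i, false) (H g).
Proof.
move=> lti com; rewrite -[H _](heckeTK z false _ lti) /= -com.
by rewrite (heckeTK z true).
Qed.

Lemma hecke_far b m e g : below m b -> (m.+1 < r)%N ->
  hecke b (T (m.+1, e) g) = T (m.+1, e) (hecke b g).
Proof.
move=> bb ltm; elim: b bb => //= -[i e'] b IHb /andP[/= lti /IHb ->].
by rewrite heckeT_far.
Qed.

(** The strand of [jm m.+1] encircles the lower ones as a bundle, and crossings within the bundle
    slide through. The braid relation settles the highest generator; induction gives the others. *)
Lemma jm_comm m i e g : (i < m)%N -> (m < r)%N ->
  hecke (jm m.+1) (T (i, e) g) = T (i, e) (hecke (jm m.+1) g).
Proof.
move=> ltim ltmr; move: e g.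
suff com : forall g, hecke (jm m.+1) (T (i, true) g)
                     = T (i, true) (hecke (jm m.+1) g).
  by case=> // g; apply: heckeT_comm_inv com; lia.
elim: m i ltim ltmr => // m IHm i; rewrite ltnS leq_eqVlt => /predU1P[->|lti] ltm g.
  rewrite !(hecke_jmS m.+1) !(hecke_jmS m) (heckeT_braid z g) //.
  have far g' : hecke (jm m) (T (m.+1, true) g') = T (m.+1, true) (hecke (jm m) g').
    by apply: hecke_far (below_jm m) _.
  by rewrite far -heckeT_braid.
rewrite !(hecke_jmS m.+1) -heckeT_far // IHm //; last lia.
by rewrite [RHS]heckeT_far.
Qed.

Lemma jm_comm_below m b g : below m b -> (m < r)%N ->
  hecke (jm m.+1) (hecke b g) = hecke b (hecke (jm m.+1) g).
Proof.
by move=> bb ltm; elim: b bb => //= -[i e] b IHb /andP[/= lti /IHb <-]; apply: jm_comm.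
Qed.

Definition fixes_above m v : Prop :=
  forall k, (m < k <= r)%N -> v (inord k) = inord k.

Lemma fixes_above1 m : fixes_above m 1%g.
Proof. by move=> k _; rewrite perm1. Qed.

Lemma fixes_aboveM m i v : (i < m)%N -> (m <= r)%N -> fixes_above m v ->
  fixes_above m (v ∘ simple_refl r i).
Proof. by move=> lti ltm fv k ltk; rewrite pcompE simple_reflD ?fv //; lia. Qed.

Lemma fixes_above_le m v k : fixes_above m v -> (m <= r)%N -> (k <= m)%N ->
  (v (inord k) <= m)%N.
Proof.
move=> fv lem lek; rewrite leqNgt; apply/negP => lt.
have := fv (v (inord k)); rewrite lt -ltnS ltn_ord => /(_ isT).
rewrite inord_val => /perm_inj /(congr1 val) /=; rewrite inordK; lia.
Qed.

Lemma hecke_eq_on m b g h : below m b -> (m <= r)%N ->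
  (forall v, fixes_above m v -> g v = h v) ->
  forall v, fixes_above m v -> hecke b g v = hecke b h v.
Proof.
move=> + lem eq_gh; elim: b => //= -[i e] b IHb /andP[/= lti /IHb {}IHb] v fv.
by rewrite !ffunE (IHb v) // IHb //; apply: fixes_aboveM.
Qed.

Lemma hecke_supp m b v k : below m b -> (m < k <= r)%N ->
  v (inord k) != inord k -> hecke b delta v = 0.
Proof.
move=> + ltk; elim: b v => [v _|[i e] b IHb v] /=.
  by rewrite ffunE; case: (v =P 1%g) => // ->; rewrite perm1 eqxx.
case/andP=> /= lti bb vk; rewrite ffunE !IHb ?mulr0 ?addr0 //=.
by rewrite pcompE simple_reflD //; lia.
Qed.

(** The letter [m] moves the label [m.+1], and a word in lower letters cannot bring it back. *)
Lemma markov_pos m y v : below m y -> (m < r)%N -> fixes_above m v ->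
  T (m, true) (hecke y delta) v = 0.
Proof.
move=> by_ ltm fv; have le := fixes_above_le fv (ltnW ltm) (leqnn m).
have fm : v (inord m.+1) = inord m.+1 by apply: fv; lia.
rewrite ffunE /stay /desc /= fm inordK // ltnNge (leq_trans le) //= mul0r addr0.
rewrite (hecke_supp (m := m) (k := m.+1)) //; first lia.
by rewrite pcompE simple_reflR // -val_eqE /= inordK //; lia.
Qed.

Lemma markov_neg m y v : below m y -> (m < r)%N -> fixes_above m v ->
  T (m, false) (hecke y delta) v = - z * hecke y delta v.
Proof.
move=> by_ ltm fv; have := markov_pos by_ ltm fv; rewrite heckeT_skein ffunE.
by move/eqP; rewrite addr_eq0 => /eqP ->; rewrite !ffunE mulNr.
Qed.

(* The largest label has to travel from position k down to 0 and back. *)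
Lemma hecke_jm_id m k g v : (m < r)%N -> (k <= m.+1)%N ->
  (forall u, fixes_above m.+1 u -> u (inord k) != inord m.+1 -> g u = 0) ->
  fixes_above m.+1 v -> v (inord k) = inord m.+1 -> hecke (jm k) g v = g v.
Proof.
move=> ltm; elim: k g v => // k IHk g v lek supp fv vk.
have ne u p q : (p <= r)%N -> (q <= r)%N -> p != q ->
    u (inord q) = inord m.+1 -> u (inord p) != inord m.+1.
  by move=> lp lq pq <-; rewrite (inj_eq perm_inj) inord_eq.
have nodesc u : fixes_above m.+1 u -> u (inord k.+1) = inord m.+1 ->
    desc u k = false.
  move=> fu uk; rewrite /desc uk inordK // ltnNge fixes_above_le //; lia.
have lek' : (k <= m.+1)%N by lia.
have fvs : fixes_above m.+1 (v ∘ simple_refl r k) by apply: fixes_aboveM.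
rewrite hecke_jmS ffunE /stay /= nodesc // mul0r addr0 IHk //.
- rewrite ffunE /= pcompsK (supp (v ∘ _)) ?mulr0 ?addr0 //.
  by rewrite pcompE simple_reflR ?(ne v k k.+1) //; lia.
- move=> u fu uk; rewrite ffunE /stay /= supp ?add0r; first last.
  + by rewrite pcompE simple_reflR //; lia.
  + by apply: fixes_aboveM.
  have [/nodesc -> //|/(supp _ fu) ->] := eqVneq (u (inord k.+1)) (inord m.+1).
    by rewrite mul0r.
  by rewrite mulr0.
- by rewrite pcompE simple_reflL //; lia.
Qed.

Lemma markov_jm m y v : below m y -> (m < r)%N -> fixes_above m v ->
  hecke (jm m.+1) (hecke y delta) v = hecke y delta v.
Proof.
move=> by_ ltm fv; apply: (@hecke_jm_id m) => //.
- by move=> u _; apply: hecke_supp by_ _; lia.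
- by move=> k lek; apply: fv; lia.
- by apply: fv; lia.
Qed.

Variables a a' : R.

(* The product of the operators a L_j - a', for L_j the multiplicative
   Jucys-Murphy elements: followed by the evaluation at 1, it is the
   Ocneanu trace up to a power of z. *)
Fixpoint jmprod m g : V :=
  if m is m'.+1 then a *: hecke (jm m) (jmprod m' g) - a' *: jmprod m' g else g.

Definition ocneanu m b : R := jmprod m (hecke b delta) 1%g.

Lemma jmprod_linear m (c : R) g h :
  jmprod m (c *: g + h) = c *: jmprod m g + jmprod m h.
Proof.
elim: m => //= m ->; rewrite (linearP (@hecke _)) !linearP /=.
by apply/ffunP => v; rewrite !ffunE /GRing.scale /=; ring.
Qed.

HB.instance Definition _ m :=
  GRing.isLinear.Build R V V _ (jmprod m) (@jmprod_linear m).

Lemma jmprod_comm m k g : (k <= m)%N -> (m < r)%N ->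
  hecke (jm m.+1) (jmprod k g) = jmprod k (hecke (jm m.+1) g).
Proof.
move=> + ltm; elim: k g => // k IHk g ltk.
have jmprodS g' : jmprod k.+1 g' = a *: hecke (jm k.+1) (jmprod k g') - a' *: jmprod k g'.
  by [].
rewrite !jmprodS linearB !linearZ -IHk ?(ltnW ltk) //.
by rewrite -jm_comm_below // (belowW _ (below_jm _)).
Qed.

Lemma combE (c c' : R) g h v : (c *: g - c' *: h) v = c * g v - c' * h v.
Proof. by rewrite !ffunE. Qed.

Lemma jmprod_eq_on m g h : (m <= r)%N ->
  (forall v, fixes_above m v -> g v = h v) ->
  forall v, fixes_above m v -> jmprod m g v = jmprod m h v.
Proof.
move=> lem eq_gh; suff: forall k, (k <= m)%N -> forall v, fixes_above m v ->
  jmprod k g v = jmprod k h v by apply.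
elim=> // k IHk lek v fv; have lek' : (k <= m)%N by lia.
have jmprodS g' : jmprod k.+1 g' v
    = a * hecke (jm k.+1) (jmprod k g') v - a' * jmprod k g' v.
  exact: combE.
rewrite !jmprodS IHk //; congr (_ * _ - _).
exact: hecke_eq_on (belowW lek (below_jm _)) lem (IHk lek') _ fv.
Qed.

(** The last factor commutes with the others and with [x], so it can act next to the letter. There,
    with L for [jm m.+1] and L' for [jm m], L T_m^-1 = T_m L' has trace 0 against [fixes_above m],
    and T_m = T_m^-1 + z. What survives is a z or a' z times [y]. *)
Lemma ocneanu_markov m e x y : (m < r)%N -> below m x -> below m y ->
  ocneanu m.+1 (x ++ (m, e) :: y) = (if e then a else a') * z * ocneanu m (x ++ y).
Proof.
move=> ltm bx by_; rewrite /ocneanu !hecke_cat.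
set Y := hecke y delta; pose h := a *: hecke (jm m.+1) (T (m, e) Y) - a' *: T (m, e) Y.
have -> : jmprod m.+1 (hecke x (hecke ((m, e) :: y) delta)) = jmprod m (hecke x h).
  rewrite [jmprod m.+1 _]/(a *: hecke (jm m.+1) (jmprod m _) - a' *: jmprod m _).
  rewrite jmprod_comm // jm_comm_below //.
  by rewrite /h !linearB !linearZ.
have jmV : hecke (jm m.+1) (T (m, false) Y) = T (m, true) (hecke (jm m) Y).
  by rewrite hecke_jmS (heckeTK z true).
have jmT : hecke (jm m.+1) (T (m, true) Y)
    = T (m, true) (hecke (jm m) Y) + z *: hecke (jm m.+1) Y.
  by rewrite -jmV heckeT_skein addrC hecke_linear addrC.
suff eq_h v : fixes_above m v -> h v = (((if e then a else a') * z) *: Y) v.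
  rewrite (jmprod_eq_on (ltnW ltm) (hecke_eq_on bx (ltnW ltm) eq_h)).
    by rewrite !linearZ ffunE.
  exact: fixes_above1.
have jmV0 u : fixes_above m u -> T (m, true) (hecke (jm m) Y) u = 0.
  by move=> fu; rewrite /Y -hecke_cat markov_pos // below_cat below_jm.
move=> fv; rewrite [RHS]ffunE /h combE; case: (e).
  rewrite markov_pos // jmT.
  rewrite [(_ + _ : V) v]ffunE [(_ *: _ : V) v]ffunE jmV0 //.
  by rewrite markov_jm // /GRing.scale /=; ring.
by rewrite jmV jmV0 // markov_neg // /GRing.scale /=; ring.
Qed.

Lemma ocneanu_skein m i b c :
  ocneanu m (b ++ (i, true) :: c) - ocneanu m (b ++ (i, false) :: c)
  = z * ocneanu m (b ++ c).
Proof.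
rewrite /ocneanu !hecke_cat /= heckeT_skein !linearD !linearZ /= !ffunE.
by rewrite addrAC subrr add0r.
Qed.

End Markov.

(** * The HOMFLYPT polynomial of a closed braid *)

Lemma skein_invariant_ocneanu r (R : comNzRingType) (z a a' : R) m : (m <= r)%N ->
  skein_invariant z m (ocneanu r z a a' m).
Proof.
move=> lem; split=> [i b c lti bb bc|b c x y xy bb bx by_ bc].
  exact: ocneanu_skein.
rewrite /ocneanu !hecke_cat; congr (jmprod _ _ _ _ (hecke _ _ _) _).
case: xy bx by_ => [i e|i j e e' lt|i] /= /and3P[] bi bj.
- by move=> _ _; rewrite heckeTK //; apply: leq_trans bi lem.
- by move=> _ _; rewrite heckeT_far //; apply: leq_trans bj lem.
- by move=> _ _; rewrite heckeT_braid //; apply: leq_trans bj lem.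
Qed.

(** The Markov property gives the values on words with one letter [m]. Those on words without it
    follow from the skein relation after division by [z]. *)
Lemma markov_trace_unique r (F : fieldType) (z a : F) (f : nat -> seq (nat * bool) -> F) :
  z != 0 -> (forall m, skein_invariant z m (f m)) -> f 0%N [::] = 1 ->
  (forall m e x y, below m x -> below m y ->
     f m.+1 (x ++ (m, e) :: y) = (if e then a else a^-1) * f m (x ++ y)) ->
  forall m b, (m <= r)%N -> below m b -> f m b = z ^- m * ocneanu r z a a^-1 m b.
Proof.
move=> z0 inv f0 mk; elim=> [|m IHm] b lem bb.
  by case: b bb => // _; rewrite f0 expr0 invr1 mul1r /ocneanu /= ffunE eqxx.
pose D b := f m.+1 b - z ^- m.+1 * ocneanu r z a a^-1 m.+1 b.
have invD : skein_invariant z m.+1 D.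
  by apply: skein_invariantB => //; apply: skein_invariant_ocneanu.
suff : D b = 0 by move/eqP; rewrite subr_eq0 => /eqP.
move: b bb; apply: (skein_invariant_zero invD).
have bas2 x e y : below m x -> below m y -> D (x ++ (m, e) :: y) = 0.
  move=> bx by_; rewrite /D mk // ocneanu_markov // IHm ?(ltnW lem) //; last first.
    by rewrite below_cat bx.
  set c := if e then _ else _; set o := ocneanu _ _ _ _ _ _.
  rewrite exprSr; have : z ^+ m != 0 by rewrite expf_neq0.
  by move: (z ^+ m) => t t0; field; rewrite z0 t0.
split=> // x bx; apply: (mulfI z0); rewrite mulr0 -[x]cats0.
have Wx : below m.+1 x by apply: belowW bx.
by rewrite -(inv_skein invD (ltnSn m) Wx) // !bas2 // subr0.
Qed.

Lemma frac_of_eq0 p : (frac_of p == 0) = (p == 0).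
Proof. by rewrite /frac_of tofrac_eq0. Qed.

Lemma var_a_neq0 : var_a != 0.
Proof. by rewrite /var_a frac_of_eq0 polyC_eq0 polyX_eq0. Qed.

Lemma var_z_neq0 : var_z != 0.
Proof. by rewrite /var_z frac_of_eq0 polyX_eq0. Qed.

Definition word_writhe (b : seq (nat * bool)) : int := \sum_(x <- b) sign_val x.2.

Lemma word_writhe_cat b c : word_writhe (b ++ c) = word_writhe b + word_writhe c.
Proof. exact: big_cat. Qed.

Lemma word_writhe_cons x b : word_writhe (x :: b) = sign_val x.2 + word_writhe b.
Proof. exact: big_cons. Qed.

Lemma word_writhe_move x y : word_move x y -> word_writhe x = word_writhe y.
Proof.
case=> [i e|i j e e' _|i]; rewrite /word_writhe !big_cons !big_nil //=.
  by case: e.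
by rewrite addrCA.
Qed.

Definition nat_word (m : nat) (b : braid_word m) : seq (nat * bool) :=
  [seq (nat_of_ord x.1, x.2) | x : 'I_m * bool <- b].

Lemma below_nat_word m (b : braid_word m) : below m (nat_word b).
Proof. by rewrite /below all_map; apply/allP => x _ /=. Qed.

Lemma below_lift m b : below m b -> exists b' : braid_word m, b = nat_word b'.
Proof.
elim: b => [_|[i e] b IHb /andP[/= lti /IHb [b' ->]]]; first by exists [::].
by exists ((Ordinal lti, e) :: b').
Qed.

Lemma strand_closure_nat m (b : braid_word m) :
  strand_closure m (nat_word b) = closure_word b.
Proof. by rewrite /strand_closure /closure_word /crossings -map_comp. Qed.

Lemma strand_closure_closed m b : below m b -> run (strand_closure m b) [::] == Some [::].
Proof. by case/below_lift=> b' ->; rewrite strand_closure_nat Defs.closure_closed. Qed.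

Lemma run_cups_crossings m b : below m b ->
  run (cups m.+1 ++ crossings b) [::] = Some (nseq m.+1 true ++ nseq m.+1 false).
Proof.
move=> bb; pose st n := nseq n true ++ nseq n false.
have run_cups n : run (cups n) [::] = Some (st n).
  elim: n => // n IHn; rewrite cupsS run_cat IHn.
  have := step_cup true (nseq n true) (nseq n false).
  rewrite size_nseq /run /= /obind /= /st => ->.
  by rewrite -[in RHS]addn1 nseqD -catA addn1.
rewrite run_cat run_cups -/(st m.+1) -[obind _ _]/(run _ _).
elim: b bb => [//|[i e] b IHb /andP[/= lti bb]].
rewrite -cat1s run_cat.
suff -> : run [:: (Cross e, i)] (st m.+1) = Some (st m.+1) by exact: IHb.
have -> : st m.+1 = nseq i true ++
    [:: true, true & nseq (m - i.+1) true ++ nseq m.+1 false].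
  rewrite -[true :: _]/(nseq 2 true ++ nseq (m - i.+1) true ++ _) /st !catA.
  by rewrite -!nseqD addn2 addSn subnKC.
have := step_cross e true true (nseq i true); rewrite size_nseq.
exact: (fun H => H (nseq (m - i.+1) true ++ nseq m.+1 false)).
Qed.

Section Invariant.
Variables (P : link_diagram -> laurent_field) (HP : is_HOMFLYPT P).

Definition homfly_word (w : seq letter) : laurent_field :=
  if insub w is Some D then P D else 0.

Lemma homfly_wordE D : homfly_word (diagram_word D) = P D.
Proof. by rewrite /homfly_word valK. Qed.

Lemma homfly_word_isotopic w w' :
  (forall D D', diagram_word D = w -> diagram_word D' = w' -> isotopic D D') ->
  run w [::] == Some [::] -> run w' [::] == Some [::] -> homfly_word w = homfly_word w'.
Proof.
move=> iso cw cw'; rewrite -[w]/(diagram_word (LinkDiagram cw)).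
rewrite -[w']/(diagram_word (LinkDiagram cw')) !homfly_wordE.
exact/(HOMFLYPT_isotopic HP)/iso.
Qed.

Lemma homfly_word_stable w w' : stable_eq w w' -> run w [::] == Some [::] ->
  homfly_word w = homfly_word w'.
Proof.
move=> ww cw; apply: homfly_word_isotopic => //; last by rewrite -(stable_run _ ww).
by move=> D D' eqD eqD'; apply: stable_isotopic; rewrite eqD eqD'.
Qed.

Lemma homfly_word_move p q x y : diagram_move x y ->
  run (p ++ x ++ q) [::] == Some [::] -> run (p ++ y ++ q) [::] == Some [::] ->
  homfly_word (p ++ x ++ q) = homfly_word (p ++ y ++ q).
Proof.
move=> xy; apply: homfly_word_isotopic => D D' eqD eqD'.
by apply: rst_step; exists p, q, x, y.
Qed.

(** The power of a turns the HOMFLYPT relation into that of the Hecke algebra; in return,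
    stabilization multiplies by a or its inverse. *)
Definition framed m b : laurent_field :=
  var_a ^ word_writhe b * homfly_word (strand_closure m b).

Lemma strand_closure_cat m b x c :
  strand_closure m (b ++ x ++ c)
  = (cups m.+1 ++ crossings b) ++ crossings x ++ (crossings c ++ caps m.+1).
Proof. by rewrite /strand_closure !crossings_cat -!catA. Qed.

Lemma framed_stable m b c x y :
  word_move x y -> stable_eq (crossings x) (crossings y) ->
  below m (b ++ x ++ c) -> framed m (b ++ x ++ c) = framed m (b ++ y ++ c).
Proof.
move=> xy xy' bel; rewrite /framed !word_writhe_cat (word_writhe_move xy); congr (_ * _).
apply: homfly_word_stable; last exact: strand_closure_closed.
by rewrite !strand_closure_cat; apply: stable_ctx.
Qed.

Lemma skein_invariant_framed m : skein_invariant var_z m (framed m).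
Proof.
split=> [i b c lti bb bc|b c x y xy bb bx by_ bc]; last first.
  have bel : below m (b ++ x ++ c) by rewrite !below_cat bb bx bc.
  have wE : word_writhe (b ++ x ++ c) = word_writhe (b ++ y ++ c).
    by rewrite 4!word_writhe_cat (word_writhe_move xy).
  case: xy bx by_ bel wE => [i e|i j e e' lt|i] bx by_ bel wE.
  (* Cancellation is not a stable move, so both closures have to be shown closed. *)
  - rewrite /framed wE; congr (_ * _).
    rewrite !strand_closure_cat; apply: homfly_word_move.
    + exact: MoveR2.
    + by rewrite -strand_closure_cat strand_closure_closed.
    + by rewrite -strand_closure_cat strand_closure_closed // !below_cat bb bc.
  - by apply: framed_stable => //; [exact: WordFar | exact: cross_cross_swap].
  - by apply: framed_stable => //; [exact: WordBraid | apply/stable_step/braid_move].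
have bel e : below m (b ++ (i, e) :: c) by rewrite below_cat bb /= lti.
have bel0 : below m (b ++ c) by rewrite below_cat bb.
pose Lp := LinkDiagram (strand_closure_closed (bel true)).
pose Lm := LinkDiagram (strand_closure_closed (bel false)).
pose L0 := LinkDiagram (strand_closure_closed bel0).
have tri : skein_triple Lp Lm L0.
  exists (cups m.+1 ++ crossings b), (crossings c ++ caps m.+1).
  exists (nseq m.+1 true ++ nseq m.+1 false), i.
  rewrite !nth_cat !size_nseq !nth_nseq !ltnS (ltnW lti) lti /=.
  rewrite run_cups_crossings //; split=> //.
  - exact: (strand_closure_cat m b [:: (i, true)] c).
  - exact: (strand_closure_cat m b [:: (i, false)] c).
  - exact: (strand_closure_cat m b [::] c).
have := HOMFLYPT_skein HP tri; rewrite -!homfly_wordE /= /framed.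
set hp := homfly_word (strand_closure m (b ++ (i, true) :: c)).
set hm := homfly_word (strand_closure m (b ++ (i, false) :: c)).
set h0 := homfly_word (strand_closure m (b ++ c)).
rewrite !word_writhe_cat !word_writhe_cons /= [_ + (_ + word_writhe c)]addrCA.
rewrite [_ + (- 1 + _)]addrCA !(exprzD_nat, expfzDr _ _ var_a_neq0) => e.
rewrite expr1z; set w := var_a ^ _ * var_a ^ _.
rewrite [RHS]mulrCA -e mulrBr; clearbody w.
by rewrite [w * (_ * hp)]mulrCA [w * (_ * hm)]mulrCA -!mulrA.
Qed.

Lemma framed_rotation m i e b : (i < m)%N -> below m b ->
  framed m ((i, e) :: b) = framed m (b ++ [:: (i, e)]).
Proof.
move=> lti bb; rewrite /framed word_writhe_cat !word_writhe_cons addrC.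
rewrite [word_writhe [::]]big_nil addr0; congr (_ * _); apply: homfly_word_stable.
  exact: stable_rotation.
by rewrite strand_closure_closed //= lti.
Qed.

Lemma framed_cyclic m b c : below m b -> below m c -> framed m (b ++ c) = framed m (c ++ b).
Proof.
elim: b c => [|[i e] b IHb] c; first by rewrite cats0.
case/andP=> /= lti bb bc; have {}bb : below m b := bb.
have bbc : below m (b ++ c) by rewrite below_cat bb.
rewrite (framed_rotation _ lti bbc) -catA IHb // -?catA //.
by rewrite below_cat bc /= lti.
Qed.

(** Rotation brings the letter [m] to the end, where it closes up to a curl. *)
Lemma framed_markov m e x y : below m x -> below m y ->
  framed m.+1 (x ++ (m, e) :: y) = (if e then var_a else var_a^-1) * framed m (x ++ y).
Proof.
move=> bx by_; have W b : below m b -> below m.+1 b by apply: belowW.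
have byx : below m (y ++ x) by rewrite below_cat by_.
have bxm : below m.+1 (x ++ [:: (m, e)]) by rewrite below_cat (W _ bx) /= ltnSn.
rewrite -cat1s catA (framed_cyclic bxm (W _ by_)).
rewrite catA (framed_cyclic bx by_) /framed word_writhe_cat word_writhe_cons.
rewrite [word_writhe [::]]big_nil addr0 addrC (expfzDr _ _ var_a_neq0) -mulrA.
have -> : var_a ^ sign_val (m, e).2 = if e then var_a else var_a^-1.
  by case: (e); rewrite ?expr1z.
congr (_ * (_ * _)).
have closed := strand_closure_closed (W _ byx).
have closed1 : run (strand_closure m.+1 ((y ++ x) ++ [:: (m, e)])) [::] == Some [::].
  by rewrite strand_closure_closed // below_cat (W _ byx) /= ltnSn.
rewrite (homfly_word_stable (stable_markov e byx)) // catA.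
rewrite /strand_closure [RHS](_ : _ =
    homfly_word ((cups m.+1 ++ crossings (y ++ x)) ++ [::] ++ caps m.+1)).
  apply: homfly_word_move; first exact: MoveR1.
    by rewrite -catA -(stable_run _ (stable_markov e byx)).
  by rewrite -catA; apply: strand_closure_closed byx.
by rewrite -catA.
Qed.

Theorem framed_ocneanu r m b : (m <= r)%N -> below m b ->
  framed m b = var_z ^- m * ocneanu r var_z var_a var_a^-1 m b.
Proof.
move=> lem; apply: (markov_trace_unique var_z_neq0 _ _ _ lem).
- by move=> k; apply: skein_invariant_framed.
- rewrite /framed /word_writhe big_nil expr0z mul1r.
  exact: (etrans (homfly_wordE unknot) (HOMFLYPT_unknot HP)).
- by move=> k e x y; apply: framed_markov.
Qed.

End Invariant.

(** * Lowest coefficients *)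

Section TranspWords.
Variable r : nat.
Implicit Types (w c v : 'S_r.+1) (t : transp r) (ts : seq (transp r * bool)).

Definition tword (x : transp r * bool) : seq (nat * bool) :=
  transp_word (val x.1).1 ((val x.1).2.-1 - (val x.1).1) x.2.

Definition tprod ts : 'S_r.+1 := perm_product [seq transp_perm x.1 | x <- ts].

Lemma tprod_cons x ts : tprod (x :: ts) = transp_perm x.1 ∘ tprod ts.
Proof. by []. Qed.

Lemma tprod_cat ts ts' : tprod (ts ++ ts') = tprod ts ∘ tprod ts'.
Proof. by rewrite /tprod map_cat perm_product_cat. Qed.

Lemma tword_endpoint t : ((val t).1 + ((val t).2.-1 - (val t).1)).+1 = (val t).2 :> nat.
Proof. by case: t => -[i j] /= lt; lia. Qed.

Lemma tword_prod x : braid_prod r (tword x) = transp_perm x.1.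
Proof.
have e := tword_endpoint x.1; rewrite /tword transp_word_prod.
  by rewrite e !inord_val.
by rewrite -ltnS e.
Qed.

(** Slid to the left, each factor becomes a transposition in front of [w], which lowers the defect
    by at most one. *)
Lemma cycle_defect_chain c ts w :
  (cycle_defect w <= cycle_defect (w ∘ (c^-1)%g ∘ tprod ts ∘ c) + size ts)%N.
Proof.
elim: ts w => [|[t e] ts IHts] w.
  by rewrite addn0 pcomp1 -pcompA [_ ∘ c]mulgV pcomp1.
set s := w ∘ (c^-1)%g; have := IHts (tperm (s (val t).1) (s (val t).2) ∘ w).
have -> : tperm (s (val t).1) (s (val t).2) ∘ w ∘ (c^-1)%g = s ∘ transp_perm t.
  by rewrite tperm_slide -pcompA.
rewrite tprod_cons pcompA /= => IH.
have le1 := cycle_defect_ge (s (val t).1) (s (val t).2) w.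
by rewrite addnS; apply: leq_trans le1 _; rewrite ltnS.
Qed.

(** The bound on the defect forces every factor to split a cycle. So the cycles of the final [W]
    refine those of each intermediate stage, and every pair that [layered] tests in the lifts is
    covered by the lemmas on splitting. *)
Lemma layered_transps c (cw : seq nat) w ts :
  interval_cycles c -> reduced_after (1%g : 'S_r.+1) cw -> word_prod r cw = c ->
  increasing_cycles w -> (forall p q, q \in porbit w p -> q \in porbit c p) ->
  let W := w ∘ (c^-1)%g ∘ tprod ts ∘ c in
  (cycle_defect W + size ts <= cycle_defect w)%N ->
  layered W (flatten (map tword ts) ++ [seq (i, true) | i <- cw]) (w ∘ (c^-1)%g)
  /\ (forall p q, q \in porbit W p -> q \in porbit w p).
Proof.
move=> int red cwc; elim: ts w => [|[t e] ts IHts] w inc sub W.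
  move=> _; have -> : W = w by rewrite /W pcomp1 -pcompA [_ ∘ c]mulgV pcomp1.
  by split=> //=; apply: (layered_reduced int inc sub red); rewrite ?pcomp1l ?pcomp1.
set s := w ∘ (c^-1)%g in W *; set i := (val t).1; set j := (val t).2.
pose w' := tperm (s i) (s j) ∘ w; move=> /= leW.
have lt_ij : (i < j)%N := valP t.
have sw' : w' ∘ (c^-1)%g = s ∘ tperm i j by rewrite tperm_slide // -pcompA.
have eW : W = w' ∘ (c^-1)%g ∘ tprod ts ∘ c by rewrite sw' /W tprod_cons pcompA.
have same : s j \in porbit w (s i).
  apply/negPn/negP => /cycle_defect_diff e'.
  have := cycle_defect_chain c ts w'; rewrite -eW e'; lia.
have ne : s i != s j.
  by rewrite (inj_eq perm_inj); apply: contraTneq lt_ij => ->; rewrite ltnn.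
have e1 := cycle_defect_same ne same.
have sub' p q : q \in porbit w' p -> q \in porbit w p by apply: split_sub.
have inc' : increasing_cycles w' by apply: split_increasing.
have subc p q : q \in porbit w' p -> q \in porbit c p by move/sub'/sub.
have [|lay subW] := IHts w' inc' subc; first by rewrite -eW -/w' in e1 *; lia.
rewrite -eW in lay subW; split; last by move=> p q /subW /sub'.
rewrite -catA layered_cat tword_prod -sw' lay andbT.
have ej := tword_endpoint t; rewrite /tword /= -/i -/j in ej *.
apply: layered_transp_word; first by rewrite -ltnS ej.
  by rewrite ej !inord_val; apply/negP => /subW; apply/negP; apply: split_apart.
move=> p ltp; have lepr : (p <= r)%N.
  by apply: leq_trans (_ : j <= r)%N; [lia | rewrite -ltnS].
have ltpj : (i < (inord p : 'I_r.+1) < j)%N by rewrite inordK //; lia.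
rewrite ej !inord_val; split; last first.
  by apply/negP => /subW; apply/negP; apply: split_right ltpj.
by move=> /subW; apply: split_left ltpj.
Qed.

End TranspWords.

(** The quadratic relation T_i^2 = 1 + z T_i, or its analogue for the inverse, carried through the
    conjugation. *)
Lemma hecke_transp_square r (R' : comNzRingType) (z : R') i d e (g : {ffun 'S_r.+1 -> R'^o}) :
  (i + d < r)%N ->
  @hecke r R' z (transp_word i d e) (@hecke r R' z (transp_word i d e) g)
  = g + (if e then z else - z) *: @hecke r R' z (transp_word i d e) g.
Proof.
elim: d i g => [|d IHd] i g lt.
  rewrite addn0 in lt; case: e => /=.
    by rewrite {1}heckeT_skein (heckeTK z false).
  have := heckeTK z false g lt; rewrite /= heckeT_skein linearD linearZ /=.
  by move/(canRL (addrK _)) => ->; rewrite scaleNr.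
rewrite /= !hecke_cat /= (heckeTK z false) ?IHd; try lia.
by rewrite linearD linearZ /= (heckeTK z true) //; lia.
Qed.

Section Leading.
Variable r : nat.
Notation R := {poly int}.
Notation V := {ffun 'S_r.+1 -> R^o}.
Implicit Types (w c v : 'S_r.+1) (b : seq (nat * bool)).
Local Notation hecke := (@hecke r R 'X).
Local Notation delta := (hecke1 r R).

Lemma coef_stay (x : nat * bool) v (p : R) k :
  (stay 'X x v * p)`_k
  = if desc v x.1 == x.2 then if k is k'.+1 then sign_val x.2 * p`_k' else 0 else 0.
Proof.
rewrite /stay; case: ifP => _; last by rewrite mul0r coef0.
by case: x.2; case: k => [|k]; rewrite /= ?mulNr ?coefN coefXM ?oppr0 ?mul1r ?mulN1r.
Qed.

(** Smoothing the first crossing multiplies the final permutation by a transposition. *)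
Lemma stay_defect v b i :
  v ∘ braid_prod r ((i, true) :: b)
  = tperm (v (inord i)) (v (inord i.+1)) ∘ (v ∘ braid_prod r b).
Proof. by rewrite braid_prod_cons pcompA tperm_slide // pcompA. Qed.

(** A smoothing costs one factor of the variable and lowers the defect by at most one; at the end of
    the word only the identity, of defect 0, has a nonzero value. *)
Lemma hecke_low b v k : (k < cycle_defect (v ∘ braid_prod r b))%N ->
  (hecke b delta v)`_k = 0.
Proof.
elim: b v k => [|[i e] b IHb] v k.
  rewrite pcomp1 ffunE; case: eqP => [->|_]; last by rewrite coef0.
  by rewrite cycle_defect1.
move=> ltk; rewrite ffunE coefD coef_stay /= IHb; last by move: ltk; rewrite braid_prod_cons pcompA.
rewrite add0r; case: ifP => // _; case: k ltk => // k.
rewrite -[braid_prod r _]/(braid_prod r ((i, true) :: b)) stay_defect => ltk.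
rewrite IHb ?mulr0 // -ltnS; apply: leq_trans ltk _; exact: cycle_defect_le.
Qed.

(** Only following each crossing contributes. Within one cycle of [w] the sign excludes the
    smoothing term; between two cycles smoothing merges them, and by [hecke_low] that term starts
    beyond the coefficient in question. *)
Lemma hecke_layered b v w : below r b -> layered w b v -> w = v ∘ braid_prod r b ->
  (hecke b delta v)`_(cycle_defect w) = (w == 1%g)%:R.
Proof.
elim: b v => [|[i e] b IHb] v bb.
  move=> _ ->; rewrite pcomp1 ffunE; case: eqP => [->|_]; last by rewrite coef0.
  by rewrite cycle_defect1 coef1.
case/andP: bb => /= lti bb /andP[/implyP lay layb] ew.
rewrite ffunE coefD coef_stay IHb //=; last by rewrite ew braid_prod_cons pcompA.
set o := (X in _ + X); suff -> : o = 0 by rewrite addr0.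
rewrite /o; case: ifP => // /eqP de.
have apart : v (inord i.+1) \notin porbit w (v (inord i)).
  apply/negP => /lay /eqP ee; move: de; rewrite ee /desc.
  case: ltngtP => // /val_inj /perm_inj /eqP; rewrite inord_eq //; lia.
have e1 := cycle_defect_diff apart.
have e2 : v ∘ braid_prod r b = tperm (v (inord i)) (v (inord i.+1)) ∘ w.
  rewrite ew (stay_defect v b i : v ∘ braid_prod r ((i, e) :: b) = _) pcompA.
  by rewrite /Defs.pcomp tperm2 mulg1.
by case k_def: (cycle_defect w) => [|k] //; rewrite hecke_low ?mulr0 // e2 e1 k_def.
Qed.

Lemma braid_prod_flatten (ts : seq (transp r * bool)) :
  braid_prod r (flatten (map (@tword r) ts)) = tprod ts.
Proof.
by elim: ts => //= x ts IHts; rewrite braid_prod_cat tword_prod IHts.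
Qed.

Lemma below_transp_word i d e : (i + d < r)%N -> below r (transp_word i d e).
Proof.
elim: d i => [|d IHd] i lt /=; first by rewrite addn0 in lt; rewrite lt.
by rewrite below_cat IHd /= ?andbT; lia.
Qed.

Lemma below_tword (x : transp r * bool) : below r (tword x).
Proof. by apply: below_transp_word; rewrite -ltnS tword_endpoint. Qed.

Lemma below_twords (ts : seq (transp r * bool)) : below r (flatten (map (@tword r) ts)).
Proof. by elim: ts => //= x ts IHts; rewrite below_cat below_tword. Qed.

(* P_c(t) and its inverse. *)
Definition pure_word (x : transp r * bool) : seq (nat * bool) :=
  tword x ++ tword x.

(** Recursive form of [sub_T] on pairs (sign, permutation), which decides letter by letter whether
    it is chosen; see [sub_count_sum]. *)
Fixpoint sub_count (l : seq (int * 'S_r.+1)) (k : nat) w : int :=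
  if l is (eta, a) :: l' then
    sub_count l' k w
    + (if k is k'.+1 then eta * sub_count l' k' ((a^-1)%g ∘ w) else 0)
  else ((k == 0%N) && (w == 1%g))%:R.

Section LeadingCoefficient.
Variables (c : 'S_r.+1) (cw : seq nat).
Hypotheses (int_c : interval_cycles c) (red : reduced_after (1%g : 'S_r.+1) cw)
  (cwc : word_prod r cw = c).
Let cword := [seq (i, true) | i <- cw].

Let cword_prod : braid_prod r cword = c.
Proof. by rewrite /braid_prod /cword -map_comp map_id. Qed.

Let below_cword : below r cword.
Proof. by case/andP: red => lt _; rewrite /below /cword all_map. Qed.

(** Either [k] is below the defect of the final permutation and [hecke_low] applies, or every factor
    of [ts] splits a cycle and the braid is layered. *)
Lemma leading_chosen (ts : seq (transp r * bool)) k :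
  (k + size ts <= cycle_defect c)%N ->
  (hecke (flatten (map (@tword r) ts) ++ cword) delta 1%g)`_k
  = ((k + size ts == cycle_defect c)%N && (tprod ts ∘ c == 1%g))%:R.
Proof.
move=> le; have inc := interval_cycles_increasing int_c.
have cc : c ∘ (c^-1)%g = 1%g by rewrite /Defs.pcomp mulVg.
have ew : c ∘ (c^-1)%g ∘ tprod ts ∘ c = tprod ts ∘ c by rewrite cc pcomp1l.
have chain := cycle_defect_chain c ts c; rewrite ew in chain.
have eprod : 1%g ∘ braid_prod r (flatten (map (@tword r) ts) ++ cword) = tprod ts ∘ c.
  by rewrite pcomp1l braid_prod_cat braid_prod_flatten cword_prod.
have [lt|ge] := ltnP k (cycle_defect (tprod ts ∘ c)).
  rewrite hecke_low ?eprod //; case: eqP => // _; case: eqP => // e1.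
  by rewrite e1 cycle_defect1 in lt.
have ek : (k + size ts = cycle_defect c)%N by lia.
have ek' : k = cycle_defect (tprod ts ∘ c) by lia.
rewrite ek eqxx /= {1}ek'.
have [|lay _] := layered_transps int_c red cwc (ts := ts) inc (fun p q h => h).
  by rewrite ew; lia.
rewrite ew cc in lay; apply: hecke_layered lay _; last by rewrite eprod.
by rewrite below_cat below_twords.
Qed.

Definition signed_perm (x : transp r * bool) : int * 'S_r.+1 :=
  (sign_val x.2, transp_perm x.1).

(** [ts] holds the letters chosen so far. Choosing one more costs a factor of the variable, so [k]
    drops by one and [k + size ts] is constant. *)
Lemma leading_word (l ts : seq (transp r * bool)) k :
  (k + size ts <= cycle_defect c)%N ->
  (hecke (flatten (map (@tword r) ts) ++ flatten (map pure_word l) ++ cword) delta 1%g)`_k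
  = if (k + size ts == cycle_defect c)%N then
      sub_count (map signed_perm l) k ((c ∘ tprod ts)^-1)%g else 0.
Proof.
elim: l ts k => [|[t e] l IHl] ts k le.
  rewrite leading_chosen //= invg_eq1; case: eqP => //= ek.
  have -> : (tprod ts ∘ c == 1%g) = (c ∘ tprod ts == 1%g).
    have swap (x y : 'S_r.+1) : x ∘ y = 1%g -> y ∘ x = 1%g.
      by move=> xy; apply: (mulIg x); rewrite -[LHS]/(x ∘ (y ∘ x)) pcompA xy pcomp1l mul1g.
    by apply/eqP/eqP; apply: swap.
  case: eqP => [e1|]; rewrite ?andbF ?andbT //.
  (* If [ts] multiplies to c^-1, it has at least [cycle_defect c] factors, which leaves nothing for
     [k]. *)
  have -> : k = 0%N; last by [].
  have eP : tprod ts = (c^-1)%g by apply/eqP; rewrite eq_mulgV1 invgK -/(c ∘ _) e1.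
  have := cycle_defect_chain c ts c.
  by rewrite eP /Defs.pcomp mulVg mulg1 mulgV cycle_defect1; lia.
have lt : ((val t).1 + ((val t).2.-1 - (val t).1) < r)%N by rewrite -ltnS tword_endpoint.
set z : R := if e then 'X else - 'X.
have -> : hecke (flatten (map (@tword r) ts) ++ flatten (map pure_word ((t, e) :: l))
                 ++ cword) delta
  = hecke (flatten (map (@tword r) ts) ++ flatten (map pure_word l) ++ cword) delta
    + z *: hecke (flatten (map (@tword r) (ts ++ [:: (t, e)]))
                  ++ flatten (map pure_word l) ++ cword) delta.
  rewrite map_cat flatten_cat /= cats0 -!catA !hecke_cat.
  by rewrite [X in hecke _ X = _](hecke_transp_square 'X e _ lt) addrC hecke_linear addrC.
rewrite [(_ + _ : V) _]ffunE [(_ *: _ : V) _]ffunE coefD IHl //=.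
have coefz (p : R) : (z * p)`_k = if k is k'.+1 then sign_val e * p`_k' else 0.
  by rewrite /z; case: (e); case: (k) => [|k'];
     rewrite /= ?mulNr ?coefN coefXM ?oppr0 ?mul1r ?mulN1r.
rewrite [_ *: _]/(_ * _) coefz; case: k le {coefz} => [|k] le; first by rewrite !addr0.
have szE : (k + size (ts ++ [:: (t, e)]) = k.+1 + size ts)%N.
  by rewrite size_cat /= addn1 addnS.
rewrite IHl szE //; case: ifP => _; last by rewrite mulr0 addr0.
congr (_ + _ * sub_count _ _ _).
rewrite tprod_cat tprod_cons pcomp1 pcompA /Defs.pcomp !invMg.
by rewrite -?mulgA.
Qed.

Theorem leading_sub_count (l : seq (transp r * bool)) k : (k <= cycle_defect c)%N ->
  (hecke (flatten (map pure_word l) ++ cword) delta 1%g)`_k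
  = if k == cycle_defect c then sub_count (map signed_perm l) k (c^-1)%g else 0.
Proof.
move=> le; have := leading_word l (ts := [::]) (k := k).
by rewrite /= addn0 pcomp1; apply.
Qed.

End LeadingCoefficient.

End Leading.

(** * Jucys-Murphy elements *)

Section JucysMurphyWords.
Variables (r : nat) (R : comNzRingType) (z : R).
Notation V := {ffun 'S_r.+1 -> R^o}.
Implicit Types (g : V).
Local Notation T := (heckeT z).
Local Notation hecke := (@hecke r R z).

Lemma hecke_transp_wordS i d e g :
  hecke (transp_word i d.+1 e) g
  = T (i, true) (hecke (transp_word i.+1 d e) (T (i, false) g)).
Proof. by rewrite /= hecke_cat. Qed.

(** For j = i + d + 1 this is s_j t_(i j+1) = t_(i j) s_j, which turns dual lifts of one column into
    those of the next. *)
Lemma transp_word_slide i d g : (i + d.+1 < r)%N ->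
  T ((i + d).+1, true) (hecke (transp_word i d.+1 true) g)
  = hecke (transp_word i d true) (T ((i + d).+1, true) g).
Proof.
elim: d i g => [|d IHd] i g lt; rewrite hecke_transp_wordS.
  by rewrite addn0 /= -heckeT_braid ?(heckeTK z true) //; lia.
rewrite -heckeT_far; try lia.
rewrite addnS -[((i + d).+2)]/((i.+1 + d).+1) IHd; last lia.
by rewrite -heckeT_far ?hecke_transp_wordS //; lia.
Qed.

Definition pure_pair (p : nat * nat) : seq (nat * bool) :=
  transp_word p.1 (p.2.-1 - p.1) true ++ transp_word p.1 (p.2.-1 - p.1) true.

Definition column (j : nat) : seq (nat * nat) := [seq (i, j) | i <- rev (iota 0 j)].

(** In s_m L s_m, moving the second s_m to the left turns each t_(i m) of the previous column into
    t_(i m+1); the two s_m then meet in the square for (m m+1). *)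
Lemma hecke_jm_column m g : (m <= r)%N ->
  hecke (jm m) g = hecke (flatten (map pure_pair (column m))) g.
Proof.
elim: m g => // m IHm g ltm; rewrite hecke_jmS IHm ?(ltnW ltm) //.
have -> : column m.+1 = (m, m.+1) :: [seq (i, m.+1) | i <- rev (iota 0 m)].
  by rewrite /column -[in iota _ _]addn1 iotaD rev_cat.
rewrite /= hecke_cat /pure_pair /= subnn /=; congr (T _ _).
rewrite /column -!map_comp.
have : all (fun i => i < m)%N (rev (iota 0 m)).
  by rewrite all_rev; apply/allP => i; rewrite mem_iota.
elim: (rev (iota 0 m)) g => //= i l IHl g /andP[lti ltl].
rewrite /pure_pair /= !hecke_cat.
have e1 : m = (i + (m.-1 - i)).+1 by lia.
have -> : (m.+1.-1 - i = (m.-1 - i).+1)%N by lia.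
have lt : (i + (m.-1 - i).+1 < r)%N by lia.
have slide h : T (m, true) (hecke (transp_word i (m.-1 - i).+1 true) h)
    = hecke (transp_word i (m.-1 - i) true) (T (m, true) h).
  by have := transp_word_slide h lt; rewrite -e1.
by rewrite !slide -IHl.
Qed.

End JucysMurphyWords.

(** * Signed subword counts *)

Section SubCount.
Variable r : nat.
Implicit Types (w : 'S_r.+1) (l : seq (int * 'S_r.+1)).

(** Equality is asked for all [k] and [w], so that it persists when letters are added in front. *)
Definition sub_count_eq l l' : Prop := forall k w, sub_count l k w = sub_count l' k w.

Lemma sub_count_eq_cat l1 l l' : sub_count_eq l l' -> sub_count_eq (l1 ++ l) (l1 ++ l').
Proof.
by move=> ll; elim: l1 => //= -[e a] l1 IHl1 [|k] w; rewrite /= !IHl1.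
Qed.

Lemma sub_count_swap x y l : x.2 ∘ y.2 = y.2 ∘ x.2 ->
  sub_count_eq (x :: y :: l) (y :: x :: l).
Proof.
case: x y => [e a] [f b] /= ab [|[|k]] w /=; rewrite ?addr0 //; first by rewrite addrAC.
have -> : (b^-1)%g ∘ ((a^-1)%g ∘ w) = (a^-1)%g ∘ ((b^-1)%g ∘ w).
  by rewrite !pcompA /Defs.pcomp -!invMg -/(b ∘ a) -/(a ∘ b) ab.
by ring.
Qed.

Lemma sub_count_move x l1 l2 : (forall y, y \in l1 -> x.2 ∘ y.2 = y.2 ∘ x.2) ->
  sub_count_eq (l1 ++ x :: l2) (x :: l1 ++ l2).
Proof.
elim: l1 => //= y l1 IHl1 com k w; rewrite [RHS]sub_count_swap; last first.
  by apply: com; rewrite inE eqxx.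
by apply: (@sub_count_eq_cat [:: y]); apply: IHl1 => u ul; apply: com; rewrite inE ul orbT.
Qed.

Lemma sub_count_move_seq l0 l1 l2 :
  (forall x y, x \in l0 -> y \in l1 -> x.2 ∘ y.2 = y.2 ∘ x.2) ->
  sub_count_eq (l1 ++ l0 ++ l2) (l0 ++ l1 ++ l2).
Proof.
elim: l0 => //= x l0 IHl0 com k w; rewrite sub_count_move; last first.
  by move=> y yl; apply: com; rewrite // inE eqxx.
apply: (@sub_count_eq_cat [:: x]) => {k w}; apply: IHl0.
by move=> u y ul yl; apply: com; rewrite // inE ul orbT.
Qed.

(** Each block [F j] commutes with the blocks [E i] after it, so all the [E] can move to the
    front. *)
Lemma sub_count_unzip (I : eqType) (E F : I -> seq (int * 'S_r.+1)) (s : seq I) (P : rel I) l :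
  (forall i j x y, P j i -> x \in E i -> y \in F j -> x.2 ∘ y.2 = y.2 ∘ x.2) ->
  pairwise P s ->
  sub_count_eq (flatten [seq E i ++ F i | i <- s] ++ l)
               (flatten [seq E i | i <- s] ++ flatten [seq F i | i <- s] ++ l).
Proof.
move=> com; elim: s => //= j s IHs /andP[/allP Pj pw] k w.
rewrite -!catA; apply: sub_count_eq_cat => {k w} k w.
rewrite (sub_count_eq_cat (F j) (IHs pw)).
rewrite sub_count_move_seq // => x y /flattenP[Ei /mapP[i ins ->] xE] yF.
by apply: com xE yF; apply: Pj.
Qed.

Definition pair_perm (p : nat * nat) : int * 'S_r.+1 :=
  (1, tperm (inord p.1) (inord p.2)).

Section RowsColumns.
Variable K : pred nat.

(* The product of the Jucys-Murphy elements lists the pairs by columns, the sorting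
   word of the longest element lists them by rows. *)
Definition columns (m : nat) : seq (nat * nat) :=
  flatten [seq column j | j <- rev (iota 1 m) & K j].

Definition row (m i : nat) : seq (nat * nat) :=
  [seq (i, j) | j <- rev (iota i.+1 (m - i)) & K j].

Definition rows (m : nat) : seq (nat * nat) :=
  flatten [seq row m i | i <- rev (iota 0 m)].

Lemma columnsS m : columns m.+1 = (if K m.+1 then column m.+1 else [::]) ++ columns m.
Proof.
have iotaS : iota 1 m.+1 = iota 1 m ++ [:: m.+1] by rewrite -(addn1 m) iotaD addnC.
rewrite /columns iotaS rev_cat filter_cat map_cat flatten_cat.
by congr (_ ++ _); rewrite /=; case: ifP; rewrite //= cats0.
Qed.

Lemma rowS m i : (i <= m)%N ->
  row m.+1 i = (if K m.+1 then [:: (i, m.+1)] else [::]) ++ row m i.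
Proof.
move=> le; have iotaS : iota i.+1 (m.+1 - i) = iota i.+1 (m - i) ++ [:: m.+1].
  by rewrite subSn // -(addn1 (m - i)) iotaD addSn subnKC.
by rewrite /row iotaS rev_cat filter_cat map_cat /=; case: ifP.
Qed.

(** The pairs (i, m + 1) move to the front. On their way they meet only pairs (j, j') with i < j <
    j' < m + 1; these are disjoint from them, so the transpositions commute. *)
Lemma rows_columns m l : (m <= r)%N ->
  sub_count_eq (map pair_perm (rows m) ++ l) (map pair_perm (columns m) ++ l).
Proof.
elim: m => // m IHm ltm k w.
pose E i := map pair_perm (if K m.+1 then [:: (i, m.+1)] else [::]).
pose F i := map pair_perm (row m i).
have -> : map pair_perm (rows m.+1) = flatten [seq E i ++ F i | i <- rev (iota 0 m.+1)].
  rewrite /rows map_flatten -map_comp; congr flatten; apply/eq_in_map => i.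
  by rewrite mem_rev mem_iota => lti; rewrite /= rowS -?map_cat //; lia.
rewrite (@sub_count_unzip _ E F _ gtn); first last.
- rewrite -sorted_pairwise; last by move=> a b d ba ad; apply: ltn_trans ad ba.
  by rewrite rev_sorted iota_ltn_sorted.
- move=> i j x y ltij /mapP[p pE ->] /mapP[q qF ->]; rewrite /=.
  have -> : p = (i, m.+1) by move: pE; case: ifP => // _; rewrite inE => /eqP.
  move: qF => /mapP[j']; rewrite mem_filter mem_rev mem_iota => /andP[_ lej] -> /=.
  by rewrite /gtn /= in ltij; apply: tperm_comm; rewrite inord_eq //; lia.
rewrite columnsS map_cat -catA.
have -> : flatten [seq E i | i <- rev (iota 0 m.+1)]
  = map pair_perm (if K m.+1 then column m.+1 else [::]).
  rewrite /E; case: ifP => _; last by elim: (rev _).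
  by rewrite /column -map_comp; elim: (rev _) => //= i s ->.
apply: sub_count_eq_cat => {k w} k w.
have -> : rev (iota 0 m.+1) = m :: rev (iota 0 m) by rewrite -addn1 iotaD rev_cat.
have Fm : F m = [::] by rewrite /F /row subnn.
rewrite /= Fm -IHm ?(ltnW ltm) // /rows map_flatten -map_comp.
by [].
Qed.

End RowsColumns.

Let upset n (J : {set 'I_n}) : {set 'I_n.+1} := [set lift ord0 j | j in J].

Let enum_setE n (A : {set 'I_n}) : enum A = [seq x <- enum 'I_n | x \in A].
Proof. by rewrite [in RHS]/enum_mem -filter_predI; apply: eq_filter => x; rewrite /= andbT. Qed.

Let enum_setS n (A : {set 'I_n.+1}) :
  enum A = [seq x <- ord0 :: map (lift ord0) (enum 'I_n) | x \in A].
Proof. by rewrite -enum_ordSl; apply: enum_setE. Qed.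

Let enum_upset n (J : {set 'I_n}) : enum (upset J) = map (lift ord0) (enum J).
Proof.
rewrite enum_setS /= filter_map [X in _ = map _ X]enum_setE.
have -> : (ord0 \in upset J) = false by apply/imsetP => -[j _] /eqP; rewrite (negPf (neq_lift _ _)).
by congr map; apply: eq_filter => j; rewrite /= mem_imset //; apply: lift_inj.
Qed.

Let enum_upset0 n (J : {set 'I_n}) :
  enum (ord0 |: upset J) = ord0 :: map (lift ord0) (enum J).
Proof.
rewrite enum_setS /= filter_map [X in _ = _ :: map _ X]enum_setE setU11.
congr (_ :: map _ _); apply: eq_filter => j; rewrite /= !inE mem_imset; last exact: lift_inj.
by rewrite eq_sym (negPf (neq_lift _ _)).
Qed.

Let sum_sets n (G : seq 'I_n.+1 -> int) :
  \sum_(I : {set 'I_n.+1}) G (enum I)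
  = \sum_(J : {set 'I_n}) (G (map (lift ord0) (enum J)) + G (ord0 :: map (lift ord0) (enum J))).
Proof.
rewrite big_split /= (bigID (fun I : {set 'I_n.+1} => ord0 \in I)) /= addrC.
have preK (I : {set 'I_n.+1}) j : (lift ord0 j \in upset (lift ord0 @^-1: I)) = (lift ord0 j \in I).
  by rewrite mem_imset ?inE //; apply: lift_inj.
have pre (J : {set 'I_n}) : lift ord0 @^-1: upset J = J.
  by apply/setP => j; rewrite inE mem_imset //; apply: lift_inj.
congr (_ + _).
  rewrite (reindex_onto (@upset n) (fun I => lift ord0 @^-1: I)) /=; last first.
    move=> I I0; apply/setP => i; case: (unliftP ord0 i) => [j ->|->]; first exact: preK.
    by rewrite (negPf I0); apply/imsetP => -[j _] /eqP; rewrite (negPf (neq_lift _ _)).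
  apply: eq_big => [J|J _]; last by rewrite enum_upset.
  rewrite pre eqxx andbT; apply/negP => /imsetP[j _] /eqP.
  by rewrite (negPf (neq_lift _ _)).
rewrite (reindex_onto (fun J => ord0 |: upset J) (fun I => lift ord0 @^-1: I)) /=; last first.
  move=> I I0; apply/setP => i; case: (unliftP ord0 i) => [j ->|->].
    by rewrite in_setU1 preK eq_sym (negPf (neq_lift _ _)).
  by rewrite setU11 I0.
apply: eq_big => [J|J _]; last by rewrite enum_upset0.
rewrite setU11 /=; apply/eqP; rewrite -[RHS]pre; apply/setP => j; rewrite !inE.
by rewrite eq_sym (negPf (neq_lift _ _)).
Qed.

(** Splitting the subsets of positions by whether they contain the first one gives the recursion of
    [sub_count]. *)
Lemma sub_count_sum (eta : seq int) (s : seq 'S_r.+1) k w : size eta = size s ->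
  \sum_(I : {set 'I_(size s)}
          | (#|I| == k) && (perm_product [seq nth 1%g s i | i : 'I_(size s) <- enum I] == w))
     \prod_(i in I) nth 0 eta i = sub_count (zip eta s) k w.
Proof.
(* With the condition inside the summand, everything depends on the list of chosen positions only,
   and shifting positions is a [map]. *)
pose H n (e : 'I_n -> int) (p : 'I_n -> 'S_r.+1) k w (l : seq 'I_n) : int :=
  if (size l == k) && (perm_product (map p l) == w) then \prod_(i <- l) e i else 0.
move=> sz; rewrite big_mkcond /=.
transitivity (\sum_(I : {set 'I_(size s)})
   H _ (fun i => nth 0 eta i) (fun i => nth 1%g s i) k w (enum I)).
  by apply: eq_bigr => I _; rewrite /H cardE big_enum.
elim: s eta k w sz => [|a s IHs] [|e eta] k w //=.
  move=> _; rewrite (big_pred1 set0) => [|I]; last first.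
    by apply/esym/eqP/setP => -[].
  by rewrite enum_set0 /H /= big_nil eq_sym [1%g == w]eq_sym; case: ifP.
case=> /IHs {}IHs; rewrite sum_sets big_split /=; congr (_ + _).
  rewrite -IHs; apply: eq_bigr => J _; rewrite /H size_map -map_comp big_map.
  by rewrite (eq_map (g := fun i : 'I_(size s) => nth 1%g s i)).
case: k => [|k]; first by rewrite big1.
rewrite -IHs mulr_sumr; apply: eq_bigr => J _.
rewrite /H /= size_map -map_comp big_cons big_map eqSS.
rewrite (eq_map (g := fun i : 'I_(size s) => nth 1%g s i)) //.
set q := perm_product _; have -> : (a ∘ q == w) = (q == (a^-1)%g ∘ w).
  by rewrite /Defs.pcomp; apply/eqP/eqP => [<-|->]; rewrite ?mulgK ?mulgKV.
by case: ifP; rewrite ?mulr0.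
Qed.

Lemma sub_T_count (eta : seq int) (s : seq 'S_r.+1) w : size eta = size s ->
  sub_T eta s w = sub_count (zip eta s) (cycle_defect w) w.
Proof. by rewrite -reflection_lengthE; apply: sub_count_sum. Qed.

End SubCount.

(** * Inversions of unimodal permutations *)

Section InversionsOfUnimodal.
Local Open Scope nat_scope.
Variable r : nat.
Implicit Types (K : {set 'I_r.+1}) (u : 'S_r.+1).

Lemma tperm_shortens u (i j : 'I_r.+1) : i < j ->
  (coxeter_length (tperm i j ∘ u) < coxeter_length u) = ((u^-1)%g j < (u^-1)%g i).
Proof.
move=> ltij; have -> : tperm i j ∘ u = u ∘ tperm ((u^-1)%g i) ((u^-1)%g j).
  by rewrite tperm_slide !permKV.
have [lt|lt|/val_inj/perm_inj e] := ltngtP ((u^-1)%g i) ((u^-1)%g j).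
- by rewrite ltn_coxeter_length_tperm // !permKV ltnNge (ltnW ltij).
- by rewrite tpermC ltn_coxeter_length_tperm // !permKV.
- by rewrite e ltnn in ltij.
Qed.

Definition all_pairs : seq (nat * nat) :=
  flatten [seq [seq (i, j) | j <- iota i.+1 (r - i)] | i <- iota 0 r].

Lemma all_pairsP p : p \in all_pairs -> p.1 < p.2 <= r.
Proof.
case/flattenP=> s /mapP[i]; rewrite mem_iota => /andP[_ lti] -> /mapP[j].
by rewrite mem_iota => ltj -> /=; lia.
Qed.

Lemma inversion_sequence_sorting ps : is_c_sorting r ps ->
  inversion_sequence r (sorting_letters r ps) = map (@tperm_pair r) all_pairs.
Proof.
move=> /c_sorting_letters ->; rewrite inversion_sequenceE.
have [|_ -> _] := @rows_run r r 0 1%g _ (@sorting_state1 r); first by [].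
congr (map _ (flatten _)); apply: eq_map => i.
by rewrite /row_pairs -(addn0 i.+1) iotaDl -map_comp; apply: eq_map.
Qed.

Definition column_pred K : pred nat := fun j => (inord j : 'I_r.+1) \in K.

(** A pair i < j is inverted exactly when j belongs to [K], whatever i is. So restricting to
    inversions keeps, in each row, the columns of [K]. *)
Lemma rev_inv_seq K ps : is_c_sorting r ps ->
  rev (inv_seq (sorting_letters r ps) (unimodal K))
  = map (@tperm_pair r) (rows (column_pred K) r).
Proof.
move=> cs; rewrite /inv_seq inversion_sequence_sorting // filter_map -map_rev.
congr map; rewrite (eq_in_filter (a2 := fun p : nat * nat => column_pred K p.2)).
  rewrite /all_pairs /rows /row filter_flatten rev_flatten -!map_comp -map_rev.
  congr flatten; apply: eq_map => i /=; rewrite filter_map -map_rev -filter_rev.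
  by [].
move=> [i j] /all_pairsP /= /andP[ltij lej].
have ltij' : (inord i : 'I_r.+1) < (inord j : 'I_r.+1) by rewrite !inordK //; lia.
rewrite /tperm_pair tperm_shortens //= unimodal_order /precedes.
by rewrite ltnNge (ltnW ltij') ltij'.
Qed.

Lemma coxeter_length_inversions u : coxeter_length u
  = \sum_(i < r.+1) \sum_(j < r.+1) ((i < j) && ((u^-1)%g j < (u^-1)%g i)).
Proof.
have -> : coxeter_length u
  = #|[set p : 'I_r.+1 * 'I_r.+1 | (p.1 < p.2) && ((u^-1)%g p.2 < (u^-1)%g p.1)]|.
  pose h (p : 'I_r.+1 * 'I_r.+1) := (u p.2, u p.1).
  have h_inj : injective h by move=> [a b] [a' b'] [] /perm_inj -> /perm_inj ->.
  rewrite /coxeter_length -(card_imset _ h_inj); congr #|pred_of_set _|.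
  apply/setP => -[i j]; rewrite inE /=; apply/imsetP/idP => [[[p q]]|/andP[lt1 lt2]].
    by rewrite inE /= => /andP[lt1 lt2] [-> ->]; rewrite !permK lt2 lt1.
  by exists ((u^-1)%g j, (u^-1)%g i); rewrite ?inE /h /= !permKV ?lt1 ?lt2.
rewrite -sum1_card pair_bigA /= big_mkcond /=.
by apply: eq_bigr => -[p q] _; rewrite inE /=; case: ifP.
Qed.

(** Matches the number of signs 1 in the theorem, given as a length, with the list of inversions,
    known by rows. *)
Lemma coxeter_length_unimodal K :
  coxeter_length (unimodal K) = size (rows (column_pred K) r).
Proof.
rewrite coxeter_length_inversions.
have -> : size (rows (column_pred K) r)
  = \sum_(0 <= i < r) \sum_(i.+1 <= j < r.+1) column_pred K j.
  rewrite /rows size_flatten /shape -map_comp sumnE big_map big_rev /index_iota subn0.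
  apply: eq_bigr => i _ /=; rewrite /row size_map size_filter -sumn_count sumnE big_map.
  by rewrite big_rev subSS.
have inner (i : 'I_r.+1) : \sum_(j < r.+1)
    ((i < j) && (((unimodal K)^-1)%g j < ((unimodal K)^-1)%g i))
   = \sum_(i.+1 <= j < r.+1) column_pred K j.
  have lei : i < r.+1 by [].
  transitivity (\sum_(0 <= j < r.+1) ((i < j) && column_pred K j)).
    rewrite big_mkord; apply: eq_bigr => j _; case: (ltnP i j) => //= lt.
    by rewrite unimodal_order /precedes /column_pred inord_val ltnNge (ltnW lt) lt.
  rewrite (big_cat_nat (n := i.+1)) //= big_nat_cond big1 ?add0n; last first.
    by move=> j; rewrite andbT ltnS => /andP[_ lej]; rewrite ltnNge lej.
  by rewrite big_nat_cond [RHS]big_nat_cond; apply: eq_bigr => j /andP[/andP[-> _] _].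
rewrite (eq_bigr _ (fun i _ => inner i)) big_ord_recr /= big_geq // addn0.
by rewrite big_mkord.
Qed.

End InversionsOfUnimodal.

(** Orders in z are read off over integer polynomials, while the invariant lives in the Laurent
    field; this compares the two. *)
Lemma hecke_map r (R R' : comNzRingType) (phi : {rmorphism R -> R'}) (z : R) b (v : 'S_r.+1) :
  phi (hecke z b (hecke1 r R) v) = hecke (phi z) b (hecke1 r R') v.
Proof.
elim: b v => [|[i e] b IHb] v; first by rewrite !ffunE; case: eqP; rewrite ?rmorph0 ?rmorph1.
rewrite !ffunE rmorphD rmorphM !IHb; congr (_ + _ * _).
by rewrite /stay /hsign; case: ifP => _; [case: e; rewrite /= ?rmorphN | rewrite rmorph0].
Qed.

(** * Expansion of the Jucys-Murphy product *)

Section Expansion.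
Variables (r : nat) (R : comNzRingType) (z a a' : R).
Notation V := {ffun 'S_r.+1 -> R^o}.
Implicit Types (g : V) (K : {set 'I_r.+1}).

Fixpoint jm_select (K : pred nat) (m : nat) : seq (nat * bool) :=
  if m is m'.+1 then (if K m then jm m else [::]) ++ jm_select K m' else [::].

Lemma hecke_jm_selectS (K : pred nat) m g :
  hecke z (jm_select K m.+1) g
  = hecke z (if K m.+1 then jm m.+1 else [::]) (hecke z (jm_select K m) g).
Proof. exact: hecke_cat. Qed.

Lemma hecke_jm_select (K : pred nat) m g : (m <= r)%N ->
  hecke z (jm_select K m) g = hecke z (flatten (map pure_pair (columns K m))) g.
Proof.
elim: m => // m IHm ltm; rewrite hecke_jm_selectS IHm ?(ltnW ltm) //.
rewrite columnsS map_cat flatten_cat hecke_cat.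
by case: ifP => // _; rewrite hecke_jm_column.
Qed.

Lemma eq_jm_select (K K' : pred nat) m : (forall j, (j <= m)%N -> K j = K' j) ->
  jm_select K m = jm_select K' m.
Proof.
elim: m => //= m IHm eqK; rewrite eqK // IHm // => j lej.
by apply: eqK; apply: leqW.
Qed.

Let D m : {set 'I_r.+1} := [set j : 'I_r.+1 | (0 < j <= m)%N].

Lemma jmprod_expand m g : (m <= r)%N ->
  jmprod z a a' m g = \sum_(K : {set 'I_r.+1} | K \subset D m)
    (a ^+ #|K| * (- a') ^+ (m - #|K|)) *: hecke z (jm_select (column_pred K) m) g.
Proof.
elim: m => [|m IHm] lem.
  rewrite (big_pred1 set0) => [|K]; last first.
    rewrite (_ : D 0 = set0) ?subset0 //; apply/setP => j; rewrite !inE; lia.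
  by rewrite cards0 !expr0 mul1r scale1r.
set q : 'I_r.+1 := inord m.+1; have qE : q = m.+1 :> nat by rewrite inordK.
have DS K : (K \subset D m) = (K \subset D m.+1) && (q \notin K).
  apply/subsetP/andP => [KD|[/subsetP KD qK] j jK].
    split; first by apply/subsetP => j /KD; rewrite !inE; lia.
    by apply/negP => /KD; rewrite inE qE; lia.
  have := KD j jK; rewrite !inE => /andP[-> le]; rewrite -ltnS ltn_neqAle le andbT.
  by apply: contraNneq qK => ej; rewrite (_ : q = j) //; apply/val_inj; rewrite /= inordK // ej.
have cardK K : K \subset D m -> (#|K| <= m)%N.
  move=> KD; apply: leq_trans (subset_leq_card KD) _.
  have -> : D m = [set lift ord0 j | j : 'I_r & (j < m)%N].
    apply/setP => j; rewrite inE; apply/idP/imsetP => [|[k + ->]].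
      case: (unliftP ord0 j) => [k ->|->] //=; rewrite /bump /= add1n => ltk.
      by exists k; rewrite ?inE.
    by rewrite inE /= /bump add1n.
  rewrite card_imset; last exact: lift_inj.
  by rewrite card_ord_lt //; lia.
have colq j : (j <= m)%N -> (inord j == q :> 'I_r.+1) = false.
  by move=> le; rewrite /q inord_eq //; lia.
rewrite [LHS]/(a *: hecke z (jm m.+1) (jmprod z a a' m g) - a' *: jmprod z a a' m g).
have lin (c : {set 'I_r.+1} -> R) (G : {set 'I_r.+1} -> V) :
    hecke z (jm m.+1) (\sum_(K : {set 'I_r.+1} | K \subset D m) c K *: G K)
    = \sum_(K : {set 'I_r.+1} | K \subset D m) c K *: hecke z (jm m.+1) (G K).
  by rewrite linear_sum; apply: eq_bigr => K _; rewrite linearZ.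
(* Sets that contain [q] come from the term a L of the last factor, the others from -a'. *)
rewrite IHm ?(ltnW lem) // lin [RHS](bigID (fun K => q \in K)); congr (_ + _).
  rewrite [RHS](reindex_onto (fun K => q |: K) (fun K => K :\ q)); last first.
    by move=> K /andP[_ qK]; rewrite setD1K.
  rewrite scaler_sumr; apply: eq_big => [K|K KD].
    rewrite DS setU11 andbT subUset sub1set !inE qE leqnn /=.
    by congr (_ && _); apply/idP/eqP => [qK|<-]; [rewrite setU1K | rewrite setD11].
  have qK : q \notin K by move: KD; rewrite DS => /andP[].
  rewrite scalerA cardsU1 qK add1n subSS exprS mulrA; congr (_ *: _).
  rewrite hecke_jm_selectS ifT; last by rewrite /column_pred -/q setU11.
  rewrite (@eq_jm_select (column_pred (q |: K)) (column_pred K)) // => j lej.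
  by rewrite /column_pred in_setU1 colq.
rewrite scaler_sumr -sumrN; apply: eq_big => [K|K KD]; first by rewrite DS.
rewrite scalerA -scaleNr subSn ?cardK // exprS; congr (_ *: _); first by ring.
have qK : q \notin K by move: KD; rewrite DS => /andP[].
by rewrite hecke_jm_selectS ifF // /column_pred -/q (negPf qK).
Qed.

End Expansion.

(** * From typed braid words to words in natural numbers *)

Section BraidWords.
Variable r : nat.
Implicit Types (b c : braid_word r) (t : transp r).

Lemma nat_word_cat b c : nat_word (b ++ c) = nat_word b ++ nat_word c.
Proof. exact: map_cat. Qed.

Definition word_inv (b : seq (nat * bool)) : seq (nat * bool) :=
  rev [seq (x.1, ~~ x.2) | x <- b].

Lemma word_inv_cat b c :
  word_inv (nat_word b ++ nat_word c) = word_inv (nat_word c) ++ word_inv (nat_word b).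
Proof. by rewrite /word_inv map_cat rev_cat. Qed.

Lemma nat_word_inv b : nat_word (braid_inv b) = word_inv (nat_word b).
Proof. by rewrite /nat_word /braid_inv /word_inv map_rev -!map_comp. Qed.

Lemma transp_word_inv i d e : word_inv (transp_word i d e) = transp_word i d (~~ e).
Proof.
elim: d i => //= d IHd i; rewrite -IHd /word_inv /= map_cat /= rev_cons rev_cat /=.
by rewrite -cats1.
Qed.

Lemma transp_wordE i d e : transp_word i d e
  = [seq (k, true) | k <- iota i d] ++ (i + d, e)%N :: word_inv [seq (k, true) | k <- iota i d].
Proof.
elim: d i => [|d IHd] i /=; first by rewrite addn0.
by rewrite IHd /word_inv /= rev_cons -cats1 -!catA addSnnS.
Qed.

Lemma nat_word_interval (m n : nat) : (n <= r)%N ->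
  nat_word (positive_braid [seq k : 'I_r <- enum 'I_r | (m <= k < n)%N])
  = [seq (k, true) | k <- iota m (n - m)].
Proof.
move=> len; rewrite /nat_word /positive_braid -map_comp.
have -> : iota m (n - m) = [seq k <- iota 0 r | (m <= k < n)%N].
  apply: (irr_sorted_eq ltn_trans ltnn); rewrite ?iota_ltn_sorted //.
    by apply: (sorted_filter ltn_trans); apply: iota_ltn_sorted.
  by move=> k; rewrite mem_filter !mem_iota; lia.
by rewrite -val_enum_ord filter_map -map_comp.
Qed.

Lemma nat_word_dual_lift t : nat_word (dual_lift t) = tword (t, true).
Proof.
rewrite /tword transp_wordE /dual_lift /=; case: t => -[i j] /= lt.
have lej : (j.-1 <= r)%N by have := ltn_ord j; lia.
rewrite !nat_word_cat nat_word_inv !nat_word_interval //; congr (_ ++ _).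
rewrite (eq_filter (a2 := fun k : 'I_r => (j.-1 <= k < j)%N)); last by move=> k /=; lia.
rewrite nat_word_interval; last by rewrite -ltnS.
have -> : (j - j.-1 = 1)%N by lia.
by rewrite /= subnKC //; lia.
Qed.

Lemma nat_word_pure t e : nat_word (braid_sign (dual_pure t) e) = pure_word (t, e).
Proof.
rewrite /pure_word /braid_sign /dual_pure; case: e.
  by rewrite nat_word_cat nat_word_dual_lift.
rewrite nat_word_inv nat_word_cat word_inv_cat nat_word_dual_lift.
by rewrite /tword transp_word_inv.
Qed.

Lemma nat_word_pure_seq (s : seq (transp r * bool)) :
  nat_word (flatten [seq braid_sign (dual_pure x.1) x.2 | x <- s])
  = flatten (map (@pure_word r) s).
Proof. by elim: s => //= -[t e] s IHs; rewrite nat_word_cat IHs nat_word_pure. Qed.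

Lemma nat_word_positive (s : seq 'I_r) :
  nat_word (positive_braid s) = [seq (i, true) | i <- map val s].
Proof. by rewrite /nat_word /positive_braid -!map_comp. Qed.

Section Framed.
Variables (P : link_diagram -> laurent_field) (HP : is_HOMFLYPT P).

Lemma framed_braid_eq b b' c : braid_eq b b' ->
  framed P r (nat_word (b ++ c)) = framed P r (nat_word (b' ++ c)).
Proof.
elim=> {b b'} [b b' [p [q [x [y [xy -> ->]]]]]|//|b b' _ ->|b b' b'' _ -> _ ->] //.
rewrite -!catA !nat_word_cat.
have below_w (w : braid_word r) : below r (nat_word w) := below_nat_word w.
have bqc : below r (nat_word q ++ nat_word c) by rewrite below_cat !below_w.
have inv := skein_invariant_framed HP r.
case: xy => [i e|i j ltij|i j ej].
- exact: (inv_move inv (WordCancel i e) (below_w p)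
    (below_w [:: (i, e); (i, ~~ e)]) (below_w [::]) bqc).
- apply: (inv_move inv (WordFar true true ltij) (below_w p) _ _ bqc).
    exact: (below_w [:: (i, true); (j, true)]).
  exact: (below_w [:: (j, true); (i, true)]).
have bx := below_w [:: (i, true); (j, true); (i, true)].
have by_ := below_w [:: (j, true); (i, true); (j, true)].
rewrite /nat_word /= ej in bx by_ *.
exact: (inv_move inv (WordBraid i) (below_w p) bx by_ bqc).
Qed.

Lemma framed_cancel b c c' :
  framed P r (nat_word (c ++ braid_inv b ++ b ++ c')) = framed P r (nat_word (c ++ c')).
Proof.
elim: b c => [|[i e] b IHb] c //.
have -> : braid_inv ((i, e) :: b) = braid_inv b ++ [:: (i, ~~ e)].
  by rewrite /braid_inv /= rev_cons cats1.
rewrite -catA /=.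
have below_w (w : braid_word r) : below r (nat_word w) := below_nat_word w.
have := inv_move (skein_invariant_framed HP r) (WordCancel i (~~ e))
  (below_w (c ++ braid_inv b)) (below_w [:: (i, ~~ e); (i, ~~ ~~ e)]) (below_w [::])
  (below_w (b ++ c')).
rewrite negbK -[[:: _; _] ++ _]/(nat_word ([:: (i, ~~ e); (i, e)] ++ b ++ c')) -!nat_word_cat /=.
by rewrite -!catA /= => ->; rewrite IHb.
Qed.

Lemma framed_nat_word b :
  framed P r (nat_word b) = var_a ^ writhe b * P (braid_closure b).
Proof.
rewrite /framed strand_closure_nat -(homfly_wordE P (braid_closure b)); congr (_ ^ _ * _).
by rewrite /word_writhe /writhe big_map.
Qed.

End Framed.
End BraidWords.

(** * Evaluation at z = 0 *)

Section ValueAtZero.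

Lemma frac_ofD p q : frac_of (p + q) = frac_of p + frac_of q.
Proof. exact: tofracD. Qed.

Lemma frac_ofM p q : frac_of (p * q) = frac_of p * frac_of q.
Proof. exact: tofracM. Qed.

Lemma frac_ofXn p n : frac_of (p ^+ n) = frac_of p ^+ n.
Proof. exact: tofracXn. Qed.

Lemma value_at_z0_0 : value_at_z0 0 0.
Proof. by exists 0%N, 0; rewrite horner0 /frac_of polyC0 rmorph0 mul0r. Qed.

Lemma value_at_z0_add x x' y y' :
  value_at_z0 x y -> value_at_z0 x' y' -> value_at_z0 (x + x') (y + y').
Proof.
move=> [m [p [-> ->]]] [m' [p' [-> ->]]].
have am k : var_a ^+ k != 0 by rewrite expf_neq0 ?var_a_neq0.
have fX k : frac_of (('X%:P) ^+ k) = var_a ^+ k by rewrite frac_ofXn.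
exists (m + m')%N, (p * ('X%:P) ^+ m' + p' * ('X%:P) ^+ m); split.
  by rewrite frac_ofD !frac_ofM !fX exprD addf_div.
rewrite hornerD !hornerM !horner_exp !hornerC polyCD !polyCM !polyC_exp.
by rewrite frac_ofD !frac_ofM !fX exprD addf_div.
Qed.

Lemma value_at_z0_mula (e : int) x y :
  value_at_z0 x y -> value_at_z0 (var_a ^ e * x) (var_a ^ e * y).
Proof.
move=> [m [p [-> ->]]].
have fX k : frac_of (('X%:P) ^+ k) = var_a ^+ k by rewrite frac_ofXn.
case: e => n.
  exists m, ('X%:P ^+ n * p); split; first by rewrite mulrA -exprnP -(fX n) -frac_ofM.
  by rewrite hornerM horner_exp hornerC polyCM polyC_exp mulrA -exprnP -(fX n) -frac_ofM.
exists (m + n.+1)%N, p; rewrite NegzE -exprnN.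
by split; rewrite exprD invfM mulrCA [X in _ = _ * X]mulrC.
Qed.

Lemma value_at_z0_sign (n : nat) x y :
  value_at_z0 x y -> value_at_z0 ((-1) ^+ n * x) ((-1) ^+ n * y).
Proof.
have sgn : frac_of (-1) = -1 by rewrite /frac_of tofracN tofrac1.
move=> [m [p [-> ->]]]; exists m, ((-1) ^+ n * p); split.
  by rewrite mulrA frac_ofM frac_ofXn sgn.
by rewrite hornerM horner_exp hornerN hornerC polyCM polyC_exp polyCN mulrA
           frac_ofM frac_ofXn sgn.
Qed.

(** A polynomial in z with integer coefficients: [polyC] makes the coefficients constant in a, and
    the variable becomes the outer one. *)
Definition const_in_a (q : {poly int}) : laurent_field := frac_of (map_poly polyC q).

Lemma value_at_z0_const q : value_at_z0 (const_in_a q) (q`_0)%:~R.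
Proof.
exists 0%N, (map_poly polyC q); rewrite expr0 !divr1; split=> //.
have polyC_int (S : nzRingType) (c : int) : (c%:~R)%:P = c%:~R :> {poly S}.
  by have := raddfMz (polyC : {additive S -> {poly S}}) c 1; rewrite /= polyC1.
rewrite horner_coef0 coef_map /= /frac_of -[in RHS](intz q`_0) !polyC_int.
by have := raddfMz (@tofrac {poly {poly int}}) q`_0 1 => /= ->; rewrite tofrac1.
Qed.

End ValueAtZero.

(** * The lowest order in z *)

Lemma columns_lt (K : pred nat) m p : p \in columns K m -> (p.1 < p.2 <= m)%N.
Proof.
case/flattenP=> s /mapP[j]; rewrite mem_filter mem_rev mem_iota => /andP[_ ltj] ->.
by case/mapP=> i; rewrite mem_rev mem_iota => lti -> /=; lia.
Qed.

Lemma pure_pairs_transp r (s : seq (nat * nat)) : all (fun p => p.1 < p.2 <= r)%N s ->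
  exists l : seq (transp r * bool),
    flatten (map pure_pair s) = flatten (map (@pure_word r) l)
    /\ map (@pair_perm r) s = map (@signed_perm r) l.
Proof.
elim: s => [|[i j] s IHs]; first by exists [::].
case/andP=> /= /andP[ltij lej] /IHs[l [eq_w eq_p]].
have lt : ((inord i : 'I_r.+1) < (inord j : 'I_r.+1))%N by rewrite !inordK //; lia.
pose t : transp r := exist _ (inord i, inord j) lt.
exists ((t, true) :: l) => /=; rewrite eq_w eq_p; split=> //.
  by rewrite /pure_pair /pure_word /tword /= !inordK //; lia.
Qed.

Section Leading.
Variables (r : nat) (c : 'S_r.+1) (cw : seq nat).
Hypotheses (int_c : interval_cycles c) (red : reduced_after (1%g : 'S_r.+1) cw)
  (cwc : word_prod r cw = c).
Variables (K : pred nat) (l : seq (transp r * bool)).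

Let p : {poly int} := hecke 'X (jm_select K r ++ flatten (map (@pure_word r) l)
                                ++ [seq (i, true) | i <- cw]) (hecke1 r _) 1%g.

Let count : int :=
  sub_count (map (@pair_perm r) (rows K r) ++ map (@signed_perm r) l)
            (cycle_defect c) (c^-1)%g.

Lemma selected_coef k : (k <= cycle_defect c)%N ->
  p`_k = if k == cycle_defect c then count else 0.
Proof.
move=> le; rewrite /p hecke_cat hecke_jm_select //.
have [|l0 [-> eq_p]] := @pure_pairs_transp r (columns K r).
  by apply/allP => q; apply: columns_lt.
rewrite -hecke_cat catA -flatten_cat -map_cat (leading_sub_count int_c red cwc) //.
by case: eqP => // ->; rewrite /count rows_columns // eq_p map_cat.
Qed.

(** The power of z split off here cancels the negative powers of the normalization; what remains can
    be evaluated at z = 0. *)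
Lemma selected_factor : exists2 q : {poly int}, p = q * 'X^(cycle_defect c) & q`_0 = count.
Proof.
exists (drop_poly (cycle_defect c) p).
  rewrite -[LHS](poly_take_drop (cycle_defect c)); set u := take_poly _ _.
  suff -> : u = 0 by rewrite add0r.
  apply/polyP => k; rewrite coef_take_poly coef0; case: ifP => // lt.
  by rewrite selected_coef ?(ltnW lt) // ltn_eqF.
by rewrite coef_drop_poly add0n selected_coef // eqxx.
Qed.

End Leading.

Lemma const_in_aXn q n : const_in_a (q * 'X^n) = const_in_a q * var_z ^+ n.
Proof. by rewrite /const_in_a rmorphM rmorphXn /= map_polyX frac_ofM frac_ofXn. Qed.

Lemma hecke_const_in_a r b (v : 'S_r.+1) :
  hecke var_z b (hecke1 r laurent_field) v = const_in_a (hecke 'X b (hecke1 r _) v).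
Proof.
pose phi : {rmorphism {poly int} -> laurent_field} :=
  (@tofrac {poly {poly int}} \o map_poly (@polyC int))%FUN.
rewrite [RHS](hecke_map phi) /=; congr (hecke _ _ _ _).
by rewrite map_polyX.
Qed.

Lemma sub_T_unimodal r (ps : seq nat) (cs : is_c_sorting r ps) (K : {set 'I_r.+1})
    (M : nat) (t : M.-tuple (transp r)) (eps : M.-tuple bool) (w : 'S_r.+1) :
  sub_T (nseq (coxeter_length (unimodal K)) 1 ++ map sign_val eps)
        (rev (inv_seq (sorting_letters r ps) (unimodal K)) ++ map (@transp_perm r) t) w
  = sub_count (map (@pair_perm r) (rows (column_pred K) r)
               ++ map (@signed_perm r) (zip t eps)) (cycle_defect w) w.
Proof.
rewrite rev_inv_seq // coxeter_length_unimodal sub_T_count; last first.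
  by rewrite !size_cat size_nseq !size_map !size_tuple.
rewrite zip_cat ?size_nseq ?size_map //; congr (sub_count (_ ++ _) _ _).
  by elim: (rows _ _) => //= q s <-.
have : size (tval t) = size (tval eps) by rewrite !size_tuple.
by elim: (tval t) (tval eps) => [|x s IHs] [|e es] //= [/IHs <-].
Qed.

Theorem theorem9p4 (P : link_diagram -> laurent_field) (HP : is_HOMFLYPT P)
    (r d : nat) (L : link_diagram) (L_components : num_components L = d)
    (beta : braid_word r) (beta_closure : isotopic (braid_closure beta) L)
    (lam : d.-tuple nat) (lam_type : tval lam = cycle_type (braid_perm beta))
    (g : 'S_r.+1)
    (g_conj : g ∘ braid_perm beta ∘ (g^-1)%g = c_lambda r lam)
    (gb : braid_word r) (gb_lift : braid_perm gb = g)
    (cw : seq 'I_r)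
    (cw_reduced : reduced_word (map val cw) (c_lambda r lam))
    (M : nat) (t : M.-tuple (transp r)) (eps : M.-tuple bool)
    (rho : braid_eq
       (gb ++ beta ++ braid_inv gb ++ braid_inv (positive_braid cw))
       (flatten [seq braid_sign (dual_pure x.1) x.2
                | x : transp r * bool <- zip t eps]))
    (ps : seq nat) (ps_sorting : is_c_sorting r ps) :
  value_at_z0 (var_z ^ (d%:Z - 1) * P L)
    (\sum_(0 <= k < r.+1)
       (-1) ^+ (r + k) *
       \sum_(u in initial_descents r k)
         (sub_T (nseq (coxeter_length u) 1 ++ map sign_val eps)
                (rev (inv_seq (sorting_letters r ps) u)
                 ++ map (@transp_perm r) t)
                (c_lambda r lam)^-1%g)%:~R
         * var_a ^ (- writhe beta - r%:Z + 2 * k%:Z)).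
Proof.
set c := c_lambda r lam in g_conj cw_reduced *.
have int_c : interval_cycles c.
  rewrite /c c_lambda_blocks; apply: interval_cycles_blocks.
  by rewrite lam_type sumn_cycle_type.
have [/= lt_cw cwc sz_cw] := and3P cw_reduced.
have cwc' : word_prod r (map val cw) = c := eqP cwc.
have red : reduced_after (1%g : 'S_r.+1) (map val cw).
  by rewrite /reduced_after lt_cw pcomp1l cwc' coxeter_length1 (eqP sz_cw) leqnn.
have card_c : #|porbits c| = d.
  by rewrite -g_conj card_porbits_conj -size_cycle_type -lam_type size_tuple.
have defect_c : (cycle_defect c + d = r.+1)%N.
  by rewrite /cycle_defect card_c subnK // -card_c card_porbits_le.
(* [W] represents rho times the positive lift of [c], which is a conjugate of [beta]. *)
set W := flatten (map (@pure_word r) (zip t eps)) ++ [seq (i, true) | i <- map val cw].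
have W_word : W = nat_word (flatten [seq braid_sign (dual_pure x.1) x.2
    | x : transp r * bool <- zip t eps] ++ positive_braid cw).
  by rewrite nat_word_cat nat_word_pure_seq nat_word_positive.
have framed_W : framed P r W = framed P r (nat_word beta).
  rewrite W_word -(framed_braid_eq HP _ rho) -!catA.
  have := framed_cancel HP (positive_braid cw) (gb ++ beta ++ braid_inv gb) [::].
  rewrite -!catA !cats0 => ->.
  rewrite nat_word_cat (framed_cyclic HP) ?below_nat_word // -nat_word_cat -catA.
  by have := framed_cancel HP gb beta [::]; rewrite !cats0.
have PL : P L = var_a ^ (- writhe beta) * framed P r W.
  rewrite framed_W framed_nat_word mulrA -expfzDr ?var_a_neq0 // addNr expr0z mul1r.
  by rewrite (HOMFLYPT_isotopic HP beta_closure).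
have [q qE q0] := fin_all_exists2 (fun K : {set 'I_r.+1} =>
  selected_factor int_c red cwc' (column_pred K) (zip t eps)).
have LHS_E : var_z ^ (d%:Z - 1) * P L = \sum_(K : {set 'I_r.+1} | ord0 \notin K)
    (-1) ^+ (r + #|K|) * (var_a ^ (- writhe beta - r%:Z + 2 * #|K|%:Z) * const_in_a (q K)).
  rewrite PL (framed_ocneanu HP (leqnn r)); last first.
    by rewrite W_word below_nat_word.
  rewrite /ocneanu jmprod_expand // sum_ffunE mulrCA mulr_sumr mulr_sumr mulr_sumr.
  apply: eq_big => [K|K K0].
    apply/subsetP/idP => [sub|K0 j jK]; first by apply/negP => /sub; rewrite inE.
    have lej : (j <= r)%N by rewrite -ltnS.
    rewrite inE lej andbT lt0n; apply: contraNneq K0 => j0.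
    by rewrite (_ : ord0 = j) //; apply/val_inj.
  have leK : (#|K| <= r)%N.
    rewrite -ltnS -[X in (_ < X)%N]card_ord -cardsT; apply: proper_card.
    apply/properP; split; [exact/subsetP|exists ord0 => //].
    by apply/negP => /(subsetP K0); rewrite inE.
  rewrite ffunE -hecke_cat hecke_const_in_a qE const_in_aXn.
  (* The size of [K] counts the factors a, the other factors of the product give a^-1, and the
     writhe comes from [framed]. *)
  have -> : var_a ^ (- writhe beta - r%:Z + 2 * #|K|%:Z)
    = var_a ^ (- writhe beta) * (var_a ^+ #|K| * var_a^-1 ^+ (r - #|K|)).
    rewrite exprVn exprnN [_ ^+ #|K|]exprnP -!expfzDr ?var_a_neq0 //; congr (_ ^ _); lia.
  have sgn : (-1) ^+ (r - #|K|) = (-1) ^+ (r + #|K|) :> laurent_field.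
    rewrite (_ : r + #|K| = (r - #|K|) + #|K|.*2)%N; last lia.
    by rewrite exprD -mul2n exprM sqrrN expr1n expr1n mulr1.
  (* The three exponents are d - 1, -r and r + 1 - d. *)
  have zE : var_z ^ (d%:Z - 1) * var_z ^- r * var_z ^+ cycle_defect c = 1.
    rewrite [_ ^- _]exprnN [_ ^+ cycle_defect c]exprnP -!expfzDr ?var_z_neq0 //.
    by rewrite -[RHS](expr0z var_z); congr (_ ^ _); lia.
  rewrite [(- var_a^-1) ^+ _]exprNn sgn.
  move: zE; move: (var_z ^ (d%:Z - 1)) (var_z ^- r) (var_z ^+ cycle_defect c) => z1 z2 z3 zE.
  rewrite -[_ *: _]/(_ * _).
  by rewrite -[RHS]mulr1 -zE; ring.
rewrite LHS_E.
pose F k u : laurent_field := (-1) ^+ (r + k) *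
  ((sub_T (nseq (coxeter_length u) 1 ++ map sign_val eps)
          (rev (inv_seq (sorting_letters r ps) u) ++ map (@transp_perm r) t)
          (c^-1)%g)%:~R * var_a ^ (- writhe beta - r%:Z + 2 * k%:Z)).
under eq_bigr => k _ do rewrite mulr_sumr.
rewrite (big_initial_descents _ F) /F.
apply: (big_ind2 value_at_z0); first exact: value_at_z0_0.
  by move=> *; apply: value_at_z0_add.
move=> K K0; apply: value_at_z0_sign; rewrite [_%:~R * _]mulrC.
(* [sub_T] selects by the reflection length of c^-1, which equals that of [c]. *)
apply: value_at_z0_mula; rewrite sub_T_unimodal // cycle_defectV -q0.
exact: value_at_z0_const.
Qed.
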